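(* Let $Q$ be an external potential satisfying the standing assumptions, with droplet $S$. Let $p=(p_n)_{n\ge 1}$ be a (possibly moving) point of $S$, i.e. any sequence of points $p_n\in S$ (a constant sequence being allowed), let $(\theta_n)_{n\ge1}$ be any sequence of real numbers, and let $K_n$ denote the correlation kernel rescaled about $p_n$ in the direction $e^{i\theta_n}$. (i) (Compactness) There is a sequence $(c_n)$ of cocycles such that every subsequence of $(c_nK_n)_{n\ge 1}$ has a further subsequence converging uniformly on compact subsets of $\mathbb{C}^2$. (ii) (Analyticity) Each limit point $K$ in (i) (locally uniform limit of a subsequence of $(c_nK_n)$) has the form $K=G\Psi$, where $\Psi$ is a Hermitian-entire function satisfying the mass-one inequality $$\int_{\mathbb{C}} e^{-|z-w|^2}\,|\Psi(z,w)|^2\,dA(w)\le \Psi(z,z),\qquad z\in\mathbb{C}.$$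
   Context: Notation: $dA(z)=d^2z/\pi$ is Lebesgue measure divided by $\pi$; $\Delta=\partial\bar\partial$ is one quarter of the usual Laplacian. Standing assumptions on the potential: $Q:\mathbb{C}\to\mathbb{R}\cup\{+\infty\}$ is lower semicontinuous, finite on some set of positive logarithmic capacity, and $\liminf_{\zeta\to\infty}Q(\zeta)/\log|\zeta|>2$. The equilibrium measure $\sigma$ is the unique minimizer of $I_Q[\mu]=\iint\log\frac1{|\zeta-\eta|}\,d\mu(\zeta)d\mu(\eta)+\int Q\,d\mu$ over compactly supported Borel probability measures $\mu$ on $\mathbb{C}$; the droplet is $S=\operatorname{supp}\sigma$. There is a neighbourhood $\Omega$ of $S$ in which $Q$ is real analytic and $\Delta Q>0$. Kernels: $\mathbf{K}_n$ is the reproducing kernel of the subspace $\mathcal{W}_n=\{q\,e^{-nQ/2}: q \text{ an analytic polynomial of degree}\le n-1\}$ of $L^2(\mathbb{C},dA)$, i.e. $\mathbf{K}_n(\zeta,\eta)=\sum_{j=0}^{n-1}q_j(\zeta)\overline{q_j(\eta)}e^{-nQ(\zeta)/2-nQ(\eta)/2}$ with $q_j$ the $j$-th orthonormal polynomial for the measure $e^{-nQ}dA$. It is a correlation kernel of the $n$-point process with density proportional to $\exp(-\sum_{j\ne k}\log\frac1{|\zeta_j-\zeta_k|}-n\sum_jQ(\zeta_j))$ on $\mathbb{C}^n$. Rescaling: $K_n(z,w)=\frac{1}{n\Delta Q(p_n)}\mathbf{K}_n(\zeta,\eta)$, where $z=e^{-i\theta_n}\sqrt{n\Delta Q(p_n)}\,(\zeta-p_n)$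 and $w=e^{-i\theta_n}\sqrt{n\Delta Q(p_n)}\,(\eta-p_n)$. The Ginibre kernel is $G(z,w)=e^{z\bar w-|z|^2/2-|w|^2/2}$. A continuous function $f:\mathbb{C}^2\to\mathbb{C}$ is Hermitian if $f(z,w)=\overline{f(w,z)}$, and Hermitian-entire if in addition it is entire as a function of $z$ and $\bar w$. A cocycle is a function $c(z,w)=g(z)\overline{g(w)}$ with $g:\mathbb{C}\to\mathbb{C}$ continuous and unimodular. *)

(* Defs.v *)
From HB Require Import structures.
From mathcomp Require Import all_boot all_order all_algebra.
From mathcomp Require Import complex.
From mathcomp Require Import all_classical all_reals all_analysis.

Set Implicit Arguments.
Unset Strict Implicit.
Unset Printing Implicit Defensive.

Import Order.TTheory GRing.Theory Num.Theory.
Import numFieldNormedType.Exports.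

Local Open Scope classical_set_scope.
Local Open Scope ring_scope.

(* The regular algebra [R[i]^o] is the alias of [R[i]] that carries the
   topology, the uniformity and the norm. *)
Notation Cplx R := ((complex (Real.sort R))^o).

(* Borel measures on the complex plane are measures on this product, whose
   sigma-algebra is the Borel sigma-algebra of R^2; see [toC]. *)
Notation plane R := (measurableTypeR R * measurableTypeR R)%type.

Section Plane.
Variable R : realType.
Local Notation C := (Cplx R).

Definition toC (u : plane R) : C := (u.1 +i* u.2)%C.

Definition cabs (z : C) : R := ComplexField.Normc.normc z.

Definition cexp (z : C) : C :=
  ((expR (complex.Re z) * cos (complex.Im z)) +i*
   (expR (complex.Re z) * sin (complex.Im z)))%C.

Fact invpi_ge0 : 0 <= (pi : R)^-1.
Proof. by rewrite invr_ge0 pi_ge0. Qed.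

(* [dA = d^2z / pi] *)
Definition dA : {measure set (plane R) -> \bar R} :=
  mscale (NngNum invpi_ge0) (@lebesgue_measure R \x @lebesgue_measure R)%E.

Definition L2 (f : C -> C) : Prop :=
  [/\ measurable_fun setT (fun u => complex.Re (f (toC u))),
      measurable_fun setT (fun u => complex.Im (f (toC u))) &
      (\int[dA]_u (cabs (f (toC u)) ^+ 2)%:E < +oo)%E].

Definition inner (f g : C -> C) : C :=
  let h u := (f (toC u) : R[i]%C) * conjc (g (toC u)) in
  ((\int[dA]_u complex.Re (h u)) +i* (\int[dA]_u complex.Im (h u)))%C.

End Plane.

Section Potential.
Variable R : realType.
Local Notation C := (Cplx R).
Implicit Types (Q : C -> \bar R) (mu : probability (plane R) R).

Definition supp mu : set C :=
  [set z | forall U : set C, open_nbhs z U -> (0 < mu (@toC R @^-1` U))%E].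

(* [lne 0 = -oo], so that the kernel is [+oo] on the diagonal. *)
Definition log_energy mu : \bar R :=
  (\int[mu]_u \int[mu]_v (- lne (cabs (toC u - toC v))%:E))%E.

Definition log_capacity (E : set C) : \bar R :=
  Order.max 0%E (ereal_sup
    [set expeR (- log_energy mu)%E
       | mu in [set mu | compact (supp mu) /\ supp mu `<=` E]]).

Definition weighted_energy Q mu : \bar R :=
  (log_energy mu + \int[mu]_u Q (toC u))%E.

(* Uniqueness of the minimizer is a theorem for admissible [Q], and is not part
   of the definition. *)
Definition is_equilibrium_measure Q mu : Prop :=
  compact (supp mu) /\
  forall nu : probability (plane R) R, compact (supp nu) ->
    (weighted_energy Q mu <= weighted_energy Q nu)%E.

Definition cplx_infty : set_system C :=
  filter_from [set: R] (fun r => [set z : C | r < cabs z]).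

Definition admissible_potential Q : Prop :=
  [/\ forall z, Q z != -oo%E,
      lower_semicontinuous Q,
      exists E : set C,
        (forall z, E z -> (Q z < +oo)%E) /\ (0 < log_capacity E)%E &
      (2%:E < limf_einf (fun z : C => Q z * ((ln (cabs z))^-1)%:E) cplx_infty)%E].

Definition real_analytic_at (f : C -> R) (z0 : C) : Prop :=
  exists (a : nat -> nat -> R) (r : R), 0 < r /\
  forall x y : R, `|x| < r -> `|y| < r ->
    summable [set: nat * nat]
      (fun jk => (a jk.1 jk.2 * x ^+ jk.1 * y ^+ jk.2)%:E) /\
    (fun N => \sum_(j < N) \sum_(k < N) a j k * x ^+ j * y ^+ k) @ \oo
      --> f (z0 + ((x +i* y)%C : C)).

(* One quarter of the usual Laplacian. *)
Definition laplacian (f : C -> R) (z : C) : R :=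
  4%:R^-1 *
  (derive1n 2 (fun x : R => f (x +i* complex.Im z)%C) (complex.Re z) +
   derive1n 2 (fun y : R => f (complex.Re z +i* y)%C) (complex.Im z)).

Definition lapQ Q : C -> R := laplacian (fun z => fine (Q z)).

Definition regular_near Q (S : set C) : Prop :=
  exists Omega : set C, [/\ open Omega, S `<=` Omega &
    forall z, Omega z ->
      [/\ Q z \is a fin_num, real_analytic_at (fun z => fine (Q z)) z
        & 0 < lapQ Q z]].

End Potential.

Section Kernels.
Variable R : realType.
Local Notation C := (Cplx R).
Implicit Types (Q : C -> \bar R) (K c : C -> C -> C).

(* [e^{-nQ/2}], which vanishes where [Q = +oo] (for [n > 0]). *)
Definition weight Q (n : nat) (z : C) : R :=
  fine (expeR (- ((n%:R / 2)%:E * Q z))%E).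

(* For an admissible [Q] the growth at infinity makes the [L2] condition
   automatic. *)
Definition weighted_polynomials Q (n : nat) : set (C -> C) :=
  [set f | L2 f /\ exists q : {poly R[i]%C}, (size q <= n)%N /\
     forall z : C, f z = q.[z] * (weight Q n z)%:C%C].

Definition is_reproducing_kernel (W : set (C -> C)) K : Prop :=
  (forall eta, W (fun zeta => K zeta eta)) /\
  forall f, W f -> forall eta, f eta = inner f (fun zeta => K zeta eta).

Definition rescaled_kernel Q (n : nat) (p : C) (theta : R) K : C -> C -> C :=
  let m : R := n%:R * lapQ Q p in
  let unscale z : C := p + (cexp (0 +i* theta)%C : R[i]%C) * z / (Num.sqrt m)%:C%C in
  fun z w => (m^-1)%:C%C * K (unscale z) (unscale w).

Definition ginibre : C -> C -> C := fun z w =>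
  cexp ((z : R[i]%C) * conjc w - (cabs z ^+ 2 / 2 + cabs w ^+ 2 / 2)%:C%C).

Definition hermitian K : Prop :=
  continuous (fun zw : C * C => K zw.1 zw.2) /\
  forall z w, K z w = conjc (K w z).

(* Holomorphy on C^2 is differentiability over the field [R[i]]. *)
Definition hermitian_entire K : Prop :=
  hermitian K /\
  exists F : C * C -> C, (forall x, differentiable F x) /\
    forall z w, K z w = F (z, conjc w).

Definition mass_one K : Prop := forall z : C,
  (\int[dA R]_u (expR (- cabs (z - toC u) ^+ 2) * cabs (K z (toC u)) ^+ 2)%:E
    <= (complex.Re (K z z))%:E)%E.

Definition cocycle c : Prop :=
  exists g : C -> C, [/\ continuous g, forall z, cabs (g z) = 1
    & forall z w, c z w = g z * conjc (g w)].

Definition cvg_locally_uniformly (f : nat -> C -> C -> C) (g : C -> C -> C) :=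
  {family compact, (fun n (zw : C * C) => f n zw.1 zw.2) @ \oo
     --> (fun zw : C * C => g zw.1 zw.2)}.

Definition increasing (phi : nat -> nat) : Prop :=
  {homo phi : m n / (m < n)%N}.

End Kernels.

(* Main.v *)
Require Import Defs.
From HB Require Import structures.
From mathcomp Require Import all_boot all_order all_algebra.
From mathcomp Require Import complex.
From mathcomp Require Import all_classical all_reals all_analysis.
From mathcomp Require Import ring lra zify measurable_realfun.
From mathcomp Require Import cyclic separable cyclotomic.

(** Let [h] be small and let [p] be a point of the droplet.  The part of the
second-order Taylor polynomial of [Q] at [p] that the Laplacian does not see is
harmonic, so that
[Q(p+h) = Q(p) + Re (al h + be h^2) + lapQ(p) |h|^2 + O(|h|^3)].
Real analyticity makes the constants locally uniform in [p], and compactness of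
the droplet makes them uniform ([uniform_quad_model]).  Under the rescaling,
[h] has modulus [|z| / sqrt (n lapQ(p))]: hence [n lapQ(p) |h|^2] is exactly
[|z|^2], and [n O(|h|^3)] tends to [0], locally uniformly in [z].

The weight [e^(-nQ/2)] at [p+h] is therefore the modulus of the holomorphic
function [e^(-n(Q(p) + al h + be h^2)/2)], times [e^(-|z|^2/2)], times [1+o(1)].
The cocycle [c_n] is built from the phase of that holomorphic function ([gauge]),
and [c_n K_n = G Psi_n (1+o(1))], where [Psi_n] is a polynomial in [z] and [conj w]
times the exponential of such a polynomial ([rescaled_form]).  The reproducing
property only provides a polynomial in the first variable for each value of the
second one; Hermitian symmetry and Lagrange interpolation at [n] nodes make the
kernel jointly polynomial ([kernel_poly]).

Local boundedness of [Psi_n] comes from the sub-mean value inequality for the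
square of the modulus of a holomorphic function on a disc of radius comparable to
[1 / sqrt n]: every weighted polynomial [f] satisfies
[|f(p+h)|^2 <= C n lapQ(p) ||f||^2] ([weighted_poly_bound]).  For [f = K(., eta)]
the squared norm is [K(eta, eta)], so the inequality bounds first the diagonal of
the kernel and then the kernel itself ([rescaled_kernel_bound]).

Holomorphic functions of two variables enter as locally uniform limits of
polynomials ([approx2]).  The functions [Psi_n] are of this kind because [e^z] is
the locally uniform limit of [(1+z/N)^N].  For a polynomial, Cauchy's estimates
and the mean value property are identities on averages over roots of unity; with
Bolzano and Weierstrass they give Montel's theorem ([montel_approx]) and the
Taylor expansions of the limits ([limit_taylor]), which are thus entire
([approx2_differentiable]).  This proves (i), the limits being [G Psi] with [Psi]
entire in [z] and [conj w].

For (ii), a limit point of [c_n K_n] is also the limit of a further subsequence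
produced by (i), hence it has the form [G Psi].  Hermitian symmetry passes to the
limit ([limit_herm]).  Since [|G(z,w)|^2 = e^(-|z-w|^2)] and [G(z,z) = 1], the
mass-one inequality is what Fatou's lemma leaves of the reproducing identity
[int |K_n(z,w)|^2 dA(w) = K_n(z,z)] ([limit_mass]). *)

Set Implicit Arguments.
Unset Strict Implicit.
Unset Printing Implicit Defensive.

Import Order.TTheory GRing.Theory Num.Theory.
Import numFieldNormedType.Exports.

Local Open Scope classical_set_scope.
Local Open Scope ring_scope.

(** * The modulus and the exponential of complex numbers *)
Section Cabs.
Variable R : realType.
Local Notation C := (R[i]%C).
Implicit Types z w : C.

Lemma cabs_ge0 z : 0 <= cabs z.
Proof. by case: z => a b; rewrite /cabs /= sqrtr_ge0. Qed.

Lemma cabs_sqr z : cabs z ^+ 2 = complex.Re z ^+ 2 + complex.Im z ^+ 2.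
Proof. by case: z => a b; rewrite /cabs /= sqr_sqrtr // addr_ge0 // sqr_ge0. Qed.

Lemma norm_complexE z : `|z| = (cabs z)%:C%C.
Proof. by case: z. Qed.

Lemma cabs0 : cabs (0 : C) = 0. Proof. exact: ComplexField.Normc.normc0. Qed.
Lemma cabs1 : cabs (1 : C) = 1. Proof. exact: ComplexField.Normc.normc1. Qed.
Lemma cabs_eq0 z : cabs z = 0 -> z = 0.
Proof. exact: ComplexField.Normc.eq0_normc. Qed.
Lemma cabsM z w : cabs (z * w) = cabs z * cabs w.
Proof. exact: ComplexField.Normc.normcM. Qed.
Lemma cabsV z : cabs z^-1 = (cabs z)^-1.
Proof. exact: ComplexField.Normc.normcV. Qed.
Lemma cabsD z w : cabs (z + w) <= cabs z + cabs w.
Proof. exact: le_normcD. Qed.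
Lemma cabsN z : cabs (- z) = cabs z.
Proof. exact: normcN. Qed.
Lemma cabsBC z w : cabs (z - w) = cabs (w - z).
Proof. by rewrite -cabsN opprB. Qed.
Lemma cabsB z w : cabs (z - w) <= cabs z + cabs w.
Proof. by rewrite -(cabsN w); exact: cabsD. Qed.
Lemma cabsX z n : cabs (z ^+ n) = cabs z ^+ n.
Proof. by elim: n => [|n IH]; rewrite ?expr0 ?cabs1 // !exprS cabsM IH. Qed.
Lemma cabs_conj z : cabs (conjc z) = cabs z.
Proof. by case: z => a b; rewrite /cabs /= sqrrN. Qed.
Lemma cabs_real (x : R) : cabs (x%:C%C) = `|x|.
Proof. by rewrite /cabs /= expr0n /= addr0 sqrtr_sqr. Qed.
Lemma cabs_Re z : `|complex.Re z| <= cabs z.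
Proof. by rewrite -(ler_pXn2r (n:=2)) ?nnegrE ?normr_ge0 ?cabs_ge0 // cabs_sqr real_normK ?num_real // lerDl sqr_ge0. Qed.
Lemma cabs_Im z : `|complex.Im z| <= cabs z.
Proof. by rewrite -(ler_pXn2r (n:=2)) ?nnegrE ?normr_ge0 ?cabs_ge0 // cabs_sqr real_normK ?num_real // lerDr sqr_ge0. Qed.
Lemma cabs_le_ReIm z : cabs z <= `|complex.Re z| + `|complex.Im z|.
Proof.
rewrite -(ler_pXn2r (n:=2)) ?nnegrE ?addr_ge0 ?normr_ge0 ?cabs_ge0 // cabs_sqr sqrrD.
rewrite !real_normK ?num_real //; set p := _ * _; have : 0 <= p by rewrite mulr_ge0.
move=> p0; rewrite mulr2n; lra.
Qed.
Lemma cabs_sum (I : Type) (r : seq I) (P : pred I) (F : I -> C) :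
  cabs (\sum_(i <- r | P i) F i) <= \sum_(i <- r | P i) cabs (F i).
Proof.
elim/big_rec2: _ => [|i x y _ h]; first by rewrite cabs0.
by apply: le_trans (cabsD _ _) _; rewrite lerD2l.
Qed.
Lemma cabs_nat n : cabs (n%:R : C) = n%:R.
Proof.
have -> : (n%:R : C) = (n%:R : R)%:C%C by rewrite rmorph_nat.
by rewrite cabs_real ger0_norm.
Qed.
Lemma cabs_mulconj z : (z * conjc z) = (cabs z ^+ 2)%:C%C.
Proof.
rewrite cabs_sqr; case: z => a b /=; rewrite /GRing.mul /=.
by congr Complex; ring.
Qed.
Lemma ReCD z w : complex.Re (z + w) = complex.Re z + complex.Re w.
Proof. by case: z w => a b [c d]. Qed.
Lemma ImCD z w : complex.Im (z + w) = complex.Im z + complex.Im w.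
Proof. by case: z w => a b [c d]. Qed.
Lemma ReCN z : complex.Re (- z) = - complex.Re z.
Proof. by case: z. Qed.
Lemma ImCN z : complex.Im (- z) = - complex.Im z.
Proof. by case: z. Qed.
Lemma ReCM z w : complex.Re (z * w) = complex.Re z * complex.Re w - complex.Im z * complex.Im w.
Proof. by case: z w => a b [c d]. Qed.
Lemma ImCM z w : complex.Im (z * w) = complex.Re z * complex.Im w + complex.Im z * complex.Re w.
Proof. by case: z w => a b [c d]. Qed.
Lemma complex_ext z w : complex.Re z = complex.Re w -> complex.Im z = complex.Im w -> z = w.
Proof. by case: z w => a b [c d] /= -> ->. Qed.

Lemma cexp0 : cexp (0 : C) = 1.
Proof. by rewrite /cexp /= expR0 cos0 sin0 !mul1r. Qed.
Lemma cexpD z w : cexp (z + w) = cexp z * cexp w :> C.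
Proof.
rewrite /cexp ReCD ImCD; apply: complex_ext; rewrite ?ReCM ?ImCM /= expRD ?cosD ?sinD; ring.
Qed.
Lemma cexp_conj z : cexp (conjc z) = conjc (cexp z) :> C.
Proof. by case: z => a b; rewrite /cexp /= cosN sinN mulrN. Qed.
Lemma cabs_cexp z : cabs (cexp z) = expR (complex.Re z).
Proof.
apply/eqP; rewrite -(eqrXn2 (n:=2)) ?cabs_ge0 ?expR_ge0 //; rewrite cabs_sqr /=.
by rewrite !exprMn -mulrDr cos2Dsin2 mulr1.
Qed.
Lemma cexpMn z n : cexp (z *+ n) = cexp z ^+ n :> C.
Proof.
elim: n => [|n IH]; first by rewrite mulr0n expr0 cexp0.
by rewrite mulrS exprS -IH cexpD.
Qed.
Lemma cexp_real (x : R) : cexp (x%:C%C : C) = (expR x)%:C%C.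
Proof. by rewrite /cexp /= cos0 sin0 mulr1 mulr0. Qed.

Lemma sin_le_norm (y : R) : `|sin y| <= `|y|.
Proof.
wlog y0 : y / 0 <= y.
  move=> h; have [/h//|/ltW y0] := lerP 0 y.
  by rewrite -(normrN y) -(normrN (sin y)) -sinN; apply: h; rewrite oppr_ge0.
have hd x : x \in `]0, y[ -> is_derive x 1 (@sin R) (cos x) by move=> _; exact: is_derive_sin.
have hc : {within `[0, y], continuous (@sin R)}.
  by apply: continuous_subspaceT => x; exact: continuous_sin.
have [c _] := MVT_segment y0 hd hc.
rewrite sin0 !subr0 => ->.
by rewrite normrM ler_piMl // ler_norml cos_geN1 cos_le1.
Qed.

Lemma cos_taylor (y : R) : `|cos y - 1| <= y ^+ 2.
Proof.
have e : cos y = 1 - 2 * sin (y / 2) ^+ 2.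
  have -> : cos y = cos (y / 2 + y / 2) by congr cos; field.
  rewrite cosD -!expr2; have := cos2Dsin2 (y / 2); lra.
have := sin_le_norm (y / 2); rewrite -(ler_pXn2r (n:=2)) ?nnegrE ?normr_ge0 //.
rewrite !real_normK ?num_real // e expr_div_n => h.
have := sqr_ge0 (sin (y/2)); have := sqr_ge0 y; move: h.
have -> : (2 : R) ^+ 2 = 4 by rewrite -natrX.
move=> h1 h2 h3; rewrite ler0_norm; lra.
Qed.

Lemma sin_taylor (y : R) : `|y| <= 1 -> `|sin y - y| <= y ^+ 2.
Proof.
wlog y0 : y / 0 <= y.
  move=> h; have [/h//|/ltW y0] := lerP 0 y.
  rewrite -(normrN y) => y1; rewrite -(sqrrN y) -(normrN (sin y - y)) opprD -sinN.
  by apply: h => //; rewrite oppr_ge0.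
move=> y1.
have hd x : x \in `]0, y[ -> is_derive x 1 (fun x => sin x - x) (cos x - 1).
  by move=> _; apply: is_deriveB.
have hc : {within `[0, y], continuous (fun x => sin x - x)}.
  by apply: continuous_subspaceT => x; apply: cvgB; [exact: continuous_sin|exact: cvg_id].
have [c] := MVT_segment y0 hd hc.
rewrite in_itv /= sin0 !subr0 => /andP[c0 cy] ->; rewrite normrM (ger0_norm y0).
rewrite expr2 ler_wpM2r //; apply: le_trans (cos_taylor c) _.
rewrite expr2; have cc : c <= 1 by move: y1; rewrite ger0_norm // => /(le_trans cy).
by apply: le_trans cy; rewrite ler_piMl.
Qed.

(** The upper bound for [expR x] is the reciprocal of the convexity bound
[1 - x <= expR (- x)]. *)
Lemma expR_taylor (x : R) : `|x| <= 2^-1 -> `|expR x - 1 - x| <= 2 * x ^+ 2.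
Proof.
rewrite ler_norml => /andP[x1 x2].
have h1 := expR_ge1Dx x; have h2 := expR_ge1Dx (- x).
have e : expR x * expR (- x) = 1 by rewrite -expRD subrr expR0.
have h3 := expR_gt0 x; rewrite ger0_norm; last lra.
nra.
Qed.

Lemma cexp_taylor z : cabs z <= 2^-1 -> cabs (cexp z - 1 - z) <= 8 * cabs z ^+ 2.
Proof.
move=> hz; have hx := le_trans (cabs_Re z) hz; have hy := le_trans (cabs_Im z) hz.
apply: le_trans (cabs_le_ReIm _) _; rewrite cabs_sqr.
rewrite !ReCD !ImCD !ReCN !ImCN /=.
move: (complex.Re z) (complex.Im z) hx hy => x y hx hy.
have hy1 : `|y| <= 1 by lra.
have h1 := expR_taylor hx; have h2 := cos_taylor y; have h3 := sin_taylor hy1.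
have h4 := sin_le_norm y.
have hE : expR x <= 2.
  move: h1 hx; rewrite !ler_norml => /andP[_ a] /andP[b c]; nra.
have E0 := expR_gt0 x.
have hE1 : `|expR x - 1| <= 2 * `|x|.
  have := h1; have : x ^+ 2 <= 2^-1 * `|x|.
    by rewrite -(real_normK (num_real x)) expr2 ler_wpM2r.
  have := ler_normD (expR x - 1 - x) x; rewrite subrK; lra.
have e1 : `|expR x * cos y - 1 - x| <= 2 * x ^+ 2 + 2 * y ^+ 2.
  have -> : expR x * cos y - 1 - x = (expR x - 1 - x) + expR x * (cos y - 1) by ring.
  apply: le_trans (ler_normD _ _) _; apply: lerD => //.
  by rewrite normrM (gtr0_norm E0); apply: ler_pM => //; exact: ltW.
have e2 : `|expR x * sin y - 0 - y| <= 2 * (`|x| * `|y|) + y ^+ 2.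
  have -> : expR x * sin y - 0 - y = (expR x - 1) * sin y + (sin y - y) by ring.
  apply: le_trans (ler_normD _ _) _; apply: lerD => //.
  by rewrite normrM mulrA; apply: ler_pM.
have : `|x| * `|y| <= x ^+ 2 + y ^+ 2.
  rewrite -(real_normK (num_real x)) -(real_normK (num_real y)).
  by have := sqr_ge0 (`|x| - `|y|); have := normr_ge0 x; have := normr_ge0 y; nra.
move: e1 e2; rewrite oppr0 addr0 ?subr0; have := sqr_ge0 x; have := sqr_ge0 y; lra.
Qed.

Lemma subrX_bound z w (m : R) n : cabs z <= m -> cabs w <= m ->
  cabs (z ^+ n.+1 - w ^+ n.+1) <= n.+1%:R * cabs (z - w) * m ^+ n.
Proof.
move=> hz hw; have m0 : 0 <= m := le_trans (cabs_ge0 z) hz.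
rewrite subrXX cabsM -[n.+1%:R * _]mulrC -mulrA ler_wpM2l ?cabs_ge0 //.
apply: le_trans (cabs_sum _ _ _) _.
rewrite -[in n.+1%:R](card_ord n.+1) -sum1_card natr_sum mulr_suml; apply: ler_sum => i _.
rewrite mul1r cabsM !cabsX.
have -> : m ^+ n = m ^+ (n.+1.-1 - i) * m ^+ i by rewrite -exprD /= subnK // -ltnS.
by apply: ler_pM; rewrite ?exprn_ge0 ?cabs_ge0 // lerXn2r ?nnegrE ?cabs_ge0.
Qed.

(** Makes exponentials locally uniform limits of polynomials: [exp z] and
[(1 + z/N)^N] are the [N]th powers of two numbers of modulus at most
[exp (M/N)] that differ by [O(1/N^2)], and passing to the [N]th powers multiplies
the difference by at most [N exp M]. *)
Lemma cexp_approx (M e : R) : 0 < e -> exists N : nat, forall z, cabs z <= M ->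
  cabs (cexp z - (1 + z / N%:R) ^+ N) <= e.
Proof.
move=> e0; pose M' := Num.max M 1; have M1 : 1 <= M' by rewrite le_max lexx orbT.
(* The term [2 M'] puts [z / N] in the range of [cexp_taylor]; the other one makes
   the total error at most [e]. *)
pose N := (Num.truncn (2 * M' + 8 * M' ^+ 2 * expR M' / e)).+1.
have hN : 2 * M' + 8 * M' ^+ 2 * expR M' / e < N%:R.
  by rewrite /N; have := truncnS_gt (2 * M' + 8 * M' ^+ 2 * expR M' / e).
exists N => z hz'; have hz : cabs z <= M' by rewrite le_max hz'.
have K0 : 0 <= 8 * M' ^+ 2 * expR M'.
  by apply: mulr_ge0 (expR_ge0 _); apply: mulr_ge0 (sqr_ge0 _).
have N0 : 0 < N%:R :> R by rewrite ltr0n.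
have zN : cabs (z / N%:R) = cabs z / N%:R by rewrite cabsM cabsV cabs_nat.
have hN2 : cabs (z / N%:R) <= 2^-1.
  rewrite zN ler_pdivrMr //; have := divr_ge0 K0 (ltW e0); lra.
have {1}-> : z = (z / N%:R) *+ N.
  by rewrite -mulr_natr mulfVK // pnatr_eq0.
rewrite cexpMn; set u := z / N%:R in zN hN2 *.
pose m := expR (M' / N%:R).
have hu : cabs u <= M' / N%:R by rewrite zN ler_wpM2r // invr_ge0 ltW.
have h1 : cabs (cexp u) <= m.
  rewrite cabs_cexp ler_expR; apply: le_trans (ler_norm _) _.
  exact: le_trans (cabs_Re _) hu.
have h2 : cabs (1 + u) <= m.
  apply: le_trans (cabsD _ _) _; rewrite cabs1.
  by apply: le_trans (expR_ge1Dx _); rewrite lerD2l.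
apply: le_trans (subrX_bound _ h1 h2) _.
have h3 : m ^+ N.-1 <= expR M'.
  rewrite -expRM_natl ler_expR mulrCA ler_piMr ?(le_trans ler01) //.
  by rewrite ler_pdivrMr // mul1r ler_nat.
have h4 : cabs (cexp u - (1 + u)) <= 8 * (M' / N%:R) ^+ 2.
  rewrite opprD addrA; apply: le_trans (cexp_taylor hN2) _.
  rewrite ler_wpM2l // lerXn2r ?nnegrE ?cabs_ge0 //; exact: le_trans (cabs_ge0 _) hu.
have h5 : N%:R * (8 * (M' / N%:R) ^+ 2) * expR M' <= e.
  have -> : N%:R * (8 * (M' / N%:R) ^+ 2) * expR M' = 8 * M' ^+ 2 * expR M' / N%:R.
    by field; rewrite lt0r_neq0.
  rewrite ler_pdivrMr // -ler_pdivrMl // mulrC; lra.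
apply: le_trans h5; apply: ler_pM => //.
- by rewrite mulr_ge0 ?cabs_ge0 // ltW.
- by rewrite exprn_ge0 // expR_ge0.
- by rewrite ler_wpM2l // ltW.
Qed.
End Cabs.

(** * Polynomials in two complex variables and Cauchy's estimates *)
Section Pol2.
Variable R : realType.
Local Notation C := (R[i]%C).
Implicit Types z u w : C.

(** The outer variable of [P] is [u] and its coefficients are polynomials
in [z]. *)
Definition pol2 (f : C -> C -> C) :=
  exists P : {poly {poly C}}, forall z u, f z u = (P.[u%:P]).[z].

Definition psum N (a : nat -> nat -> C) z u : C :=
  \sum_(j < N) \sum_(k < N) a j k * z ^+ j * u ^+ k.

Lemma pol2_ext f g : (forall z u, f z u = g z u) -> pol2 f -> pol2 g.
Proof. by move=> e [P hP]; exists P => z u; rewrite -e. Qed.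
Lemma pol2_cst c : pol2 (fun _ _ => c).
Proof. by exists (c%:P%:P) => z u; rewrite !hornerC. Qed.
Lemma pol2_fst : pol2 (fun z _ => z).
Proof. by exists ('X%:P) => z u; rewrite hornerC hornerX. Qed.
Lemma pol2_snd : pol2 (fun _ u => u).
Proof. by exists 'X => z u; rewrite hornerX hornerC. Qed.
Lemma pol2D f g : pol2 f -> pol2 g -> pol2 (fun z u => f z u + g z u).
Proof. by move=> [P hP] [Q hQ]; exists (P + Q) => z u; rewrite !hornerD hP hQ. Qed.
Lemma pol2M f g : pol2 f -> pol2 g -> pol2 (fun z u => f z u * g z u).
Proof. by move=> [P hP] [Q hQ]; exists (P * Q) => z u; rewrite !hornerM hP hQ. Qed.
Lemma pol2X f n : pol2 f -> pol2 (fun z u => f z u ^+ n).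
Proof. by move=> [P hP]; exists (P ^+ n) => z u; rewrite !horner_exp hP. Qed.
Lemma pol2_sum (I : Type) (r : seq I) (F : I -> C -> C -> C) :
  (forall i, pol2 (F i)) -> pol2 (fun z u => \sum_(i <- r) F i z u).
Proof.
move=> h; elim: r => [|i r IH].
  by apply: pol2_ext (pol2_cst 0) => z u; rewrite big_nil.
by apply: pol2_ext (pol2D (h i) IH) => z u; rewrite big_cons.
Qed.
Lemma pol2_horner (q : {poly C}) f : pol2 f -> pol2 (fun z u => q.[f z u]).
Proof.
move=> hf.
apply: (@pol2_ext (fun z u => \sum_(i <- index_enum 'I_(size q)) (q`_i * f z u ^+ i))).
  by move=> z u; rewrite horner_coef.
by apply: pol2_sum => i; apply: pol2M; [exact: pol2_cst|exact: pol2X].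
Qed.

Lemma psum_widen N N' a z u : (N <= N')%N ->
  psum N a z u = psum N' (fun j k => if (j < N)%N && (k < N)%N then a j k else 0) z u.
Proof.
move=> NN; rewrite /psum.
rewrite (big_ord_widen N' (fun j => \sum_(k < N) a j k * z ^+ j * u ^+ k) NN) big_mkcond.
apply: eq_bigr => j _; case: ifP => jN; last by rewrite big1 // => k _; rewrite !mul0r.
rewrite (big_ord_widen N' (fun k => a j k * z ^+ j * u ^+ k) NN) big_mkcond.
by apply: eq_bigr => k _; case: ifP => kN //; rewrite !mul0r.
Qed.

(** Both degrees are below [N], so that one square array holds the coefficients;
the vanishing outside of it lets arrays of different polynomials be compared
after widening to a common size. *)
Lemma pol2_coef f : pol2 f -> exists N a,
  (forall z u, f z u = psum N a z u) /\
  (forall j k, (N <= j)%N || (N <= k)%N -> a j k = 0).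
Proof.
move=> [P hP].
pose N := maxn (size P) (\max_(k < size P) size (P`_k)%R).
have h1 k : (size (P`_k)%R <= N)%N.
  have [kP|kP] := ltnP k (size P); last by rewrite nth_default // size_poly0.
  by rewrite (leq_trans (leq_bigmax (F := fun k : 'I_(size P) => size (P`_k)%R) (Ordinal kP))) // leq_maxr.
exists N, (fun j k => P`_k`_j); split=> [z u|j k /orP[h|h]].
- rewrite hP (horner_coef_wide _ (leq_maxl _ _ : (size P <= N)%N)) horner_sum /psum.
  rewrite exchange_big; apply: eq_bigr => k _.
  rewrite hornerM -rmorphXn hornerC /= (horner_coef_wide _ (h1 k)) mulr_suml.
  by apply: eq_bigr => j _.
- by rewrite nth_default // (leq_trans (h1 k)).
- by rewrite (nth_default _ (_ : (size P <= k)%N)) ?coef0 // (leq_trans _ h) // leq_maxl.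
Qed.

Lemma pol2_psum N a : pol2 (psum N a).
Proof.
apply: pol2_sum => j; apply: pol2_sum => k.
by apply: pol2M; [apply: pol2M; [exact: pol2_cst|exact/pol2X/pol2_fst]|exact/pol2X/pol2_snd].
Qed.

Lemma pol2_comp f g h : pol2 f -> pol2 g -> pol2 h -> pol2 (fun z u => f (g z u) (h z u)).
Proof.
move=> /pol2_coef[N [a [ha _]]] hg hh.
apply: (@pol2_ext (fun z u => psum N a (g z u) (h z u))) => [z u|]; first by rewrite ha.
apply: pol2_sum => j; apply: pol2_sum => k.
by apply: pol2M; [apply: pol2M; [exact: pol2_cst|exact: pol2X]|exact: pol2X].
Qed.

(** [X^n - 1] splits and, in characteristic zero, is separable: it has [n] distinct
roots, which form a cyclic group. *)
Lemma prim_root_exists n : (0 < n)%N -> exists w : C, n.-primitive_root w.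
Proof.
move=> n0; have [r hr] := closed_field_poly_normal ('X^n - 1 : {poly C}).
have hm : 'X^n - 1 \is @monic C by exact: monicXnsubC.
rewrite (monicP hm) scale1r in hr.
have su : uniq r.
  by rewrite -separable_prod_XsubC -hr separable_Xn_sub_1 // pnatr_eq0 -lt0n.
have sz : size r = n.
  by apply: succn_inj; rewrite -(size_prod_XsubC r id) -hr size_XnsubC.
have ha : all n.-unity_root r.
  apply/allP => x xr; rewrite unity_rootE.
  have : root ('X^n - 1) x by rewrite hr root_prod_XsubC.
  by rewrite /root !hornerE subr_eq0.
have /hasP[w _ hw] := has_prim_root n0 ha su (eq_leq (esym sz)).
by exists w.
Qed.

Lemma prim_root_cabs n w : n.-primitive_root w -> cabs w = 1.
Proof.
move=> h; have n0 := prim_order_gt0 h.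
have := congr1 (@cabs R) (prim_expr_order h); rewrite cabsX cabs1 => e.
by apply/eqP; rewrite -(eqrXn2 n0) ?cabs_ge0 // e expr1n.
Qed.

Lemma prim_root_sum n w i : n.-primitive_root w ->
  \sum_(s < n) (w ^+ i) ^+ s = (if (n %| i)%N then n%:R else 0).
Proof.
move=> h; case: ifP => hi.
  move: hi; rewrite (prim_order_dvd h) => /eqP ->.
  by rewrite (eq_bigr (fun=> 1)) ?sumr_const ?card_ord // => s _; rewrite expr1n.
have : (w ^+ i) ^+ n - 1 = 0 by rewrite exprAC (prim_expr_order h) expr1n subrr.
rewrite subrX1 => /eqP; rewrite mulf_eq0 subr_eq0 -(prim_order_dvd h) hi /=.
by move/eqP.
Qed.

(** The average over the [N]th roots of unity, the algebraic counterpart of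
Cauchy's integral formula: it extracts the coefficient [a k] of a polynomial of
degree below [N].  The factor [w^(N-k)] stands for [w^(-k)]. *)
Lemma root_filter N (a : nat -> C) w k z : N.-primitive_root w -> (k < N)%N ->
  \sum_(s < N) (\sum_(j < N) a j * (z * w ^+ s) ^+ j) * (w ^+ (N - k)) ^+ s
   = N%:R * (a k * z ^+ k).
Proof.
move=> hw kN.
have aux j s : a j * (z * w ^+ s) ^+ j * (w ^+ (N - k)) ^+ s =
    a j * z ^+ j * (w ^+ (j + (N - k))) ^+ s.
  by rewrite exprMn -!exprM mulnDl exprD (mulnC j s) !mulrA.
under eq_bigr do rewrite mulr_suml.
rewrite exchange_big /= (bigD1 (Ordinal kN)) //= [X in _ + X]big1 ?addr0 => [|j /eqP jk].
  under eq_bigr do rewrite aux.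
  by rewrite -!mulr_sumr (prim_root_sum _ hw) subnKC 1?ltnW // dvdnn [in RHS]mulrC.
under eq_bigr do rewrite aux.
rewrite -!mulr_sumr (prim_root_sum _ hw).
case: ifP => // hd; last by rewrite !mulr0.
case: jk; apply: val_inj => /=; have jN := ltn_ord j.
move/dvdnP: hd => [[|[|q]] hq]; move: hq; rewrite ?mulSn ?mul0n; clear -kN jN; lia.
Qed.

(** Cauchy's estimate, from [root_filter] at [z = r]: an average of values of
modulus at most [B]. *)
Lemma cauchy_estimate1 N (a : nat -> C) (r B : R) k : 0 <= r -> (k < N)%N ->
  (forall z, cabs z <= r -> cabs (\sum_(j < N) a j * z ^+ j) <= B) ->
  cabs (a k) * r ^+ k <= B.
Proof.
move=> r0 kN hB; have N0 : (0 < N)%N by exact: leq_ltn_trans kN.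
have [w hw] := prim_root_exists N0.
have w1 := prim_root_cabs hw.
have NR : 0 < N%:R :> R by rewrite ltr0n.
have := root_filter a (r%:C%C) hw kN => /(congr1 (@cabs R)).
rewrite !cabsM cabsX cabs_real ger0_norm // cabs_nat => e.
rewrite -(ler_pM2l NR) -e; apply: le_trans (cabs_sum _ _ _) _.
apply: (@le_trans _ _ (\sum_(s < N) B)); last by rewrite sumr_const card_ord mulr_natl.
apply: ler_sum => s _; rewrite cabsM !cabsX w1 !expr1n mulr1; apply: hB.
by rewrite cabsM cabsX w1 expr1n mulr1 cabs_real ger0_norm.
Qed.

(** One variable at a time: the coefficient of [z^j] is a polynomial in [u],
bounded by [B / r^j] for [|u| <= r]. *)
Lemma cauchy_estimate2 N (a : nat -> nat -> C) (r B : R) j k : 0 <= r ->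
  (j < N)%N -> (k < N)%N ->
  (forall z u, cabs z <= r -> cabs u <= r -> cabs (psum N a z u) <= B) ->
  cabs (a j k) * r ^+ (j + k) <= B.
Proof.
move=> r0 jN kN hB.
have B0 : 0 <= B by apply: le_trans (hB 0 0 _ _); rewrite ?cabs_ge0 ?cabs0.
have h1 u : cabs u <= r -> cabs (\sum_(k < N) a j k * u ^+ k) * r ^+ j <= B.
  move=> hu; apply: (@cauchy_estimate1 N (fun j => \sum_(k < N) a j k * u ^+ k)) => // z hz.
  apply: le_trans (hB _ _ hz hu); rewrite le_eqVlt /psum; apply/orP; left; apply/eqP.
  congr cabs; apply: eq_bigr => i _; rewrite mulr_suml; apply: eq_bigr => l _; ring.
have -> : cabs (a j k) * r ^+ (j + k) = cabs (a j k * (r ^+ j)%:C%C) * r ^+ k.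
  by rewrite cabsM cabs_real (ger0_norm (exprn_ge0 j r0)) exprD mulrA.
apply: (@cauchy_estimate1 N (fun k => a j k * (r ^+ j)%:C%C)) => // u hu.
apply: le_trans (h1 u hu); rewrite -[X in _ * X](ger0_norm (exprn_ge0 j r0)) -cabs_real -cabsM.
rewrite le_eqVlt; apply/orP; left; apply/eqP; congr cabs.
rewrite mulr_suml; apply: eq_bigr => i _; ring.
Qed.

Lemma sum_half_pow_le N : \sum_(j < N) (2^-1 : R) ^+ j <= 2.
Proof.
suff -> : \sum_(j < N) (2^-1 : R) ^+ j = 2 - 2 * 2^-1 ^+ N.
  by rewrite lerBlDr lerDl mulr_ge0 // exprn_ge0 // invr_ge0.
elim: N => [|N IH]; first by rewrite big_ord0 expr0 mulr1 subrr.
by rewrite big_ord_recr /= IH exprS; field.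
Qed.

Lemma double_sum_geometric_le N (c : nat -> nat -> R) (B : R) :
  (forall j k, (j < N)%N -> (k < N)%N -> c j k <= B * 2^-1 ^+ (j + k)) -> 0 <= B ->
  \sum_(j < N) \sum_(k < N) c j k <= 4 * B.
Proof.
move=> h B0; apply: (@le_trans _ _ (\sum_(j < N) \sum_(k < N) B * 2^-1 ^+ (j + k))).
  by apply: ler_sum => j _; apply: ler_sum => k _; exact: h.
have -> : \sum_(j < N) \sum_(k < N) B * 2^-1 ^+ (j + k) =
   B * (\sum_(j < N) (2^-1) ^+ j) * (\sum_(k < N) (2^-1) ^+ k).
  rewrite -mulrA mulr_suml mulr_sumr; apply: eq_bigr => j _; rewrite !mulr_sumr.
  by apply: eq_bigr => k _; rewrite exprD.
have g := sum_half_pow_le N; have g0 : 0 <= \sum_(j < N) (2^-1 : R) ^+ j.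
  by apply: sumr_ge0 => i _; rewrite exprn_ge0 // invr_ge0.
set S := \sum_(j < N) _ in g g0 *.
have h1 : S * S <= 2 * 2 by exact: ler_pM.
rewrite -mulrA mulrC; apply: le_trans (_ : (2 * 2) * B <= _); first by rewrite ler_wpM2r.
lra.
Qed.

Lemma cabs_psum N a z u : cabs (psum N a z u) <=
  \sum_(j < N) \sum_(k < N) cabs (a j k) * cabs z ^+ j * cabs u ^+ k.
Proof.
apply: le_trans (cabs_sum _ _ _) _; apply: ler_sum => j _.
apply: le_trans (cabs_sum _ _ _) _; apply: ler_sum => k _.
by rewrite !cabsM !cabsX.
Qed.

(** Doubling the radius makes the terms decay like [2^-(j+k)], whose sum is at
most [4], whatever the degree of the polynomial. *)
Lemma psum_bound N (a : nat -> nat -> C) z u (M B : R) : 0 <= B -> cabs z <= M -> cabs u <= M ->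
  (forall j k, (j < N)%N -> (k < N)%N -> cabs (a j k) * (2 * M) ^+ (j + k) <= B) ->
  cabs (psum N a z u) <= 4 * B.
Proof.
move=> B0 hz hu h; apply: le_trans (cabs_psum _ _ _ _) _.
apply: (double_sum_geometric_le (c := fun j k => cabs (a j k) * cabs z ^+ j * cabs u ^+ k)) => // j k jN kN.
have M0 : 0 <= M := le_trans (cabs_ge0 _) hz.
have h2 : 0 < (2^-1 : R) ^+ (j + k) by rewrite exprn_gt0 // invr_gt0.
apply: (@le_trans _ _ (cabs (a j k) * M ^+ (j + k))).
  rewrite -mulrA exprD ler_wpM2l ?cabs_ge0 //.
  by apply: ler_pM; rewrite ?exprn_ge0 ?cabs_ge0 // lerXn2r ?nnegrE ?cabs_ge0.
apply: le_trans (_ : cabs (a j k) * (2 * M) ^+ (j + k) * 2^-1 ^+ (j + k) <= _); last first.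
  by rewrite ler_wpM2r ?h // ltW.
by rewrite -mulrA -exprMn mulrAC mulfV // mul1r.
Qed.

Definition taylor_part d (b : nat -> nat -> C) z u : C :=
  \sum_(j < d) \sum_(k < d) if (j + k < d)%N then b j k * z ^+ j * u ^+ k else 0.

(** The coefficients [b] satisfy Cauchy's estimates on the radius [r]; the terms
of total degree at least [d] are dominated by a geometric series of ratio
[t / r <= 1/2].  The bounds depend on the polynomial only through [B], which is
what allows passing to limits. *)
Lemma pol2_taylor f (r B : R) d : pol2 f -> 0 < r ->
  (forall z u, cabs z <= r -> cabs u <= r -> cabs (f z u) <= B) ->
  exists b : nat -> nat -> C, (forall j k, cabs (b j k) * r ^+ (j + k) <= B) /\
  forall z u t, cabs z <= t -> cabs u <= t -> 2 * t <= r ->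
    cabs (f z u - taylor_part d b z u) <= 4 * (B * (2 * t / r) ^+ d).
Proof.
move=> /pol2_coef[N0 [b [hb b0]]] r0 hB.
have B0 : 0 <= B by apply: le_trans (hB 0 0 _ _); rewrite ?cabs_ge0 ?cabs0 ?ltW.
pose N := maxn N0 d.
have hbN z u : f z u = psum N b z u.
  rewrite hb (psum_widen _ _ _ (leq_maxl N0 d)); apply: eq_bigr => j _; apply: eq_bigr => k _.
  case: ifP => // /negbT; rewrite negb_and -!leqNgt => /b0 ->; by rewrite !mul0r.
have bB j k : cabs (b j k) * r ^+ (j + k) <= B.
  have [jN|jN] := ltnP j N; last by rewrite b0 ?cabs0 ?mul0r // (leq_trans (leq_maxl N0 d) jN).
  have [kN|kN] := ltnP k N; last by rewrite b0 ?cabs0 ?mul0r // (leq_trans (leq_maxl N0 d) kN) orbT.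
  by apply: (cauchy_estimate2 (N := N)) => [|//|//|z u hz hu]; rewrite -?hbN ?hB // ltW.
exists b; split => // z u t hz hu ht.
have t0 : 0 <= t := le_trans (cabs_ge0 _) hz.
have -> : f z u - taylor_part d b z u =
    psum N (fun j k => if (j + k < d)%N then 0 else b j k) z u.
  apply/eqP; rewrite subr_eq; apply/eqP; rewrite hbN.
  have -> : taylor_part d b z u = psum N (fun j k => if (j + k < d)%N then b j k else 0) z u.
    rewrite /taylor_part /psum.
    rewrite (big_ord_widen N (fun j => \sum_(k < d) if (j + k < d)%N then b j k * z ^+ j * u ^+ k else 0) (leq_maxr N0 d)) big_mkcond.
    apply: eq_bigr => j _; case: ifP => jN; last first.
      rewrite big1 // => k _; case: ifP; rewrite ?mul0r // => h.
      by rewrite (leq_ltn_trans (leq_addr _ _) h) in jN.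
    rewrite (big_ord_widen N (fun k => if (j + k < d)%N then b j k * z ^+ j * u ^+ k else 0) (leq_maxr N0 d)) big_mkcond.
    apply: eq_bigr => k _; have [jk|jk] := ltnP (j + k) d; last by rewrite !mul0r if_same.
    by rewrite (leq_ltn_trans (leq_addl j k) jk).
  rewrite /psum -big_split; apply: eq_bigr => j _; rewrite -big_split; apply: eq_bigr => k _.
  by case: ifP => _ /=; rewrite !mul0r ?add0r ?addr0.
apply: le_trans (cabs_psum _ _ _ _) _.
have rn : r != 0 by rewrite lt0r_neq0.
have h2 : 0 <= 2 * t / r by rewrite divr_ge0 ?mulr_ge0 // ltW.
have h21 : 2 * t / r <= 1 by rewrite ler_pdivrMr // mul1r.
apply: (double_sum_geometric_le (c := fun j k => cabs (if (j + k < d)%N then 0 else b j k) * cabs z ^+ j * cabs u ^+ k)) => [j k jN kN|]; last first.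
  by rewrite mulr_ge0 // exprn_ge0.
have hp : 0 <= (2^-1 : R) ^+ (j + k) by rewrite exprn_ge0 // invr_ge0.
case: ifP => jk; first by rewrite cabs0 !mul0r !mulr_ge0 // exprn_ge0.
apply: (@le_trans _ _ (cabs (b j k) * t ^+ (j + k))).
  rewrite -mulrA exprD ler_wpM2l ?cabs_ge0 //.
  by apply: ler_pM; rewrite ?exprn_ge0 ?cabs_ge0 // lerXn2r ?nnegrE ?cabs_ge0.
have -> : t ^+ (j + k) = r ^+ (j + k) * ((2 * t / r) ^+ (j + k) * 2^-1 ^+ (j + k)).
  by rewrite -!exprMn; congr (_ ^+ _); field.
rewrite mulrA -[X in _ <= X]mulrA; apply: ler_pM.
- by rewrite mulr_ge0 ?cabs_ge0 // exprn_ge0 // ltW.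
- by rewrite mulr_ge0 // exprn_ge0.
- exact: bB.
- rewrite ler_wpM2r // ler_wiXn2l //; by rewrite leqNgt jk.
Qed.

Lemma taylor_part2E b z u : taylor_part 2 b z u = b 0%N 0%N + b 1%N 0%N * z + b 0%N 1%N * u.
Proof.
rewrite /taylor_part !big_ord_recl !big_ord0 /bump /= ?addn0 ?addn1 /= !expr0 !expr1; ring.
Qed.

Lemma taylor_part3E b z u : taylor_part 3 b z u = b 0%N 0%N + b 1%N 0%N * z + b 0%N 1%N * u
  + b 2%N 0%N * z ^+ 2 + b 1%N 1%N * z * u + b 0%N 2%N * u ^+ 2.
Proof.
rewrite /taylor_part !big_ord_recl !big_ord0 /bump /= ?addn0 ?addn1 /= !expr0 !expr1; ring.
Qed.

Lemma pol2_bounded f (M : R) : pol2 f -> exists2 B : R, 0 <= B &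
  forall z u, cabs z <= M -> cabs u <= M -> cabs (f z u) <= B.
Proof.
move=> /pol2_coef[N [a [ha _]]]; exists (\sum_(j < N) \sum_(k < N) cabs (a j k) * `|M| ^+ j * `|M| ^+ k).
  by apply: sumr_ge0 => j _; apply: sumr_ge0 => k _; rewrite !mulr_ge0 ?cabs_ge0 // exprn_ge0.
move=> z u hz hu; rewrite ha; apply: le_trans (cabs_psum _ _ _ _) _.
have hz' := le_trans hz (ler_norm M); have hu' := le_trans hu (ler_norm M).
apply: ler_sum => j _; apply: ler_sum => k _; rewrite -!mulrA ler_wpM2l ?cabs_ge0 //.
by apply: ler_pM; rewrite ?exprn_ge0 ?cabs_ge0 // lerXn2r ?nnegrE ?cabs_ge0.
Qed.

End Pol2.

(** * Convergent subsequences and Taylor expansions of limits *)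
Section Limits.
Variable R : realType.
Local Notation C := (R[i]%C).
Implicit Types z u w : C.

(** Convergence of sequences in terms of [cabs], independent of the topologies on
complex numbers. *)
Definition ccvg (x : nat -> C) (l : C) := forall e : R, 0 < e ->
  exists N : nat, forall n, (N <= n)%N -> cabs (x n - l) <= e.

Lemma ccvg_cst c : ccvg (fun=> c) c.
Proof. by move=> e e0; exists 0%N => n _; rewrite subrr cabs0 ltW. Qed.

Lemma ccvgD x y a b : ccvg x a -> ccvg y b -> ccvg (fun n => x n + y n) (a + b).
Proof.
move=> hx hy e e0; have e2 : 0 < e / 2 by rewrite divr_gt0.
have [N hN] := hx _ e2; have [N' hN'] := hy _ e2; exists (maxn N N') => n.
rewrite geq_max => /andP[/hN h1 /hN' h2].
have -> : x n + y n - (a + b) = (x n - a) + (y n - b) by ring.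
by apply: le_trans (cabsD _ _) _; lra.
Qed.

Lemma ccvgMl c x a : ccvg x a -> ccvg (fun n => c * x n) (c * a).
Proof.
move=> hx e e0; have e2 : 0 < e / (cabs c + 1) by rewrite divr_gt0 // ltr_wpDl // cabs_ge0.
have [N hN] := hx _ e2; exists N => n /hN h.
rewrite -mulrBr cabsM; apply: le_trans (_ : (cabs c + 1) * cabs (x n - a) <= _).
  by rewrite ler_wpM2r ?cabs_ge0 // lerDl.
by rewrite -ler_pdivlMl ?ltr_wpDl ?cabs_ge0 // mulrC.
Qed.

Lemma ccvg_sum (I : Type) (r : seq I) (x : I -> nat -> C) a :
  (forall i, ccvg (x i) (a i)) ->
  ccvg (fun n => \sum_(i <- r) x i n) (\sum_(i <- r) a i).
Proof.
move=> h; elim: r => [|i r IH].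
  by move=> e e0; exists 0%N => n _; rewrite !big_nil subrr cabs0 ltW.
move=> e /(ccvgD (h i) IH)[N hN]; exists N => n /hN.
by rewrite !big_cons.
Qed.

Lemma ccvg_ext x y a : (forall n, x n = y n) -> ccvg x a -> ccvg y a.
Proof. by move=> e h d d0; have [N hN] := h d d0; exists N => n /hN; rewrite e. Qed.

Lemma ccvg_le x a c (B : R) : ccvg x a -> (exists N, forall n, (N <= n)%N -> cabs (x n - c) <= B) ->
  cabs (a - c) <= B.
Proof.
move=> hx [N hN]; apply/ler_addgt0Pr => e /hx[N' hN'].
have h1 := hN (maxn N N') (leq_maxl _ _); have h2 := hN' (maxn N N') (leq_maxr _ _).
have -> : a - c = (x (maxn N N') - c) - (x (maxn N N') - a) by ring.
by apply: le_trans (cabsB _ _) _; lra.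
Qed.

Lemma ccvg_unique x a b : ccvg x a -> ccvg x b -> a = b.
Proof.
move=> ha hb; apply/eqP; rewrite -subr_eq0; apply/eqP/(@cabs_eq0 R)/eqP.
rewrite eq_le cabs_ge0 andbT; apply/ler_addgt0Pr => e e0; rewrite add0r.
exact: ccvg_le ha (hb e e0).
Qed.

Lemma increasing_ge (phi : nat -> nat) n : increasing phi -> (n <= phi n)%N.
Proof.
move=> h; elim: n => // n IH; apply: leq_ltn_trans IH _; exact: h.
Qed.

Lemma ccvg_sub x a phi : increasing phi -> ccvg x a -> ccvg (x \o phi) a.
Proof.
move=> hp hx e /hx[N hN]; exists N => n hn; apply: hN.
exact: leq_trans hn (increasing_ge _ hp).
Qed.

(** Simultaneous extraction for countably many bounded sequences.  The products of
segments containing them are compact by Tychonoff's theorem, so the sequence of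
families has a cluster point [f]; a basic neighbourhood of [f] constrains only
finitely many coordinates, and [psi k] is chosen so that the coordinates of
index below [k] are within [1/(k+1)] of those of [f]. *)
Lemma bolzano_real (I : countType) (x : nat -> I -> R) :
  (forall i, exists B, forall n, `|x n i| <= B) ->
  exists psi (f : I -> R), increasing psi /\
   forall i (e : R), 0 < e -> exists N, forall n, (N <= n)%N -> `|x (psi n) i - f i| < e.
Proof.
move=> /choice[B hB].
have hc := @tychonoff I (fun=> R : topologicalType) (fun i => `[- B i, B i]%classic)
  (fun i => @segment_compact R _ _).
have [|f [_ hf]] := hc (x @ \oo) _.
  by exists 0%N => // n _ i /=; rewrite in_itv /= -ler_norml.
pose T : topologicalType := prod_topology (fun _ : I => R : topologicalType).
have FF : Filter (nbhs (f : T)) := nbhs_filter (f : T).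
have hV e m : 0 < e -> nbhs (f : T)
    [set g : T | forall i : I, (pickle i < m)%N -> `|f i - g i| < e].
  move=> e0; elim: m => [|m IH].
    by apply: (@filterS _ _ FF setT) (@filterT _ _ FF) => g _ i.
  have [[i0 hi0]|hn] := pselect (exists i0 : I, pickle i0 = m); last first.
    apply: (@filterS _ _ FF _ _ _ IH) => g hg i.
    by rewrite ltnS leq_eqVlt => /orP[/eqP im|/hg//]; case: hn; exists i.
  have h1 : nbhs (f : T) [set g : T | ball (f i0) e (g i0)].
    exact: (@proj_continuous I (fun=> R : topologicalType) i0 f _ (nbhsx_ballx (f i0 : R) e e0)).
  apply: (@filterS _ _ FF _ _ _ (@filterI _ _ FF _ _ h1 IH)) => g [g1 g2] i.
  rewrite ltnS leq_eqVlt => /orP[/eqP im|/g2//].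
  by have -> : i = i0 by apply: (pcan_inj pickleK); rewrite im.
have hk (kN : nat * nat) : exists n, (kN.2 < n)%N /\
    forall i : I, (pickle i < kN.1)%N -> `|f i - x n i| < kN.1.+1%:R^-1.
  have e0 : 0 < kN.1.+1%:R^-1 :> R by rewrite invr_gt0.
  have FA : (x @ \oo) [set x n | n in [set n | (kN.2 < n)%N]].
    by exists kN.2.+1 => // n hn; exists n.
  by have [g [[n hn <-] hg]] := hf _ _ FA (hV _ kN.1 e0); exists n.
have [pick hpick] := choice hk.
pose psi := fix psi k := if k is k'.+1 then pick (k, psi k') else pick (0, 0)%N.
have hpsi : increasing psi.
  by apply: homo_ltn => [|k]; [exact: ltn_trans|rewrite /=; have [] := hpick (k.+1, psi k)].
exists psi, f; split => // i e e0.
exists (maxn (pickle i).+1 (Num.truncn e^-1).+1) => n; rewrite geq_max => /andP[h1 h2].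
have h3 : `|f i - x (psi n) i| < n.+1%:R^-1.
  case: n h1 h2 => [//|n] h1 h2 /=; have [_] := hpick (n.+1, psi n); exact.
rewrite distrC; apply: lt_trans h3 _.
rewrite -[e]invrK ltf_pV2 ?posrE ?invr_gt0 //.
apply: lt_trans (truncnS_gt _) _; by rewrite ltr_nat ltnS.
Qed.

Lemma bolzano (I : countType) (x : nat -> I -> C) :
  (forall i, exists B, forall n, cabs (x n i) <= B) ->
  exists psi (f : I -> C), increasing psi /\ forall i, ccvg (fun n => x (psi n) i) (f i).
Proof.
move=> hB.
pose y n (ib : I * bool) := if ib.2 then complex.Re (x n ib.1) else complex.Im (x n ib.1).
have [|psi [f [hpsi hf]]] := @bolzano_real (I * bool)%type y.
  move=> [i b]; have [B hBi] := hB i; exists B => n; rewrite /y /=.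
  by case: b; apply: le_trans (hBi n); [exact: cabs_Re|exact: cabs_Im].
exists psi, (fun i => (f (i, true) +i* f (i, false))%C); split => // i e e0.
have e2 : 0 < e / 2 by rewrite divr_gt0.
have [N hN] := hf (i, true) _ e2; have [N' hN'] := hf (i, false) _ e2.
exists (maxn N N') => n; rewrite geq_max => /andP[/hN h1 /hN' h2].
apply: le_trans (cabs_le_ReIm _) _; rewrite ReCD ImCD ReCN ImCN /=.
by move: h1 h2; rewrite /y /=; lra.
Qed.

(** A Cauchy sequence is bounded, and converges to the limit of any convergent
subsequence. *)
Lemma ccvg_cauchy (x : nat -> C) :
  (forall e, 0 < e -> exists N, forall n m, (N <= n)%N -> (N <= m)%N -> cabs (x n - x m) <= e) ->
  exists l, ccvg x l.
Proof.
move=> h.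
have [|psi [f [hpsi hf]]] := @bolzano unit (fun n _ => x n).
  move=> _; have [N hN] := h 1 ltr01.
  exists (1 + cabs (x N) + \sum_(i < N) cabs (x i)) => n.
  have [nN|Nn] := ltnP n N.
    rewrite (bigD1 (Ordinal nN)) //= addrCA lerDl addr_ge0 ?addr_ge0 ?cabs_ge0 //.
    by apply: sumr_ge0 => i _; exact: cabs_ge0.
  apply: (@le_trans _ _ (1 + cabs (x N))); last first.
    by rewrite lerDl; apply: sumr_ge0 => i _; exact: cabs_ge0.
  have := cabsD (x n - x N) (x N); rewrite subrK => h1; apply: le_trans h1 _.
  by rewrite lerD2r; exact: hN.
exists (f tt) => e e0; have [N hN] := h _ e0.
exists N => n Nn; rewrite cabsBC; apply: ccvg_le (hf tt) _; exists N => m Nm.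
by apply: hN => //; exact: leq_trans Nm (increasing_ge _ hpsi).
Qed.

Lemma ccvg_taylor_part d (b : nat -> nat -> nat -> C) (l : nat -> nat -> C) z u :
  (forall j k, ccvg (fun n => b n j k) (l j k)) ->
  ccvg (fun n => taylor_part d (b n) z u) (taylor_part d l z u).
Proof.
move=> h; apply: ccvg_sum => j; apply: ccvg_sum => k.
case: ifP => _; last exact: ccvg_cst.
have e (x : C) : z ^+ j * u ^+ k * x = x * z ^+ j * u ^+ k by ring.
by apply: (ccvg_ext (x := fun n => z ^+ j * u ^+ k * b n j k)) => [n|]; rewrite -?e //; exact: ccvgMl.
Qed.

(** Along a subsequence the Taylor coefficients of the [P n] converge, and the
remainder estimate of [pol2_taylor] is uniform in [n].  Convergence is assumed on
the set [S] only: with [S] the real plane this applies to the power series of a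
real analytic function, whose partial sums are only known to converge to it at
real points. *)
Lemma limit_taylor (P : nat -> C -> C -> C) (G : C -> C -> C) (S : C -> C -> Prop) (r B : R) d :
  (forall n, pol2 (P n)) -> 0 < r ->
  (forall n z u, cabs z <= r -> cabs u <= r -> cabs (P n z u) <= B) ->
  (forall z u, S z u -> cabs z <= r -> cabs u <= r -> ccvg (fun n => P n z u) (G z u)) ->
  exists b : nat -> nat -> C, (forall j k, cabs (b j k) * r ^+ (j + k) <= B) /\
  forall z u t, S z u -> cabs z <= t -> cabs u <= t -> 2 * t <= r ->
    cabs (G z u - taylor_part d b z u) <= 4 * (B * (2 * t / r) ^+ d).
Proof.
move=> hP r0 hB hG.
have /choice[b hb] n := pol2_taylor d (hP n) r0 (hB n).
have rp j k : 0 < r ^+ (j + k) by rewrite exprn_gt0.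
have [|psi [f [hpsi hf]]] := @bolzano (nat * nat)%type (fun n jk => b n jk.1 jk.2).
  move=> [j k]; exists (B / r ^+ (j + k)) => n /=; rewrite ler_pdivlMr //.
  by have [h _] := hb n.
exists (fun j k => f (j, k)); split=> [j k|z u t hS hz hu ht].
  rewrite -ler_pdivlMr // -[f (j, k)]subr0; apply: ccvg_le (hf (j, k)) _.
  by exists 0%N => n _; rewrite subr0 ler_pdivlMr //; have [h _] := hb (psi n).
have t0 : 0 <= t := le_trans (cabs_ge0 _) hz.
have tr : t <= r by apply: le_trans ht; rewrite mulr_natl mulr2n lerDl.
have h1 := ccvg_sub hpsi (hG z u hS (le_trans hz tr) (le_trans hu tr)).
have h2 := @ccvg_taylor_part d (fun n => b (psi n)) (fun j k => f (j, k)) z u (fun j k => hf (j, k)).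
have h3 := ccvgD h1 (ccvgMl (-1) h2).
rewrite -[G z u - _]subr0 -[- taylor_part _ _ _ _]mulN1r; apply: ccvg_le h3 _.
by exists 0%N => n _; rewrite subr0 mulN1r /=; have [_ h] := hb (psi n); exact: h.
Qed.

End Limits.

(** * Locally uniform limits of polynomials *)
Section Montel.
Variable R : realType.
Local Notation C := (R[i]%C).
Implicit Types z u w : C.

Definition ucvg (f : nat -> C -> C -> C) F := forall M e : R, 0 < e ->
  exists N, forall n, (N <= n)%N -> forall z u, cabs z <= M -> cabs u <= M ->
    cabs (f n z u - F z u) <= e.

(** Bounded on each polydisc from some index on, which depends on the polydisc:
rescaled kernels are controlled on a polydisc only for large [n]. *)
Definition lbounded (f : nat -> C -> C -> C) := forall M : R, exists B N,
  forall n, (N <= n)%N -> forall z u, cabs z <= M -> cabs u <= M -> cabs (f n z u) <= B.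

(** The entire functions of two variables: locally uniform limits of
polynomials. *)
Definition approx2 (f : C -> C -> C) := forall M e : R, 0 < e -> exists2 P, pol2 P &
  forall z u, cabs z <= M -> cabs u <= M -> cabs (f z u - P z u) <= e.

Lemma small_pow (B e : R) : 0 < e -> exists J : nat, forall m, (J <= m)%N -> B * 2^-1 ^+ m <= e.
Proof.
move=> e0; exists (Num.truncn (B / e)).+1 => m Jm.
have : B / e < m%:R by apply: lt_le_trans (truncnS_gt _) _; rewrite ler_nat.
rewrite ltr_pdivrMr // => h.
rewrite exprVn ler_pdivrMr ?exprn_gt0 // mulrC; apply: le_trans (ltW h) _.
by apply: ler_wpM2r; [exact: ltW|rewrite -natrX ler_nat ltnW // ltn_expl].
Qed.

Lemma eventually_forall_fin (I : finType) (T : I -> nat -> Prop) :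
  (forall i, exists N, forall n, (N <= n)%N -> T i n) ->
  exists N, forall n, (N <= n)%N -> forall i, T i n.
Proof.
move=> /choice[N hN]; exists (\max_i N i) => n hn i; apply: hN.
exact: leq_trans (leq_bigmax i) hn.
Qed.

(** By Cauchy's estimates each coefficient is a bounded sequence, so a diagonal
extraction makes all of them converge.  On the polydisc of radius [M] the terms of
total degree at least [J] are uniformly small, by Cauchy's estimates on the radius
[4 M]; the finitely many others form a Cauchy sequence. *)
Lemma montel (P : nat -> C -> C -> C) : (forall n, pol2 (P n)) -> lbounded P ->
  exists psi F, increasing psi /\ ucvg (fun n => P (psi n)) F.
Proof.
move=> /(_ _)/pol2_coef hP hB.
have /choice[Na hNa] n : exists Na : nat * (nat -> nat -> C),
    (forall z u, P n z u = psum Na.1 Na.2 z u) /\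
    (forall j k, (Na.1 <= j)%N || (Na.1 <= k)%N -> Na.2 j k = 0).
  by have [N [a h]] := hP n; exists (N, a).
pose a n := (Na n).2.
have bnd (M B : R) N n : 0 <= M -> (N <= n)%N ->
   (forall n, (N <= n)%N -> forall z u, cabs z <= M -> cabs u <= M -> cabs (P n z u) <= B) ->
   forall j k, cabs (a n j k) * M ^+ (j + k) <= B.
  move=> M0 Nn h j k; have [e0 e1] := hNa n.
  have B0 : 0 <= B by apply: le_trans (h n Nn 0 0 _ _); rewrite ?cabs_ge0 ?cabs0.
  have [jN|jN] := ltnP j (Na n).1; last by rewrite /a e1 ?jN // cabs0 mul0r.
  have [kN|kN] := ltnP k (Na n).1; last by rewrite /a e1 ?kN ?orbT // cabs0 mul0r.
  by apply: (cauchy_estimate2 (N := (Na n).1)) => // z u hz hu; rewrite -e0; exact: h.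
have [|psi [f [hpsi hf]]] := @bolzano R (nat * nat)%type (fun n jk => a n jk.1 jk.2).
  move=> [j k]; have [B [N h]] := hB 1.
  exists (B + \sum_(i < N) cabs (a i j k)) => n /=.
  have B0 : 0 <= B by apply: le_trans (h N (leqnn _) 0 0 _ _); rewrite ?cabs_ge0 ?cabs0.
  have [nN|Nn] := ltnP n N.
    rewrite (bigD1 (Ordinal nN)) //= addrCA lerDl addr_ge0 //.
    by apply: sumr_ge0 => i _; exact: cabs_ge0.
  have := bnd 1 B N n ler01 Nn h j k; rewrite expr1n mulr1 => h1; apply: le_trans h1 _.
  by rewrite lerDl; apply: sumr_ge0 => i _; exact: cabs_ge0.
have cau (M e : R) : 0 < e -> exists N, forall n m, (N <= n)%N -> (N <= m)%N ->
    forall z u, cabs z <= M -> cabs u <= M -> cabs (P (psi n) z u - P (psi m) z u) <= e.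
  move=> e0; have [M0|M0] := ltP M 0.
    by exists 0%N => n m _ _ z u hz; have := le_lt_trans (le_trans (cabs_ge0 z) hz) M0; rewrite ltxx.
  have M20 : 0 <= 2 * M by rewrite mulr_ge0.
  have [B [N1 h1]] := hB (4 * M).
  have e4 : 0 < e / 4 by rewrite divr_gt0.
  have [J hJ] := small_pow (2 * B) e4.
  have e8 jk : 0 < e / 8 / ((2 * M) ^+ jk + 1) by rewrite !divr_gt0 // ltr_wpDl // exprn_ge0.
  have [|N2 h2] := @eventually_forall_fin ('I_J * 'I_J)%type (fun jk n =>
     cabs (a (psi n) jk.1 jk.2 - f (nat_of_ord jk.1, nat_of_ord jk.2)) <= e / 8 / ((2 * M) ^+ (jk.1 + jk.2) + 1)).
    by move=> jk; exact: hf (nat_of_ord jk.1, nat_of_ord jk.2) _ (e8 (jk.1 + jk.2)%N).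
  exists (maxn N1 N2) => n m; rewrite !geq_max => /andP[n1 n2] /andP[m1 m2] z u hz hu.
  have pn := leq_trans n1 (increasing_ge n hpsi); have pm := leq_trans m1 (increasing_ge m hpsi).
  pose N := maxn (Na (psi n)).1 (Na (psi m)).1.
  have ext l : ((Na l).1 <= N)%N -> P l z u = psum N (a l) z u.
    have [e1 e2] := hNa l; move=> lN; rewrite e1 (psum_widen _ _ _ lN).
    apply: eq_bigr => j _; apply: eq_bigr => k _.
    by case: ifP => // /negbT; rewrite negb_and -!leqNgt /a => /e2 ->; rewrite !mul0r.
  rewrite !ext ?leq_maxl ?leq_maxr //.
  have -> : psum N (a (psi n)) z u - psum N (a (psi m)) z u =
      psum N (fun j k => a (psi n) j k - a (psi m) j k) z u.
    rewrite /psum -sumrB; apply: eq_bigr => j _; rewrite -sumrB; apply: eq_bigr => k _.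
    by rewrite !mulrBl.
  have -> : e = 4 * (e / 4) by field.
  apply: (@psum_bound R _ _ z u M) => //; first exact: ltW.
  move=> j k _ _.
  have M40 : 0 <= 4 * M by rewrite mulr_ge0.
  have [jk|jk] := leqP J (j + k).
    apply: le_trans (hJ _ jk).
    have -> : (2 * M) ^+ (j + k) = (4 * M) ^+ (j + k) * 2^-1 ^+ (j + k).
      by rewrite -exprMn; congr (_ ^+ _); field.
    rewrite mulrA ler_wpM2r ?exprn_ge0 ?invr_ge0 //.
    have b1 := bnd _ _ _ _ M40 pn h1 j k; have b2 := bnd _ _ _ _ M40 pm h1 j k.
    apply: le_trans (_ : (cabs (a (psi n) j k) + cabs (a (psi m) j k)) * (4 * M) ^+ (j + k) <= _).
      by rewrite ler_wpM2r ?exprn_ge0 ?cabsB.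
    by rewrite mulrDl; lra.
  have jJ : (j < J)%N by exact: leq_ltn_trans (leq_addr _ _) jk.
  have kJ : (k < J)%N by exact: leq_ltn_trans (leq_addl _ _) jk.
  have b1 := h2 n n2 (Ordinal jJ, Ordinal kJ); have b2 := h2 m m2 (Ordinal jJ, Ordinal kJ).
  rewrite /= in b1 b2.
  set q := (2 * M) ^+ (j + k) in b1 b2 *.
  have q0 : 0 <= q by rewrite exprn_ge0.
  have hab : cabs (a (psi n) j k - a (psi m) j k) <= e / 4 / (q + 1).
    have -> : a (psi n) j k - a (psi m) j k = (a (psi n) j k - f (j, k)) - (a (psi m) j k - f (j, k)) by ring.
    by apply: le_trans (cabsB _ _) _; lra.
  apply: le_trans (_ : e / 4 / (q + 1) * q <= _); first by rewrite ler_wpM2r.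
  rewrite mulrAC ler_pdivrMr ?ltr_wpDl //; rewrite mulrDr lerDl mulr1 ltW //.
have /choice[G hG] (zu : C * C) : exists l, ccvg (fun n => P (psi n) zu.1 zu.2) l.
  apply: ccvg_cauchy => e e0.
  have [N hN] := cau (Num.max (cabs zu.1) (cabs zu.2)) e e0.
  by exists N => n m Nn Nm; apply: hN; rewrite ?le_max ?lexx ?orbT.
exists psi, (fun z u => G (z, u)); split=> // M e e0.
have [N hN] := cau M e e0; exists N => n Nn z u hz hu.
rewrite cabsBC; apply: ccvg_le (hG (z, u)) _; exists N => m Nm /=.
exact: hN.
Qed.

(** Replacing [f n] by a polynomial at distance [1/(n+1)] on the polydisc of radius
[n] changes no locally uniform limit. *)
Lemma montel_approx (f : nat -> C -> C -> C) : (forall n, approx2 (f n)) -> lbounded f ->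
  exists psi F, [/\ increasing psi, ucvg (fun n => f (psi n)) F & approx2 F].
Proof.
move=> hf hB.
have /choice[P hP] n : exists P, pol2 P /\ forall z u, cabs z <= n%:R -> cabs u <= n%:R ->
    cabs (f n z u - P z u) <= n.+1%:R^-1.
  by have [|P hP h] := hf n n%:R n.+1%:R^-1; [rewrite invr_gt0|exists P].
have key (M e : R) : 0 < e -> exists N, forall n, (N <= n)%N -> forall z u,
    cabs z <= M -> cabs u <= M -> cabs (f n z u - P n z u) <= e.
  move=> e0; exists (maxn (Num.truncn M).+1 (Num.truncn e^-1).+1) => n.
  rewrite geq_max => /andP[h1 h2] z u hz hu.
  have Mn : M <= n%:R by apply: ltW; apply: lt_le_trans (truncnS_gt _) _; rewrite ler_nat.
  have [_ h] := hP n; apply: le_trans (h z u (le_trans hz Mn) (le_trans hu Mn)) _.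
  rewrite -[e]invrK lef_pV2 ?posrE ?invr_gt0 //; apply: ltW.
  by apply: lt_le_trans (truncnS_gt _) _; rewrite ler_nat (leq_trans h2).
have [||psi [F [hpsi hF]]] := @montel P.
- by move=> n; have [] := hP n.
- move=> M; have [B [N h]] := hB M; have [N' h'] := key M 1 ltr01.
  exists (B + 1), (maxn N N') => n; rewrite geq_max => /andP[/h h1 /h' h2] z u hz hu.
  have -> : P n z u = f n z u - (f n z u - P n z u) by ring.
  by apply: le_trans (cabsB _ _) _; apply: lerD; [exact: h1|exact: h2].
exists psi, F; split => // M e e0.
- have e2 : 0 < e / 2 by rewrite divr_gt0.
  have [N h] := hF M _ e2; have [N' h'] := key M _ e2.
  exists (maxn N N') => n; rewrite geq_max => /andP[n1 n2] z u hz hu.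
  have -> : f (psi n) z u - F z u = (f (psi n) z u - P (psi n) z u) + (P (psi n) z u - F z u) by ring.
  have h1 := h n n1 z u hz hu; have h2 := h' _ (leq_trans n2 (increasing_ge n hpsi)) z u hz hu.
  by apply: le_trans (cabsD _ _) _; lra.
- have [N h] := hF M _ e0; exists (P (psi N)); first by have [] := hP (psi N).
  by move=> z u hz hu; rewrite cabsBC; exact: h.
Qed.

Lemma approx2_mulexp p q : pol2 p -> pol2 q -> approx2 (fun z u => p z u * cexp (q z u)).
Proof.
move=> hp hq M e e0.
have [B B0 hB] := pol2_bounded M hp; have [D _ hD] := pol2_bounded M hq.
have e2 : 0 < e / (B + 1) by rewrite divr_gt0 // ltr_wpDl.
have [N hN] := @cexp_approx R D _ e2.
exists (fun z u => p z u * (1 + q z u / N%:R) ^+ N).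
  apply: pol2M => //; apply: pol2X; apply: pol2D; first exact: pol2_cst.
  by apply: pol2M => //; exact: pol2_cst.
move=> z u hz hu; rewrite -mulrBr cabsM.
apply: le_trans (_ : B * (e / (B + 1)) <= _).
  by apply: ler_pM; rewrite ?cabs_ge0 ?hB ?hN ?hD.
rewrite mulrCA; apply: ler_piMr; first exact: ltW.
by rewrite ler_pdivrMr ?ltr_wpDl // mul1r lerDl.
Qed.

(** The first-order expansion of a limit of polynomials [P n], from [limit_taylor]
at order [2] on the unit polydisc centred at [(x1, x2)]. *)
Lemma approx2_taylor (F : C -> C -> C) (x1 x2 : C) : approx2 F -> exists A D : C, exists2 K : R, 0 <= K &
  forall (h1 h2 : C) (t : R), cabs h1 <= t -> cabs h2 <= t -> 2 * t <= 1 ->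
   cabs (F (x1 + h1) (x2 + h2) - F x1 x2 - (A * h1 + D * h2)) <= K * t ^+ 2.
Proof.
move=> hF; pose M : R := Num.max (cabs x1) (cabs x2) + 1.
have e0 n : 0 < n.+1%:R^-1 :> R by rewrite invr_gt0.
have /choice[P hP] n : exists P, pol2 P /\ forall z u, cabs z <= M -> cabs u <= M ->
    cabs (F z u - P z u) <= n.+1%:R^-1.
  by have [P h1 h2] := hF M _ (e0 n); exists P.
have M1 (h : C) : cabs h <= 1 -> cabs (x1 + h) <= M.
  by move=> h1; apply: le_trans (cabsD _ _) _; apply: lerD => //; rewrite le_max lexx.
have M2 (h : C) : cabs h <= 1 -> cabs (x2 + h) <= M.
  by move=> h1; apply: le_trans (cabsD _ _) _; apply: lerD => //; rewrite le_max lexx orbT.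
have [B B0 hB] := pol2_bounded M (proj1 (hP 0%N)).
pose Q n := fun z u => P n (x1 + z) (x2 + u).
have [||z u|b [hb1 hb2]] := @limit_taylor R Q (fun z u => F (x1 + z) (x2 + u)) (fun _ _ => True) 1 (B + 2) 2 _ ltr01.
- move=> n; apply: pol2_comp; first by have [] := hP n.
  + by apply: pol2D; [exact: pol2_cst|exact: pol2_fst].
  + by apply: pol2D; [exact: pol2_cst|exact: pol2_snd].
- move=> n z u hz hu; have a1 := M1 _ hz; have a2 := M2 _ hu.
  have -> : Q n z u = P 0%N (x1 + z) (x2 + u) + (F (x1 + z) (x2 + u) - P 0%N (x1 + z) (x2 + u))
     - (F (x1 + z) (x2 + u) - P n (x1 + z) (x2 + u)) by rewrite /Q; ring.
  apply: le_trans (cabsB _ _) _.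
  have b1 := cabsD (P 0%N (x1 + z) (x2 + u)) (F (x1 + z) (x2 + u) - P 0%N (x1 + z) (x2 + u)).
  have b2 := hB _ _ a1 a2; have b3 := proj2 (hP 0%N) _ _ a1 a2; have b4 := proj2 (hP n) _ _ a1 a2.
  have b5 : n.+1%:R^-1 <= 1 :> R by rewrite invf_le1 // ler1n.
  have b6 := le_trans b1 (lerD b2 b3); have b7 := le_trans b4 b5.
  by apply: le_trans (lerD b6 b7) _; rewrite invr1; lra.
- move=> _ hz hu e he; exists (Num.truncn e^-1).+1 => n hn; rewrite cabsBC.
  apply: le_trans (proj2 (hP n) _ _ (M1 _ hz) (M2 _ hu)) _.
  rewrite -[e]invrK lef_pV2 ?posrE ?invr_gt0 //; apply: ltW.
  by apply: lt_le_trans (truncnS_gt _) _; rewrite ler_nat (leq_trans hn).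
have b00 : F x1 x2 = b 0%N 0%N.
  have := hb2 0 0 0 I; rewrite cabs0 mulr0 => /(_ (lexx _) (lexx _) ler01).
  rewrite taylor_part2E !mulr0 !addr0 mul0r expr0n /= !mulr0 => h.
  by apply/eqP; rewrite -subr_eq0; apply/eqP/(@cabs_eq0 R)/eqP; rewrite eq_le h cabs_ge0.
exists (b 1%N 0%N), (b 0%N 1%N), (16 * (B + 2)); first by rewrite mulr_ge0 // addr_ge0.
move=> h1 h2 t a1 a2 a3; have := hb2 h1 h2 t I a1 a2 a3.
rewrite taylor_part2E b00 divr1 exprMn => h.
have -> : F (x1 + h1) (x2 + h2) - b 0%N 0%N - (b 1%N 0%N * h1 + b 0%N 1%N * h2)
  = F (x1 + h1) (x2 + h2) - (b 0%N 0%N + b 1%N 0%N * h1 + b 0%N 1%N * h2) by ring.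
by apply: le_trans h _; rewrite le_eqVlt; apply/orP; left; apply/eqP; ring.
Qed.

(** The mean value property as a finite average over as many rotations as the degree
requires; the second variable is frozen at [0].  Here the polynomial is first read
as one in [z] whose coefficients depend on [z0], so that the same rotations serve
all centres. *)
Lemma mean_value P : pol2 P -> exists (N : nat) (w : C),
  [/\ (0 < N)%N, cabs w = 1 & forall z0 z, \sum_(s < N) P (z0 + z * w ^+ s) 0 = N%:R * P z0 0].
Proof.
move=> hP.
have hQ : pol2 (fun z u => P (u + z) 0).
  apply: (@pol2_comp R P (fun z u => u + z) (fun _ _ => 0) hP); last exact: pol2_cst.
  by apply: pol2D; [exact: pol2_snd|exact: pol2_fst].
have [N0 [a [ha _]]] := pol2_coef hQ; pose N := N0.+1.
have [w hw] := @prim_root_exists R N (ltn0Sn _).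
exists N, w; split => //; first exact: prim_root_cabs hw.
move=> z0 z; pose b j := \sum_(k < N) (if (j < N0)%N && (k < N0)%N then a j k else 0) * z0 ^+ k.
have hb x : P (z0 + x) 0 = \sum_(j < N) b j * x ^+ j.
  rewrite ha (psum_widen _ _ _ (leqnSn N0)); apply: eq_bigr => j _.
  by rewrite mulr_suml; apply: eq_bigr => k _; rewrite mulrAC.
have := root_filter b z hw (ltn0Sn _).
rewrite subn0 (prim_expr_order hw) expr0 mulr1 => h.
have -> : P z0 0 = b 0%N.
  rewrite -[z0]addr0 hb big_ord_recl expr0 mulr1 big1 ?addr0 // => j _.
  by rewrite expr0n /= mulr0.
by rewrite -h; apply: eq_bigr => s _; rewrite hb expr1n mulr1.
Qed.

End Montel.

(** * Complex differentiability and locally uniform convergence *)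
Section GenericDifferentiable.
Variables (K : numFieldType) (V W : normedModType K).

(** Reduces differentiability to that of a function [g] with the same first-order
expansion; below [g] is affine. *)
Lemma differentiable_of_diff (f g : V -> W) (x : V) :
  differentiable g x ->
  (forall eps : K, 0 < eps -> \forall h \near (0 : V),
     `|(f (h + x) - f x) - (g (h + x) - g x)| <= eps * `|h|) ->
  differentiable f x.
Proof.
move=> /diff_locallyP[cg /eqaddoP eg] h.
have ef : f \o shift x = cst (f x) + 'd g x +o_ (0 : V) id.
  apply/eqaddoP => eps eps0; have e2 : 0 < eps / 2 by rewrite divr_gt0.
  apply: filterS (filterI (eg _ e2) (h _ e2)) => y [h1 h2].
  have -> : (f \o shift x - (cst (f x) + 'd g x)) y =
     ((g \o shift x - (cst (g x) + 'd g x)) y) + ((f (y + x) - f x) - (g (y + x) - g x)).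
    rewrite !fctE /= [RHS]addrC !opprD opprK !addrA; congr (_ - _).
    by rewrite [in RHS](addrAC (f (y + x) - f x - g (y + x))) subrK addrK.
  apply: le_trans (ler_normD _ _) _; rewrite [eps]splitr mulrDl; exact: lerD.
have hd : 'd f x = 'd g x :> (V -> W) by exact: diff_unique.
by apply: (proj2 (diff_locallyP x f)); rewrite hd.
Qed.
End GenericDifferentiable.

Section Topology.
Variable R : realType.
Local Notation C := (Cplx R).

Lemma pos_complexP (e : R[i]%C) : 0 < e -> exists2 d : R, 0 < d & e = d%:C%C.
Proof. by case: e => a b; rewrite ltcE /= => /andP[/eqP -> a0]; exists a. Qed.

(** The norm of complex numbers takes its values in the complex numbers, hence the
radius [d%:C]. *)
Lemma ball_cabs (x y : C) (d : R) : ball x (d%:C%C) y = (cabs (x - y) < d) :> Prop.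
Proof. by rewrite -ball_normE /ball_ /= norm_complexE ltcR. Qed.

Lemma nbhs_cabsP (x : C) (P : set C) :
  nbhs x P <-> exists2 d : R, 0 < d & forall y : C, cabs (y - x) < d -> P y.
Proof.
split.
  move=> /nbhs_ballP[e /= e0 h]; have [d d0 ed] := pos_complexP e0.
  by exists d => // y hy; apply: h; rewrite ed ball_cabs cabsBC.
move=> [d d0 h]; apply/nbhs_ballP; exists (d%:C%C); first by rewrite /= ltcR.
by move=> y; rewrite ball_cabs cabsBC; exact: h.
Qed.

Lemma nbhs_cabs2P (x : C * C) (P : set (C * C)) :
  nbhs x P <-> exists2 d : R, 0 < d &
    forall y : C * C, cabs (y.1 - x.1) < d -> cabs (y.2 - x.2) < d -> P y.
Proof.
split.
  move=> /nbhs_ballP[e /= e0 h]; have [d d0 ed] := pos_complexP e0.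
  exists d => // y h1 h2; apply: h; split => /=; rewrite ed ball_cabs cabsBC //.
move=> [d d0 h]; apply/nbhs_ballP; exists (d%:C%C); first by rewrite /= ltcR.
by move=> y [/= h1 h2]; apply: h; move: h1 h2; rewrite !ball_cabs => h1 h2; rewrite cabsBC.
Qed.

Lemma continuous_cabsP (f : C -> C) : continuous f <->
  forall x (e : R), 0 < e -> exists2 d : R, 0 < d &
    forall y, cabs (y - x) < d -> cabs (f y - f x) < e.
Proof.
split=> h x.
  move=> e e0; have : nbhs (f x) [set y | cabs (y - f x) < e] by apply/nbhs_cabsP; exists e.
  by move/(h x)/nbhs_cabsP => [d d0 hd]; exists d.
move=> P /nbhs_cabsP[e e0 he]; have [d d0 hd] := h x e e0.
by apply/nbhs_cabsP; exists d => // y /hd /he.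
Qed.

Lemma continuous2_cabsP (f : C * C -> C) : (forall x (e : R), 0 < e -> exists2 d : R, 0 < d &
    forall y, cabs (y.1 - x.1) < d -> cabs (y.2 - x.2) < d -> cabs (f y - f x) < e) ->
  continuous f.
Proof.
move=> h x P /nbhs_cabsP[e e0 he]; have [d d0 hd] := h x e e0.
by apply/nbhs_cabs2P; exists d => // y h1 h2; apply: he; exact: hd.
Qed.

Lemma compact_bounded2 (A : set (C * C)) : compact A -> exists M : R,
  forall z w, A (z, w) -> cabs z <= M /\ cabs w <= M.
Proof.
move=> /compact_near_coveringP/(_ nat \oo
  (fun n (x : C * C) => cabs x.1 <= n%:R /\ cabs x.2 <= n%:R) _) h.
have [|N _ hN] := h.
  move=> x _; pose N := (Num.truncn (Num.max (cabs x.1) (cabs x.2) + 1)).+1.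
  exists ([set y : C * C | cabs (y.1 - x.1) < 1 /\ cabs (y.2 - x.2) < 1], [set n | (N <= n)%N]).
    split => /=; first by apply/nbhs_cabs2P; exists 1.
    by exists N.
  move=> [y n] [/= [h1 h2] Nn].
  have : Num.max (cabs x.1) (cabs x.2) + 1 <= n%:R.
    by apply: ltW; apply: lt_le_trans (truncnS_gt _) _; rewrite ler_nat.
  have m1 : cabs x.1 <= Num.max (cabs x.1) (cabs x.2) by rewrite le_max lexx.
  have m2 : cabs x.2 <= Num.max (cabs x.1) (cabs x.2) by rewrite le_max lexx orbT.
  have := cabsD (y.1 - x.1) x.1; have := cabsD (y.2 - x.2) x.2; rewrite !subrK.
  by move=> *; split; lra.
exists N%:R => z w zw; exact: (hN N (leqnn _) (z, w) zw).
Qed.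

Lemma cvg_locally_uniformly_cabs (f : nat -> C -> C -> C) (g : C -> C -> C) :
  (forall M e : R, 0 < e -> exists N, forall n, (N <= n)%N -> forall z w : C,
    cabs z <= M -> cabs w <= M -> cabs (f n z w - g z w) <= e) ->
  cvg_locally_uniformly f g.
Proof.
move=> h; apply/fam_cvgP => A /compact_bounded2[M hM] P /uniform_nbhs[E [entE hE]].
move: entE; rewrite -entourage_ballE => -[e /= e0 he]; have [d d0 ed] := pos_complexP e0.
have d2 : 0 < d / 2 by rewrite divr_gt0.
have [N hN] := h M _ d2; exists N => // n Nn; apply: hE => -[z w] Azw; apply: he => /=.
have [hz hw] := hM _ _ Azw.
rewrite ed ball_cabs cabsBC; apply: le_lt_trans (hN n Nn z w hz hw) _.
by rewrite ltr_pdivrMr // ltr_pMr // ltr1n.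
Qed.

Lemma cvg_locally_uniformly_pointwise (f : nat -> C -> C -> C) (g : C -> C -> C) z w :
  cvg_locally_uniformly f g -> ccvg (fun n => f n z w) (g z w).
Proof.
move=> h e e0.
have /fam_cvgP/(_ [set (z, w)] (@compact_set1 _ _)) := h.
move=> /(_ [set h | forall y, [set (z, w)] y -> cabs (g y.1 y.2 - h y) < e]).
case.
  apply/uniform_nbhs; exists [set xy | ball xy.1 (e%:C%C) xy.2]; split.
    by rewrite -entourage_ballE; exists (e%:C%C) => //=; rewrite ltcR.
  by move=> k /= hk y hy; have := hk y hy; rewrite ball_cabs.
move=> N _ hN; exists N => n Nn; have := hN n Nn (z, w) erefl.
by rewrite /= cabsBC; exact: ltW.
Qed.

Lemma differentiable_affine (A D : R[i]%C) (x : C * C) :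
  differentiable (fun h : C * C => (A * h.1 + D * h.2 : C)) x.
Proof.
have d1 : differentiable (fun h : C * C => h.1) x.
  apply: linear_differentiable => y P /nbhs_cabsP[d d0 h].
  by apply/nbhs_cabs2P; exists d => // z h1 _; exact: h.
have d2 : differentiable (fun h : C * C => h.2) x.
  apply: linear_differentiable => y P /nbhs_cabsP[d d0 h].
  by apply/nbhs_cabs2P; exists d => // z _ h1; exact: h.
apply: differentiableD.
- exact: (@differentiableM _ _ (fun _ => A : C) (fun h : C * C => h.1) x (differentiable_cst _ _) d1).
- exact: (@differentiableM _ _ (fun _ => D : C) (fun h : C * C => h.2) x (differentiable_cst _ _) d2).
Qed.

(** A quadratic remainder [K t^2] is below [e t] as soon as [t <= e / (K + 1)]. *)
Lemma differentiable_taylor (F : C -> C -> C) (x : C * C) (A D : R[i]%C) (K : R) : 0 <= K ->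
  (forall (h1 h2 : C) (t : R), cabs h1 <= t -> cabs h2 <= t -> 2 * t <= 1 ->
   cabs (F (x.1 + h1) (x.2 + h2) - F x.1 x.2 - (A * h1 + D * h2)) <= K * t ^+ 2) ->
  differentiable (fun zw : C * C => F zw.1 zw.2) x.
Proof.
move=> K0 hF; apply: differentiable_of_diff (differentiable_affine A D x) _.
move=> eps eps0; have [e e0 ee] := pos_complexP eps0.
have [d d0 [hd1 hd2]] : exists2 d : R, 0 < d & 2 * d <= 1 /\ K * d <= e.
  exists (Num.min (2^-1) (e / (K + 1))).
    by rewrite lt_min invr_gt0 ltr0n !divr_gt0 // ltr_wpDl.
  have m1 : Num.min (2^-1) (e / (K + 1)) <= 2^-1 by rewrite ge_min lexx.
  have m2 : Num.min (2^-1) (e / (K + 1)) <= e / (K + 1) by rewrite ge_min lexx orbT.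
  split; first lra.
  move: m2; rewrite ler_pdivlMr ?ltr_wpDl //; set m := Num.min _ _ => m2.
  have m0 : 0 <= m by rewrite le_min invr_ge0 ler0n !divr_ge0 ?addr_ge0 // ltW.
  by move: m2; rewrite mulrDr mulr1 mulrC; lra.
apply/nbhs_cabs2P; exists d => // h; rewrite !subr0 => h1 h2.
pose t := Num.max (cabs h.1) (cabs h.2).
have th : `|h| = t%:C%C.
  rewrite prod_normE !norm_complexE /t; case: (leP (cabs h.1) (cabs h.2)) => hh.
    by rewrite max_r // lecR.
  by rewrite max_l // lecR ltW.
have td : t < d by rewrite gt_max h1 h2.
have t0 : 0 <= t by rewrite le_max cabs_ge0.
rewrite th ee -rmorphM norm_complexE lecR /=.
have h3 : cabs (F (x.1 + h.1) (x.2 + h.2) - F x.1 x.2 - (A * h.1 + D * h.2)) <= e * t.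
  have t1 : 2 * t <= 1 by apply: le_trans hd1; rewrite ler_pM2l // ltW.
  apply: le_trans (hF h.1 h.2 t _ _ t1) _; rewrite ?le_max ?lexx ?orbT //.
  rewrite expr2 mulrA ler_wpM2r //; apply: le_trans hd2.
  by rewrite ler_wpM2l // ltW.
rewrite [x.1 + h.1]addrC [x.2 + h.2]addrC in h3; move: h3.
have -> : A * (h.1 + x.1 : R[i]%C) + D * (h.2 + x.2 : R[i]%C) - (A * x.1 + D * x.2) = A * h.1 + D * h.2.
  by move: (h.1 : R[i]%C) (h.2 : R[i]%C) (x.1 : R[i]%C) (x.2 : R[i]%C) => a b c f; ring.
exact.
Qed.

Lemma approx2_differentiable (F : C -> C -> C) : approx2 F ->
  forall x : C * C, differentiable (fun zw : C * C => F zw.1 zw.2) x.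
Proof.
move=> hF x; have [A [D [K K0 h]]] := approx2_taylor x.1 x.2 hF.
exact: differentiable_taylor K0 h.
Qed.

End Topology.

(** * Second-order Taylor expansions of real analytic functions *)
Section RealAnalytic.
Variable R : realType.
Local Notation C := (R[i]%C).

Lemma derive1_quad (g : R -> R) (x d B rho : R) : 0 < rho ->
  (forall h, `|h| <= rho -> `|g (x + h) - g x - d * h| <= B * h ^+ 2) ->
  derive1 g x = d.
Proof.
move=> r0 hg; rewrite /derive1; apply: cvg_lim => //.
have h0 : (fun h : R => h^-1 * (g (h + x) - g x) - d) @ 0^' --> (0 : R).
  apply: (@cvg_to_0_linear R _ B rho r0) => h /andP[hp hr].
  have hn : h != 0 by rewrite -normr_gt0.
  have -> : h^-1 * (g (h + x) - g x) - d = h^-1 * (g (x + h) - g x - d * h).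
    by rewrite addrC [h + x]addrC; field.
  rewrite normrM normfV ler_pdivrMl //.
  apply: le_trans (hg h (ltW hr)) _; rewrite -(real_normK (num_real h)).
  by rewrite expr2; lra.
have -> : (fun h : R => h^-1 *: (g (h + x) - g x)) =
    (fun h => (h^-1 * (g (h + x) - g x) - d) + d) by apply/funext => h; rewrite subrK.
by rewrite -[X in _ --> X]add0r; apply: cvgD h0 _; exact: cvg_cst.
Qed.

(** The quadratic coefficient [c s] is not assumed continuous in [s].  Writing [g]
at [x], [x+k] and [x+2k] with the expansions centred at [x] and at [x+k] and
eliminating [g] shows [b k = b 0 + 2 c 0 k + O(k^2)], where [b] is the first
derivative. *)
Lemma derive2_taylor (g : R -> R) (x B rho : R) (a b c : R -> R) : 0 < rho -> 0 <= B ->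
  (forall s, `|s| <= rho -> `|c s| <= B /\ forall h, `|h| <= rho ->
     `|g (x + s + h) - (a s + b s * h + c s * h ^+ 2)| <= B * `|h| ^+ 3) ->
  derive1n 2 g x = 2 * c 0.
Proof.
move=> r0 B0 H.
have az s : `|s| <= rho -> a s = g (x + s).
  move=> hs; have [_ /(_ 0)] := H s hs; rewrite normr0 => /(_ (ltW r0)).
  rewrite expr0n /= mulr0 addr0 !mulr0 !addr0 expr0n /= mulr0 normr_le0 subr_eq0.
  by move/eqP.
have d1 s : `|s| <= rho -> derive1 g (x + s) = b s.
  move=> hs; have [hc hh] := H s hs.
  apply: (@derive1_quad _ _ _ (B + B * rho) rho r0) => h hr.
  have := hh h hr; rewrite az //.
  have e : g (x + s + h) - g (x + s) - b s * h =
    (g (x + s + h) - (g (x + s) + b s * h + c s * h ^+ 2)) + c s * h ^+ 2 by ring.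
  move=> h1; rewrite e; apply: le_trans (ler_normD _ _) _.
  have h2 : `|c s * h ^+ 2| <= B * h ^+ 2.
    by rewrite normrM (ger0_norm (sqr_ge0 h)) ler_wpM2r ?sqr_ge0.
  have h3 : B * `|h| ^+ 3 <= B * rho * h ^+ 2.
    rewrite -mulrA ler_wpM2l // exprS real_normK ?num_real // ler_wpM2r ?sqr_ge0 //.
  by rewrite mulrDl; lra.
rewrite /derive1n /=.
apply: (@derive1_quad _ _ _ (5 * B) (rho / 2)); first by rewrite divr_gt0.
move=> k hk2; have hk : `|k| <= rho by lra.
have h00 : `|0 : R| <= rho by rewrite normr0 ltW.
have d10 := d1 0 h00; rewrite addr0 in d10; rewrite d1 // d10.
have [_ h1] := H k hk; have [_ h0] := H 0 h00.
have e1 := h1 k hk; have e2 := h1 (- k); rewrite normrN in e2; have {}e2 := e2 hk.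
have e3 := h0 (k + k); have kk : `|k + k| <= rho by apply: le_trans (ler_normD _ _) _; lra.
have {}e3 := e3 kk.
have k3 : `|k + k| ^+ 3 = 8 * `|k| ^+ 3.
  have -> : k + k = 2 * k by ring.
  by rewrite normrM (ger0_norm (_ : 0 <= 2)) //; ring.
rewrite k3 in e3; rewrite (az k hk) in e1 e2; rewrite (az 0 h00) in e3.
rewrite addr0 in e3; rewrite addrK in e2; rewrite addrA in e3.
have [->|kn] := eqVneq k 0.
  by rewrite subrr !mulr0 subrr normr0 expr0n /= mulr0.
have kp : 0 < `|k| by rewrite normr_gt0.
rewrite -(ler_pM2r kp) -normrM -(ler_pM2l (_ : 0 < 2)) // -{1}[2]ger0_norm // -normrM.
have -> : 2 * ((b k - b 0 - 2 * c 0 * k) * k) =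
   (g (x + k + k) - (g x + b 0 * (k + k) + c 0 * (k + k) ^+ 2))
   - (g (x + k + k) - (g (x + k) + b k * k + c k * k ^+ 2))
   + (g x - (g (x + k) + b k * (- k) + c k * (- k) ^+ 2)) by ring.
apply: le_trans (ler_normD _ _) _.
have := ler_normB (g (x + k + k) - (g x + b 0 * (k + k) + c 0 * (k + k) ^+ 2))
   (g (x + k + k) - (g (x + k) + b k * k + c k * k ^+ 2)).
have : `|k| ^+ 3 = k ^+ 2 * `|k| by rewrite exprS real_normK ?num_real // mulrC.
move=> ek; rewrite ek in e1 e2 e3; lra.
Qed.

Definition quad (b : nat -> nat -> R) (x y : R) :=
  b 0%N 0%N + b 1%N 0%N * x + b 0%N 1%N * y + b 2%N 0%N * x ^+ 2 + b 1%N 1%N * x * y + b 0%N 2%N * y ^+ 2.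

Lemma ReCMr (z : C) (x : R) : complex.Re (z * x%:C%C) = complex.Re z * x.
Proof. by rewrite ReCM /= mulr0 subr0. Qed.

Lemma Re_quad (b : nat -> nat -> C) (x y : R) :
  complex.Re (b 0%N 0%N + b 1%N 0%N * x%:C%C + b 0%N 1%N * y%:C%C + b 2%N 0%N * x%:C%C ^+ 2
    + b 1%N 1%N * x%:C%C * y%:C%C + b 0%N 2%N * y%:C%C ^+ 2) = quad (fun j k => complex.Re (b j k)) x y.
Proof. by rewrite -!rmorphXn !ReCD !ReCMr. Qed.

(** One pair [rho], [B] serves all centres [p] near [z0].  The power series at [z0]
converges absolutely at the real point [(s, s)], so its partial sums are bounded on
the complex polydisc of radius [s]; [limit_taylor], applied to the partial sums
recentred at [p], bounds the Taylor coefficients and the remainder. *)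
Lemma analytic_taylor (f : C -> R) (z0 : C) : real_analytic_at f z0 ->
  exists rho B : R, [/\ 0 < rho, 0 <= B & forall p : C, cabs (p - z0) <= rho ->
   exists b : nat -> nat -> R, (forall j k, (j + k <= 2)%N -> `|b j k| <= B) /\
    forall x y t, `|x| <= t -> `|y| <= t -> t <= rho ->
     `|f (p + (x +i* y)%C) - quad b x y| <= B * t ^+ 3].
Proof.
move=> [a [r [r0 ha]]]; pose s := r / 2.
have s0 : 0 < s by rewrite divr_gt0.
have sr : s < r by rewrite /s; lra.
have ss : `|s| < r by rewrite gtr0_norm.
have [hsum _] := ha s s ss ss.
have [B0 B00 hB0] : exists2 B0 : R, 0 <= B0 & forall N,
    \sum_(j < N) \sum_(k < N) `|a j k| * s ^+ (j + k) <= B0.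
  move: hsum; rewrite /summable; case E : (\esum_(x in _) _)%E => [B0||] // _.
    have hN N : \sum_(j < N) \sum_(k < N) `|a j k| * s ^+ (j + k) <= B0.
      rewrite -lee_fin -E; apply: esum_ge; exists (`I_N `*` `I_N); first by split => //; exact: finite_setX.
      rewrite le_eqVlt; apply/orP; left; apply/eqP.
      rewrite -(@pair_fsbig _ _ _ _ _ _ _ (fun j k => `|(a j k * s ^+ j * s ^+ k)%:E|%E)) //.
      rewrite -(fsbig_ord _ _ (fun j => (\sum_(k \in `I_N) `|(a j k * s ^+ j * s ^+ k)%:E|)%E)).
      rewrite -sumEFin; apply: eq_bigr => j _.
      rewrite -(fsbig_ord _ _ (fun k => `|(a j k * s ^+ j * s ^+ k)%:E|%E)) -sumEFin.
      by apply: eq_bigr => k _; rewrite -mulrA -exprD /= normrM (ger0_norm (exprn_ge0 _ (ltW s0))).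
    by exists B0 => //; have := hN 0%N; rewrite big_ord0.
  have : (0 <= \esum_(x in [set: nat * nat]) `|(a x.1 x.2 * s ^+ x.1 * s ^+ x.2)%:E|)%E.
    by apply: esum_ge0.
  by rewrite E.
pose P N := psum N (fun j k => (a j k)%:C%C).
have hP N : pol2 (P N) by exact: pol2_psum.
have bP N z u : cabs z <= s -> cabs u <= s -> cabs (P N z u) <= B0.
  move=> hz hu; apply: le_trans (cabs_psum _ _ _ _) _; apply: le_trans (hB0 N).
  apply: ler_sum => j _; apply: ler_sum => k _; rewrite cabs_real -mulrA exprD ler_wpM2l //.
  by apply: ler_pM; rewrite ?exprn_ge0 ?cabs_ge0 // lerXn2r ?nnegrE ?cabs_ge0 // ltW.
have s2 : 0 < s / 2 by rewrite divr_gt0.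
pose D : R := 1 + 2 / s; have D1 : 1 <= D by rewrite /D lerDl divr_ge0 // ltW.
pose B := B0 * D ^+ 2 + 4 * B0 * (4 / s) ^+ 3.
have B1 : 0 <= B0 * D ^+ 2 by rewrite mulr_ge0 // sqr_ge0.
have B2 : 0 <= 4 * B0 * (4 / s) ^+ 3.
  by apply: mulr_ge0; [exact: mulr_ge0|rewrite exprn_ge0 // divr_ge0 // ltW].
exists (s / 4), B; split; [by rewrite divr_gt0|exact: addr_ge0|move=> p hp].
have hx0 := le_trans (cabs_Re _) hp; have hy0 := le_trans (cabs_Im _) hp.
set x0 := complex.Re (p - z0) in hx0; set y0 := complex.Im (p - z0) in hy0.
have pE x y : p + (x +i* y)%C = z0 + ((x0 + x) +i* (y0 + y))%C.
  by rewrite -[p](subrKC z0) -addrA; congr (_ + _); rewrite /x0 /y0; case: (p - z0).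
pose Q N z u := P N (x0%:C%C + z) (y0%:C%C + u).
pose G (z u : C) : C := (f (p + (complex.Re z +i* complex.Re u)%C))%:C%C.
pose S (z u : C) := complex.Im z = 0 /\ complex.Im u = 0.
have [|||b [hb1 hb2]] := @limit_taylor R Q G S (s / 2) B0 3 _ s2.
- move=> N; apply: (@pol2_comp R (P N)); first exact: hP.
  + by apply: pol2D; [exact: pol2_cst|exact: pol2_fst].
  + by apply: pol2D; [exact: pol2_cst|exact: pol2_snd].
- move=> N z u hz hu; apply: bP; apply: le_trans (cabsD _ _) _; rewrite cabs_real; lra.
- move=> z u [z1 u1] hz hu e e0.
  have zE : z = (complex.Re z)%:C%C by apply: complex_ext.
  have uE : u = (complex.Re u)%:C%C by apply: complex_ext.
  have lx : `|x0 + complex.Re z| < r.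
    by apply: le_lt_trans (ler_normD _ _) _; have := cabs_Re z; lra.
  have ly : `|y0 + complex.Re u| < r.
    by apply: le_lt_trans (ler_normD _ _) _; have := cabs_Re u; lra.
  have [_ /cvgrPdist_le/(_ e e0)[N _ hN]] := ha _ _ lx ly.
  exists N => n Nn; rewrite cabsBC /G pE.
  have -> : Q n z u = (\sum_(j < n) \sum_(k < n) a j k * (x0 + complex.Re z) ^+ j * (y0 + complex.Re u) ^+ k)%:C%C.
    rewrite /Q /P /psum {1}zE {1}uE rmorph_sum; apply: eq_bigr => j _.
    rewrite rmorph_sum; apply: eq_bigr => k _.
    by rewrite -!rmorphD -!rmorphXn -!rmorphM.
  by rewrite -rmorphB cabs_real; exact: hN.
exists (fun j k => complex.Re (b j k)); split=> [j k jk|x y t hx hy ht].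
  apply: le_trans (cabs_Re _) _; apply: le_trans (_ : B0 * D ^+ 2 <= _); last by rewrite lerDl.
  have := hb1 j k; rewrite -ler_pdivlMr ?exprn_gt0 // => h; apply: le_trans h _.
  rewrite ler_wpM2l // -exprVn.
  apply: le_trans (_ : D ^+ (j + k) <= _); last by rewrite ler_weXn2l.
  have i0 : 0 <= (s / 2)^-1 by rewrite invr_ge0 ltW.
  have D0 : 0 <= D := le_trans ler01 D1.
  by apply: lerXn2r; rewrite ?nnegrE // invf_div /D lerDr.
have := hb2 (x%:C%C) (y%:C%C) t (conj erefl erefl); rewrite !cabs_real => /(_ hx hy).
have t2 : 2 * t <= s / 2 by lra.
move=> /(_ t2); rewrite taylor_part3E => h.
apply: le_trans (_ : 4 * (B0 * (2 * t / (s / 2)) ^+ 3) <= _).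
  apply: le_trans h; apply: le_trans (cabs_Re _).
  by rewrite ReCD ReCN Re_quad.
have t0 : 0 <= t by exact: le_trans hx.
have -> : 4 * (B0 * (2 * t / (s / 2)) ^+ 3) = 4 * B0 * (4 / s) ^+ 3 * t ^+ 3.
  by field; rewrite gt_eqF.
by rewrite ler_wpM2r ?exprn_ge0 // lerDr.
Qed.

End RealAnalytic.

(** * The quadratic model of the potential *)
Section QuadraticModel.
Variable R : realType.
Local Notation C := (R[i]%C).

(** The number [e] bounds the Laplacian from below, is the radius on which the
expansion holds, and its inverse bounds the remainder: one parameter that can be
decreased ([quad_model_le]), as a compactness argument requires. *)
Definition quad_model (f : C -> R) (e : R) (p : C) :=
  e <= laplacian f p /\ exists al be : C, forall h : C, cabs h <= e ->
    `|f (p + h) - f p - complex.Re (al * h + be * h ^+ 2) - laplacian f p * cabs h ^+ 2|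
      <= cabs h ^+ 3 / e.

Lemma quad_model_le f (e e' : R) p : 0 < e' -> e' <= e -> quad_model f e p -> quad_model f e' p.
Proof.
move=> e0 ee [h1 [al [be h3]]]; have ep : 0 < e := lt_le_trans e0 ee.
have ie : e^-1 <= e'^-1 by rewrite lef_pV2.
split; first exact: le_trans ee h1.
exists al, be => h hh; apply: le_trans (h3 h (le_trans hh ee)) _.
by rewrite ler_wpM2l // exprn_ge0 // cabs_ge0.
Qed.

(** A real quadratic polynomial is harmonic up to a multiple of [x^2 + y^2], and a
harmonic one is the real part of a complex quadratic polynomial. *)
Lemma quad_Re (b : nat -> nat -> R) (x y : R) : quad b x y = b 0%N 0%N +
  complex.Re ((((b 1%N 0%N) +i* (- b 0%N 1%N))%C : C) * (x +i* y)%C +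
    ((((b 2%N 0%N - b 0%N 2%N) / 2) +i* (- (b 1%N 1%N / 2)))%C : C) * (x +i* y)%C ^+ 2) +
  (b 2%N 0%N + b 0%N 2%N) / 2 * (x ^+ 2 + y ^+ 2).
Proof.
have -> : ((x +i* y)%C : C) ^+ 2 = ((x ^+ 2 - y ^+ 2) +i* (2 * x * y))%C.
  by apply: complex_ext; rewrite expr2 ?ReCM ?ImCM /=; ring.
by rewrite ReCD !ReCM /= /quad; field.
Qed.

(** The expansion comes from [analytic_taylor] and [quad_Re].  For the lower bound
on the Laplacian near [z0], note that [4 t^2 lap f (p)] is, up to [O(t^3)], the
second difference of [f] on the five points [p], [p+t], [p-t], [p+it], [p-it];
comparing it with the expansion at [z0] makes the Laplacian Lipschitz at [z0]. *)
Lemma analytic_quad_model (f : C -> R) (z0 : C) : real_analytic_at f z0 -> 0 < laplacian f z0 ->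
  exists2 e : R, 0 < e & forall p, cabs (p - z0) <= e -> quad_model f e p.
Proof.
move=> /analytic_taylor[rho [B [r0 B0 H]]] l0.
have /choice[b hb] (p : C) : exists b : nat -> nat -> R, cabs (p - z0) <= rho ->
   (forall j k, (j + k <= 2)%N -> `|b j k| <= B) /\
    forall x y t, `|x| <= t -> `|y| <= t -> t <= rho ->
     `|f (p + (x +i* y)%C) - quad b x y| <= B * t ^+ 3.
  have [h|h] := boolP (cabs (p - z0) <= rho); last by exists (fun _ _ => 0).
  by have [b h'] := H p h; exists b.
have r2 : 0 < rho / 2 by rewrite divr_gt0.
have lapE p : cabs (p - z0) <= rho / 2 -> laplacian f p = (b p 2%N 0%N + b p 0%N 2%N) / 2.
  move=> hp.
  have hs (q : C) (s : R) : `|s| <= rho / 2 -> cabs q = `|s| -> cabs (p + q - z0) <= rho.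
    move=> h1 h2; rewrite addrAC; apply: le_trans (cabsD _ _) _; rewrite h2; lra.
  rewrite /laplacian.
  have -> : derive1n 2 (fun x : R => f (x +i* complex.Im p)%C) (complex.Re p) = 2 * b p 2%N 0%N.
    have -> : p = p + ((0 : R) +i* 0)%C by apply: complex_ext; rewrite ?ReCD ?ImCD /= addr0.
    pose q (s : R) : C := (s +i* 0)%C.
    apply: (@derive2_taylor _ _ _ B (rho / 2) (fun s => b (p + q s) 0%N 0%N)
      (fun s => b (p + q s) 1%N 0%N) (fun s => b (p + q s) 2%N 0%N)) => // s hss.
    have qs : cabs (q s) = `|s| by rewrite -cabs_real.
    have [h1 h2] := hb _ (hs _ _ hss qs); split=> [|h hh]; first exact: h1.
    have := h2 h 0 `|h| (lexx _); rewrite normr0 => /(_ (normr_ge0 _)).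
    have hr : `|h| <= rho by lra.
    move=> /(_ hr); rewrite /quad !mulr0 expr0n /= !mulr0 !addr0.
    congr (`|f _ - _| <= _); apply: complex_ext; rewrite ?ReCD ?ImCD /= ?addr0 //.
  have -> : derive1n 2 (fun y : R => f (complex.Re p +i* y)%C) (complex.Im p) = 2 * b p 0%N 2%N.
    have -> : p = p + ((0 : R) +i* 0)%C by apply: complex_ext; rewrite ?ReCD ?ImCD /= addr0.
    pose q (s : R) : C := (0 +i* s)%C.
    apply: (@derive2_taylor _ _ _ B (rho / 2) (fun s => b (p + q s) 0%N 0%N)
      (fun s => b (p + q s) 0%N 1%N) (fun s => b (p + q s) 0%N 2%N)) => // s hss.
    have qs : cabs (q s) = `|s| by rewrite /cabs /= expr0n /= add0r sqrtr_sqr.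
    have [h1 h2] := hb _ (hs _ _ hss qs); split=> [|h hh]; first exact: h1.
    have := h2 0 h `|h|; rewrite normr0 => /(_ (normr_ge0 _) (lexx _)).
    have hr : `|h| <= rho by lra.
    move=> /(_ hr); rewrite /quad !mulr0 expr0n /= !mulr0 !mul0r !addr0.
    congr (`|f _ - _| <= _); apply: complex_ext; rewrite ?ReCD ?ImCD /= ?addr0 //.
  by field.
have z00 : cabs (z0 - z0) <= rho / 2 by rewrite subrr cabs0 ltW.
have z01 : cabs (z0 - z0) <= rho by rewrite subrr cabs0 ltW.
have [hz1 hz2] := hb z0 z01.
have lap_cont p t : cabs (p - z0) <= t -> 2 * t <= rho -> `|laplacian f p - laplacian f z0| <= 18 * B * t.
  move=> hp ht; have t0 : 0 <= t := le_trans (cabs_ge0 _) hp.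
  have [tp|tz] := ltP 0 t; last first.
    have te : t = 0 by apply/eqP; rewrite eq_le tz t0.
    move: hp; rewrite te => hp; have e : p - z0 = 0.
      by apply: (@cabs_eq0 R); apply/eqP; rewrite eq_le hp cabs_ge0.
    have -> : p = z0 by apply/eqP; rewrite -subr_eq0 e.
    by rewrite subrr normr0 mulr0.
  have p2 : cabs (p - z0) <= rho / 2 by lra.
  have p1 : cabs (p - z0) <= rho by lra.
  rewrite (lapE _ p2) (lapE _ z00).
  have [hp1 hp2] := hb p p1.
  set x0 := complex.Re (p - z0); set y0 := complex.Im (p - z0).
  have hx0 : `|x0| <= t := le_trans (cabs_Re _) hp.
  have hy0 : `|y0| <= t := le_trans (cabs_Im _) hp.
  have pE x y : p + (x +i* y)%C = z0 + ((x0 + x) +i* (y0 + y))%C.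
    by rewrite -[p](subrKC z0) -addrA; congr (_ + _); rewrite /x0 /y0; case: (p - z0).
  have tr : t <= rho by lra.
  have nt : `|t| <= t by rewrite ger0_norm.
  have nnt : `|- t| <= t by rewrite normrN ger0_norm.
  have n0 : `|0 : R| <= t by rewrite normr0.
  have t2 : t <= 2 * t by lra.
  have bx (d : R) : `|d| <= t -> `|x0 + d| <= 2 * t by move=> hd; apply: le_trans (ler_normD _ _) _; lra.
  have by_ (d : R) : `|d| <= t -> `|y0 + d| <= 2 * t by move=> hd; apply: le_trans (ler_normD _ _) _; lra.
(* [9 = 1 + 8]: the remainder at [p] on the radius [t] and the remainder at [z0]
     on the radius [2 t]. *)
  have E1 (d1 d2 : R) : `|d1| <= t -> `|d2| <= t ->
    `|quad (b z0) (x0 + d1) (y0 + d2) - quad (b p) d1 d2| <= 9 * B * t ^+ 3.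
    move=> hd1 hd2; have a1 := hp2 d1 d2 t hd1 hd2 tr.
    have a2 := hz2 (x0 + d1) (y0 + d2) (2 * t) (bx _ hd1) (by_ _ hd2) ht.
    rewrite pE in a1.
    have -> : quad (b z0) (x0 + d1) (y0 + d2) - quad (b p) d1 d2 =
      (f (z0 + ((x0 + d1) +i* (y0 + d2))%C) - quad (b p) d1 d2) -
      (f (z0 + ((x0 + d1) +i* (y0 + d2))%C) - quad (b z0) (x0 + d1) (y0 + d2)) by ring.
    apply: le_trans (ler_normB _ _) _.
    have : B * (2 * t) ^+ 3 = 8 * B * t ^+ 3 by ring.
    lra.
  have e0 := E1 0 0 n0 n0.
  have e1 := E1 t 0 nt n0; have e2 := E1 (- t) 0 nnt n0.
  have e3 := E1 0 t n0 nt; have e4 := E1 0 (- t) n0 nnt.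
  have tt : 0 < t ^+ 2 by rewrite exprn_gt0.
  rewrite -(ler_pM2r tt) -[X in _ * X <= _](ger0_norm (ltW tt)) -normrM.
  have -> : ((b p 2%N 0%N + b p 0%N 2%N) / 2 - (b z0 2%N 0%N + b z0 0%N 2%N) / 2) * t ^+ 2 =
    - ((quad (b z0) (x0 + t) (y0 + 0) - quad (b p) t 0) + (quad (b z0) (x0 - t) (y0 + 0) - quad (b p) (- t) 0)
     + (quad (b z0) (x0 + 0) (y0 + t) - quad (b p) 0 t) + (quad (b z0) (x0 + 0) (y0 - t) - quad (b p) 0 (- t))
     - 4 * (quad (b z0) (x0 + 0) (y0 + 0) - quad (b p) 0 0)) / 4.
    by rewrite /quad; field.
  have : 18 * B * t * t ^+ 2 = 18 * B * t ^+ 3 by ring.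
  move: e0 e1 e2 e3 e4; rewrite !ler_norml; set q0 := _ - _; set q1 := _ - _; set q2 := _ - _; set q3 := _ - _; set q4 := _ - _.
  have BT : 0 <= B * t ^+ 3 by rewrite mulr_ge0 // exprn_ge0.
  move=> /andP[a1 a2] /andP[a3 a4] /andP[a5 a6] /andP[a7 a8] /andP[a9 a10] ->.
  by clear - a1 a2 a3 a4 a5 a6 a7 a8 a9 a10 BT; apply/andP; split; lra.
pose l := laplacian f z0.
(* The four constraints: the expansions hold on radius [2 e]; the Laplacian varies
   by at most [l / 2] on radius [e]; its lower bound [l / 2] is at least [e]; the
   remainder constant [B] is at most [1 / e]. *)
pose e := Num.min (rho / 4) (Num.min (l / 2 / (18 * B + 1)) (Num.min (l / 2) (B + 1)^-1)).
have B18 : 0 < 18 * B + 1 by rewrite ltr_wpDl // mulr_ge0.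
have B11 : 0 < B + 1 by rewrite ltr_wpDl.
have e0 : 0 < e by rewrite !lt_min !divr_gt0 //= invr_gt0.
have c1 : e <= rho / 4 by rewrite ge_min lexx.
have c2 : e <= l / 2 / (18 * B + 1) by rewrite !ge_min lexx !orbT.
have c3 : e <= l / 2 by rewrite !ge_min lexx !orbT.
have c4 : e <= (B + 1)^-1 by rewrite !ge_min lexx !orbT.
have c5 : B <= e^-1.
  by apply: le_trans (_ : B + 1 <= _); rewrite ?lerDl // -[B + 1]invrK lef_pV2 ?posrE ?invr_gt0.
exists e; first exact: e0.
move=> p hp.
have p2 : cabs (p - z0) <= rho / 2 by lra.
have pr : cabs (p - z0) <= rho by lra.
have [hp1 hp2] := hb p pr.
have hr2 : 2 * e <= rho by lra.
split.
  have := lap_cont p e hp hr2; rewrite -/l ler_norml => /andP[h1 _].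
  rewrite (ler_pdivlMr _ _ B18) in c2.
  by have l1 : 0 < l := l0; clear - h1 c2 l1; lra.
exists ((b p 1%N 0%N) +i* (- b p 0%N 1%N))%C, (((b p 2%N 0%N - b p 0%N 2%N) / 2) +i* (- (b p 1%N 1%N / 2)))%C.
move=> [x y] hh.
have b00 : f p = b p 0%N 0%N.
  have := hp2 0 0 0; rewrite normr0 => /(_ (lexx _) (lexx _) (ltW r0)).
  rewrite /quad !mulr0 expr0n /= !mulr0 !addr0 expr0n /= mulr0 normr_le0 subr_eq0.
  by move/eqP.
have hx := cabs_Re (x +i* y)%C; have hy := cabs_Im (x +i* y)%C; rewrite /= in hx hy.
have hr : cabs (x +i* y)%C <= rho by lra.
have := hp2 x y _ hx hy hr => h.
apply: le_trans (_ : B * cabs (x +i* y)%C ^+ 3 <= _); last first.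
  by rewrite mulrC ler_wpM2l // exprn_ge0 // cabs_ge0.
apply: le_trans h; rewrite le_eqVlt; apply/orP; left; apply/eqP; congr (`|_|).
rewrite lapE // cabs_sqr b00 quad_Re /=; ring.
Qed.

End QuadraticModel.

(** * Similarities of the plane and Lebesgue measure *)
Section ChangeOfVariables.
Variable R : realType.
Local Notation C := (R[i]%C).
Local Notation lam := (@lebesgue_measure R).
Local Notation MR := (measurableTypeR R).

Lemma measurable_affine (s c : R) : measurable_fun setT (fun x : MR => (s + c * x : MR)).
Proof. by apply: measurable_funD => //; apply: measurable_funM. Qed.

Lemma lebesgue_affine (s c : R) (A : set MR) : c != 0 -> measurable A ->
  lam A = (`|c|%:E * lam ((fun x : MR => (s + c * x)%R : MR) @^-1` A))%E.
Proof.
move=> c0 mA; pose phi : MR -> MR := fun x => s + c * x.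
have mphi : measurable_fun setT phi := measurable_affine s c.
have h0 : 0 <= `|c| by [].
pose mu : {measure set MR -> \bar R} := mscale (NngNum h0) (pushforward lam phi).
suff : lam A = mu mphi A by [].
apply: lebesgue_measure_unique mA => _ [[a b] _ <-] /=.
rewrite /mu /mscale /=; change (lam `]a, b] = (`|c|%:E * lam (phi @^-1` `]a, b]))%E).
have [cp|cn|/eqP] := ltgtP 0 c; last by rewrite eq_sym (negbTE c0).
- have -> : phi @^-1` `]a, b] = `](a - s) / c, (b - s) / c]%classic.
    apply/seteqP; split=> x /=; rewrite !in_itv /= /phi.
      by move=> /andP[h1 h2]; rewrite ltr_pdivrMr // ler_pdivlMr //; apply/andP; split; lra.
    by rewrite ltr_pdivrMr // ler_pdivlMr // => /andP[h1 h2]; apply/andP; split; lra.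
  rewrite !lebesgue_measure_itv /= !lte_fin ltr_pM2r ?invr_gt0 // ltrD2r.
  case: ifP => _; last by rewrite mule0.
  by rewrite -!EFinB -EFinM (gtr0_norm cp); congr EFin; field; rewrite gt_eqF.
- have -> : phi @^-1` `]a, b] = `[(b - s) / c, (a - s) / c[%classic.
    apply/seteqP; split=> x /=; rewrite !in_itv /= /phi.
      by move=> /andP[h1 h2]; rewrite ler_ndivrMr // ltr_ndivlMr //; apply/andP; split; lra.
    by rewrite ler_ndivrMr // ltr_ndivlMr // => /andP[h1 h2]; apply/andP; split; lra.
  rewrite !lebesgue_measure_itv /= !lte_fin ltr_nM2r ?invr_lt0 // ltrD2r.
  case: ifP => _; last by rewrite mule0.
  by rewrite -!EFinB -EFinM (ltr0_norm cn); congr EFin; field; rewrite lt_eqF.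
Qed.

Lemma integral_affine (s c : R) (g : MR -> \bar R) : c != 0 ->
  measurable_fun setT g -> (forall x, 0 <= g x)%E ->
  (\int[lam]_x g x = `|c|%:E * \int[lam]_x g (s + c * x)%R)%E.
Proof.
move=> c0 mg g0; pose phi : MR -> MR := fun x => s + c * x.
have mphi : measurable_fun setT phi := measurable_affine s c.
have h0 : 0 <= `|c| by [].
pose nu : {measure set MR -> \bar R} := pushforward lam phi.
pose mu : {measure set MR -> \bar R} := mscale (NngNum h0) (nu mphi).
rewrite (@eq_measure_integral _ _ _ _ mu) /=; last first.
  by move=> A mA _; exact: lebesgue_affine.
rewrite (@ge0_integral_mscale _ _ _ (nu mphi) setT) //=; congr (_ * _)%E.
by rewrite (@ge0_integral_pushforward _ _ _ _ _ phi).
Qed.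

Local Notation lam2 := (@lebesgue_measure R \x @lebesgue_measure R)%E.

Lemma measurable_shear1 (p c s : R) : measurable_fun setT
  (fun u : plane R => ((p + c * u.1 + s * u.2, u.2) : plane R)).
Proof.
apply: measurable_fun_pair; last exact: measurable_snd.
apply: measurable_funD.
  by apply: measurable_funD => //; apply: measurable_funM => //; exact: measurable_fst.
by apply: measurable_funM => //; exact: measurable_snd.
Qed.

Lemma measurable_shear2 (p c s : R) : measurable_fun setT
  (fun u : plane R => ((u.1, p + c * u.2 + s * u.1) : plane R)).
Proof.
apply: measurable_fun_pair; first exact: measurable_fst.
apply: measurable_funD.
  by apply: measurable_funD => //; apply: measurable_funM => //; exact: measurable_snd.
by apply: measurable_funM => //; exact: measurable_fst.
Qed.

Lemma integral_shear1 (p c s : R) (G : plane R -> \bar R) : c != 0 ->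
  measurable_fun setT G -> (forall u, 0 <= G u)%E ->
  (\int[lam2]_u G u = `|c|%:E * \int[lam2]_u G (p + c * u.1 + s * u.2, u.2)%R)%E.
Proof.
move=> c0 mG G0; have mH := measurableT_comp mG (measurable_shear1 p c s).
set H := (G \o _) in mH; have H0 u : (0 <= H u)%E by exact: G0.
rewrite (@fubini_tonelli2 _ _ _ _ _ lam lam _ mG) // (@fubini_tonelli2 _ _ _ _ _ lam lam _ mH) //.
rewrite -ge0_integralZl //; last 2 first.
- by apply: measurable_fun_fubini_tonelli_G => // u; exact: G0.
- by move=> y _; apply: integral_ge0 => x _; exact: G0.
apply: eq_integral => y _; rewrite /fubini_G /=.
rewrite (@integral_affine (p + s * y) c) //; last first.
  exact: measurableT_comp mG (measurable_pair2 _).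
by congr (_ * _)%E; apply: eq_integral => x _; rewrite /H /= addrAC.
Qed.

Lemma integral_shear2 (p c s : R) (G : plane R -> \bar R) : c != 0 ->
  measurable_fun setT G -> (forall u, 0 <= G u)%E ->
  (\int[lam2]_u G u = `|c|%:E * \int[lam2]_u G (u.1, p + c * u.2 + s * u.1)%R)%E.
Proof.
move=> c0 mG G0; have mH := measurableT_comp mG (measurable_shear2 p c s).
set H := (G \o _) in mH; have H0 u : (0 <= H u)%E by exact: G0.
rewrite (@fubini_tonelli1 _ _ _ _ _ lam lam _ mG) // (@fubini_tonelli1 _ _ _ _ _ lam lam _ mH) //.
rewrite -ge0_integralZl //; last 2 first.
- by apply: measurable_fun_fubini_tonelli_F => // u; exact: G0.
- by move=> y _; apply: integral_ge0 => x _; exact: G0.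
apply: eq_integral => x _; rewrite /fubini_F /=.
rewrite (@integral_affine (p + s * x) c) //; last first.
  exact: measurableT_comp mG (measurable_pair1 _).
by congr (_ * _)%E; apply: eq_integral => y _; rewrite /H /= addrAC.
Qed.

(** The matrix with rows [(x, -y)] and [(y, x)] is, for [x != 0], the product of two
shears [(u, v) -> (p1 + x u - y v, v)] and
[(u, v) -> (u, p2' + c v + s u)], each of which is affine in one coordinate and is
handled by Tonelli's theorem. *)
Lemma integral_similarity (p1 p2 x y : R) (G : plane R -> \bar R) : x != 0 ->
  measurable_fun setT G -> (forall u, 0 <= G u)%E ->
  (\int[lam2]_u G u = (x ^+ 2 + y ^+ 2)%:E *
     \int[lam2]_u G (p1 + x * u.1 - y * u.2, p2 + y * u.1 + x * u.2)%R)%E.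
Proof.
move=> x0 mG G0; pose c := (x ^+ 2 + y ^+ 2) / x; pose s := y / x.
have n0 : 0 < x ^+ 2 + y ^+ 2 by rewrite ltr_wpDr ?sqr_ge0 // exprn_even_gt0.
have c0 : c != 0 by rewrite mulf_neq0 ?invr_eq0 // gt_eqF.
have mH := measurableT_comp mG (measurable_shear2 (p2 - s * p1) c s).
rewrite (integral_shear2 (p2 - s * p1) s c0 mG G0).
rewrite (integral_shear1 p1 (- y) x0 mH (fun u => G0 _)).
rewrite muleA -EFinM -normrM /c (mulfVK x0) (gtr0_norm n0); congr (_ * _)%E.
apply: eq_integral => u _ /=; congr (G (_, _)); first ring.
by rewrite /c /s; field.
Qed.

Definition cmeas (f : C -> C) := measurable_fun setT (fun u : plane R => complex.Re (f (toC u)))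
  /\ measurable_fun setT (fun u : plane R => complex.Im (f (toC u))).

Lemma measurable_simil (p a : C) : measurable_fun setT (fun u : plane R =>
   ((complex.Re (p + a * (toC u : C)), complex.Im (p + a * (toC u : C))) : plane R)).
Proof.
have h (k : R) : measurable_fun setT (fun u : plane R => k * u.1).
  by apply: measurable_funM => //; exact: measurable_fst.
have h' (k : R) : measurable_fun setT (fun u : plane R => k * u.2).
  by apply: measurable_funM => //; exact: measurable_snd.
apply: measurable_fun_pair.
  rewrite (_ : (fun u : plane R => _) = (fun u => complex.Re p + (complex.Re a * u.1 - complex.Im a * u.2))).
    by apply: measurable_funD => //; apply: measurable_funB.
  by apply/funext => u; rewrite ReCD ReCM.
rewrite (_ : (fun u : plane R => _) = (fun u => complex.Im p + (complex.Re a * u.2 + complex.Im a * u.1))).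
  by apply: measurable_funD => //; apply: measurable_funD.
by apply/funext => u; rewrite ImCD ImCM.
Qed.

Lemma toC_ReIm (z : C) : toC (complex.Re z, complex.Im z) = z.
Proof. by case: z. Qed.

Lemma integral_dAE (G : plane R -> \bar R) : measurable_fun setT G -> (forall u, 0 <= G u)%E ->
  (\int[dA R]_u G u = (pi^-1)%:E * \int[lam2]_u G u)%E.
Proof. by move=> mG G0; rewrite /dA ge0_integral_mscale. Qed.

Lemma measurable_comp_simil (p a : C) (g : C -> \bar R) :
  measurable_fun setT (fun u : plane R => g (toC u)) ->
  measurable_fun setT (fun u : plane R => g (p + a * (toC u : C))).
Proof.
move=> mg; have := measurableT_comp mg (measurable_simil p a).
by congr (measurable_fun _ _); apply/funext => u /=; rewrite toC_ReIm.
Qed.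

Lemma integral_dA_simil_Re (p a : C) (g : C -> \bar R) : complex.Re a != 0 ->
  measurable_fun setT (fun u : plane R => g (toC u)) -> (forall z, 0 <= g z)%E ->
  (\int[dA R]_u g (toC u) = (cabs a ^+ 2)%:E * \int[dA R]_u g (p + a * (toC u : C))%R)%E.
Proof.
move=> a0 mg g0; have mg' := measurable_comp_simil p a mg.
rewrite !integral_dAE //.
rewrite (integral_similarity (complex.Re p) (complex.Im p) (complex.Im a) a0 mg) // cabs_sqr.
rewrite muleCA; congr (_ * (_ * _))%E; apply: eq_integral => u _ /=.
congr g; apply: complex_ext; rewrite ?ReCD ?ImCD ?ReCM ?ImCM /=; ring.
Qed.

(** When [Re a = 0], write [a = b b'] with [b = 1 + i]: both factors have non-zero
real part. *)
Lemma integral_dA_simil (p a : C) (g : C -> \bar R) : a != 0 ->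
  measurable_fun setT (fun u : plane R => g (toC u)) -> (forall z, 0 <= g z)%E ->
  (\int[dA R]_u g (toC u) = (cabs a ^+ 2)%:E * \int[dA R]_u g (p + a * (toC u : C))%R)%E.
Proof.
move=> a0 mg g0; have [r0|r0] := eqVneq (complex.Re a) 0; last exact: integral_dA_simil_Re.
pose b : C := (1 +i* 1)%C; pose b' := a / b.
have b0 : b != 0 by rewrite eq_complex /= oner_eq0.
have rb : complex.Re b != 0 by rewrite /= oner_eq0.
have rb' : complex.Re b' != 0.
  have ab : a = b' * b by rewrite /b' mulfVK.
  have := congr1 (@complex.Re R) ab; have := congr1 (@complex.Im R) ab.
  rewrite ReCM ImCM r0 /= !mulr1 => h1 h2; apply/eqP => h3.
  move/negP: a0; apply; apply/eqP/complex_ext => /=; rewrite ?r0 // h1 h3.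
  by move: h2; rewrite h3; lra.
rewrite (integral_dA_simil_Re p rb mg g0).
rewrite (integral_dA_simil_Re (g := fun z => g (p + b * z)) 0 rb') //; last exact: measurable_comp_simil.
rewrite muleA -EFinM -exprMn -cabsM [b * b']mulrC /b' mulfVK //.
congr (_ * _)%E; apply: eq_integral => u _; congr (g (_ + _)).
by rewrite add0r mulrA [b * _]mulrC mulfVK.
Qed.

End ChangeOfVariables.

(** * The sub-mean value inequality *)
Section Disc.
Variable R : realType.
Local Notation C := (R[i]%C).

Lemma cmeas_cst (c : C) : cmeas (fun _ : C => c).
Proof. by split; exact: measurable_cst. Qed.
Lemma cmeas_id : cmeas (fun z : C => z).
Proof. by split; [exact: measurable_fst|exact: measurable_snd]. Qed.
Lemma cmeasD f g : cmeas f -> cmeas g -> cmeas (fun z : C => f z + g z).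
Proof.
move=> [f1 f2] [g1 g2]; split.
  have := measurable_funD f1 g1; congr (measurable_fun _ _); apply/funext => u /=; by rewrite ReCD.
have := measurable_funD f2 g2; congr (measurable_fun _ _); apply/funext => u /=; by rewrite ImCD.
Qed.
Lemma cmeasM f g : cmeas f -> cmeas g -> cmeas (fun z : C => f z * g z).
Proof.
move=> [f1 f2] [g1 g2]; split.
  have := measurable_funB (measurable_funM f1 g1) (measurable_funM f2 g2).
  by congr (measurable_fun _ _); apply/funext => u /=; rewrite ReCM.
have := measurable_funD (measurable_funM f1 g2) (measurable_funM f2 g1).
by congr (measurable_fun _ _); apply/funext => u /=; rewrite ImCM.
Qed.
Lemma cmeas_sum (I : Type) (r : seq I) (F : I -> C -> C) :
  (forall i, cmeas (F i)) -> cmeas (fun z => \sum_(i <- r) F i z).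
Proof.
move=> h; elim: r => [|i r IH].
  rewrite (_ : (fun z => _) = (fun=> 0)); first exact: cmeas_cst.
  by apply/funext => z; rewrite big_nil.
rewrite (_ : (fun z => _) = (fun z => F i z + \sum_(i <- r) F i z)); first exact: cmeasD.
by apply/funext => z; rewrite big_cons.
Qed.
Lemma cmeasX f n : cmeas f -> cmeas (fun z : C => f z ^+ n).
Proof.
move=> hf; elim: n => [|n IH].
  by rewrite (_ : (fun z => _) = (fun=> 1)) //; exact: cmeas_cst.
rewrite (_ : (fun z => _) = (fun z => f z * f z ^+ n)); first exact: cmeasM.
by apply/funext => z; rewrite exprS.
Qed.
Lemma cmeas_pol2 P f u : pol2 P -> cmeas f -> cmeas (fun z : C => P (f z) u).
Proof.
move=> /pol2_coef[N [a [ha _]]] hf.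
rewrite (_ : (fun z => _) = (fun z => psum N a (f z) u)); last first.
  by apply/funext => z; rewrite ha.
apply: cmeas_sum => j; apply: cmeas_sum => k; apply: cmeasM; last exact: cmeas_cst.
by apply: cmeasM; [exact: cmeas_cst|exact: cmeasX].
Qed.
Lemma cmeas_sqr f : cmeas f -> measurable_fun setT (fun u : plane R => cabs (f (toC u)) ^+ 2).
Proof.
move=> [f1 f2]; have := measurable_funD (measurable_funX 2 f1) (measurable_funX 2 f2).
by congr (measurable_fun _ _); apply/funext => u /=; rewrite cabs_sqr.
Qed.

Definition disc : set C := [set z | cabs z <= 1].
Definition pdisc : set (plane R) := [set u | disc (toC u)].

Lemma measurable_pdisc : measurable pdisc.
Proof.
have h := cmeas_sqr cmeas_id.
rewrite (_ : pdisc = setT `&` (fun u : plane R => cabs (toC u) ^+ 2) @^-1` `]-oo, 1]%classic).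
  by apply: h => //; exact: measurable_itv.
apply/seteqP; split=> u; rewrite /pdisc /disc /= in_itv /=.
  by move=> h1; split => //; rewrite exprn_ile1 ?cabs_ge0.
by move=> [_]; rewrite expr_le1 ?cabs_ge0.
Qed.

Definition square (r : R) : set (plane R) := (`[- r, r]%classic : set (measurableTypeR R)) `*` (`[- r, r]%classic : set (measurableTypeR R)).

Lemma measurable_square r : measurable (square r).
Proof. by apply: measurableX; exact: measurable_itv. Qed.

Lemma dA_square (r : R) : 0 < r -> dA R (square r) = (pi^-1 * (2 * r) ^+ 2)%:E.
Proof.
move=> r0; have mi : measurable (`[- r, r]%classic : set (measurableTypeR R)) by exact: measurable_itv.
have e := @product_measure1E _ _ _ _ R (@lebesgue_measure R) (@lebesgue_measure R) _ _ mi mi.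
change ((pi^-1)%:E * (lebesgue_measure \x lebesgue_measure) (square r) = (pi^-1 * (2 * r) ^+ 2)%:E)%E.
have ei : lebesgue_measure (`[- r, r]%classic : set R) = (2 * r)%:E.
  by rewrite lebesgue_measure_itv /= lte_fin gtrN // -EFinB; congr EFin; rewrite opprK; ring.
rewrite /square e; transitivity ((pi^-1)%:E * ((2 * r)%:E * (2 * r)%:E))%E.
  by congr (_ * (_ * _))%E; exact: ei.
by rewrite -!EFinM expr2.
Qed.

(** Enclosing the disc between two squares shows that its area, the
constant of the sub-mean value inequality, is positive and finite. *)
Lemma dA_disc : exists2 a : R, 0 < a & dA R pdisc = a%:E.
Proof.
have h1 : (dA R (square 2^-1) <= dA R pdisc)%E.
  apply: le_measure; rewrite ?inE; [exact: measurable_square|exact: measurable_pdisc|].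
  move=> [x y] [/=]; rewrite !in_itv /= -!ler_norml /pdisc /disc /= => hx hy.
  by apply: le_trans (cabs_le_ReIm (x +i* y)%C) _ => /=; lra.
have h2 : (dA R pdisc <= dA R (square 1))%E.
  apply: le_measure; rewrite ?inE; [exact: measurable_pdisc|exact: measurable_square|].
  move=> [x y]; rewrite /pdisc /disc /= => h; split; rewrite /= in_itv /= -ler_norml.
    exact: le_trans (cabs_Re (x +i* y)%C) h.
  exact: le_trans (cabs_Im (x +i* y)%C) h.
rewrite dA_square // in h2; rewrite dA_square // in h1.
have pi0 : 0 < pi^-1 * (2 * 2^-1) ^+ 2 :> R.
  by rewrite mulr_gt0 ?invr_gt0 ?pi_gt0 // exprn_gt0 // divr_gt0.
case: (dA R pdisc) h1 h2 => [a h1 _||]//; exists a => //.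
by rewrite lee_fin in h1; exact: lt_le_trans pi0 h1.
Qed.

Definition disc_area : R := fine (dA R pdisc).
Lemma disc_area_gt0 : 0 < disc_area.
Proof. by rewrite /disc_area; have [a a0 ->] := dA_disc. Qed.
Lemma dA_discE : dA R pdisc = disc_area%:E.
Proof. by rewrite /disc_area; have [a a0 ->] := dA_disc. Qed.

Definition disc_ind (z : C) : R := \1_disc z.
Lemma disc_ind_toC u : disc_ind (toC u) = (\1_pdisc u : R).
Proof. by rewrite /disc_ind !indicE; congr (_%:R); apply: congr1; apply/idP/idP; rewrite !inE. Qed.
Lemma disc_ind_ge0 z : 0 <= disc_ind z. Proof. by rewrite /disc_ind indicE. Qed.
Lemma measurable_disc_ind : measurable_fun setT (fun u : plane R => disc_ind (toC u)).
Proof.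
have : measurable_fun setT (\1_pdisc : plane R -> R) := measurable_indic measurable_pdisc.
by congr (measurable_fun _ _); apply/funext => u; rewrite disc_ind_toC.
Qed.

Lemma integral_disc_ind : (\int[dA R]_u (disc_ind (toC u))%:E = disc_area%:E)%E.
Proof.
under eq_integral do rewrite disc_ind_toC.
by rewrite integral_indic // ?setIT ?dA_discE //; exact: measurable_pdisc.
Qed.

Lemma integral_rotate (w : C) (g : C -> R) : cabs w = 1 ->
  measurable_fun setT (fun u : plane R => g (toC u)) -> (forall z, 0 <= g z) ->
  (\int[dA R]_u (g (w * (toC u : C)))%:E = \int[dA R]_u (g (toC u))%:E)%E.
Proof.
move=> w1 mg g0.
have w0 : w != 0 by apply/eqP => w0; move: w1; rewrite w0 cabs0 => /esym/eqP; rewrite oner_eq0.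
rewrite [RHS](integral_dA_simil (g := fun z => (g z)%:E) 0 w0).
- by rewrite w1 expr1n mul1e; apply: eq_integral => u _; rewrite add0r.
- by apply/measurable_EFinP.
- by move=> z; rewrite lee_fin.
Qed.

(** The mean value property with finitely many rotations and the inequality
[2 p q - p^2 <= q^2] give [N |P(z0)|^2 <= sum_s |P(z0 + w^s z)|^2] for every [z].
Integrate over the disc, which rotations preserve. *)
Lemma pol2_sub_mean_value P (z0 : C) : pol2 P ->
  ((disc_area * cabs (P z0 0) ^+ 2)%:E <= \int[dA R]_u (disc_ind (toC u) * cabs (P (z0 + (toC u : C)) 0%R) ^+ 2)%:E)%E.
Proof.
move=> hP; have [N [w [N0 w1 mv]]] := mean_value hP.
have NR : 0 < N%:R :> R by rewrite ltr0n.
pose g z := disc_ind z * cabs (P (z0 + z) 0) ^+ 2.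
have g0 z : 0 <= g z by rewrite mulr_ge0 ?disc_ind_ge0 // sqr_ge0.
have mg : measurable_fun setT (fun u : plane R => g (toC u)).
  apply: measurable_funM; first exact: measurable_disc_ind.
  apply: (@cmeas_sqr (fun z => P (z0 + z) 0)); apply: cmeas_pol2 => //.
  by apply: cmeasD; [exact: cmeas_cst|exact: cmeas_id].
have ws s : cabs (w ^+ s) = 1 by rewrite cabsX w1 expr1n.
have indw s z : disc_ind (w ^+ s * z) = disc_ind z.
  by rewrite /disc_ind !indicE; congr (_%:R); apply: congr1; apply/idP/idP; rewrite !inE /disc /= cabsM ws mul1r.
have ms s : measurable_fun setT (fun u : plane R => g (w ^+ s * (toC u : C))).
  have /measurable_EFinP mg' := mg.
  have := measurable_comp_simil 0 (w ^+ s) (g := fun z => (g z)%:E) mg'.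
  move=> /measurable_EFinP; congr (measurable_fun _ _); apply/funext => u /=.
  by rewrite add0r.
have pt z : N%:R * (disc_ind z * cabs (P z0 0) ^+ 2) <= \sum_(s < N) g (w ^+ s * z).
  rewrite /g; under eq_bigr do rewrite indw.
  rewrite -mulr_sumr mulrCA ler_wpM2l ?disc_ind_ge0 //.
  set p0 := cabs (P z0 0).
  have h1 : N%:R * p0 <= \sum_(s < N) cabs (P (z0 + w ^+ s * z) 0).
    rewrite /p0 -(cabs_nat R N) -cabsM -(mv z0 z); apply: le_trans (cabs_sum _ _ _) _.
    by apply: ler_sum => s _; rewrite [z * _]mulrC.
  have h2 : \sum_(s < N) (2 * p0 * cabs (P (z0 + w ^+ s * z) 0) - p0 ^+ 2) <=
      \sum_(s < N) cabs (P (z0 + w ^+ s * z) 0) ^+ 2.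
    apply: ler_sum => s _; have := sqr_ge0 (cabs (P (z0 + w ^+ s * z) 0) - p0).
    rewrite sqrrB; set q := cabs _; rewrite -mulr_natr; lra.
  apply: le_trans h2; rewrite sumrB -mulr_sumr sumr_const card_ord -mulr_natl.
  have p00 : 0 <= p0 := cabs_ge0 _.
  have := ler_wpM2l p00 h1; lra.
have : (\int[dA R]_u (N%:R * (disc_ind (toC u) * cabs (P z0 0) ^+ 2))%:E <=
   \int[dA R]_u (\sum_(s < N) g (w ^+ s * (toC u : C))%R)%:E)%E.
  apply: ge0_le_integral => //.
  - by move=> u _; rewrite lee_fin; apply: mulr_ge0; [exact: ltW|apply: mulr_ge0; [exact: disc_ind_ge0|exact: sqr_ge0]].
  - apply/measurable_EFinP; apply: measurable_funM => //; apply: measurable_funM => //.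
    exact: measurable_disc_ind.
  - apply/measurable_EFinP.
    exact: measurable_sum.
  - by move=> u _; rewrite lee_fin.
have -> : (\int[dA R]_u (N%:R * (disc_ind (toC u) * cabs (P z0 0%R) ^+ 2))%:E =
    (N%:R * cabs (P z0 0%R) ^+ 2 * disc_area)%:E)%E.
  rewrite EFinM -integral_disc_ind -ge0_integralZl //.
  - by apply: eq_integral => u _; rewrite -EFinM; congr EFin; ring.
  - by apply/measurable_EFinP; exact: measurable_disc_ind.
  - by move=> u _; rewrite lee_fin disc_ind_ge0.
  - by rewrite lee_fin mulr_ge0 ?sqr_ge0 // ltW.
under eq_integral do rewrite -sumEFin.
rewrite ge0_integral_sum //; last 2 first.
- by move=> s; apply/measurable_EFinP; exact: ms.
- by move=> s u _; rewrite lee_fin.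
under eq_bigr do rewrite integral_rotate //.
rewrite sumr_const card_ord => h.
rewrite -(@lee_pmul2l _ N%:R%:E) // ?lte_fin // -EFinM mulrA mulrAC; apply: le_trans h _.
by rewrite mule_natl.
Qed.

(** Take for [P] a polynomial within [X / 4] of [F], where [X = |F(z0)|].  Then
[|P(z0)| >= 3 X / 4] while [|P|^2 <= 2 g + X^2 / 8] on the disc, and the term in
[X^2] is absorbed on the left: [9/16 - 1/8 = 7/16], and [2 / (7/16) <= 5]. *)
Lemma approx2_sub_mean_value (F : C -> C -> C) (z0 : C) (g : C -> R) : approx2 F ->
  measurable_fun setT (fun u : plane R => g (toC u)) -> (forall z, 0 <= g z) ->
  (forall z, cabs z <= 1 -> cabs (F (z0 + z) 0) ^+ 2 <= g z) ->
  ((disc_area * cabs (F z0 0) ^+ 2)%:E <= 5%:E * \int[dA R]_u (g (toC u))%:E)%E.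
Proof.
move=> hF mg g0 hg; set X := cabs (F z0 0).
have I0 : (0 <= \int[dA R]_u (g (toC u))%:E)%E by apply: integral_ge0 => u _; rewrite lee_fin.
have X0 : 0 <= X := cabs_ge0 _.
have [->|Xn] := eqVneq X 0; first by rewrite expr0n mulr0 mule_ge0.
have Xp : 0 < X by rewrite lt_neqAle eq_sym Xn.
have e0 : 0 < X / 4 by rewrite divr_gt0.
have [P hP hFP] := hF (cabs z0 + 1) _ e0.
have b1 z : cabs z <= 1 -> cabs (F (z0 + z) 0 - P (z0 + z) 0) <= X / 4.
  move=> hz; apply: hFP; first by apply: le_trans (cabsD _ _) _; rewrite lerD2l.
  by rewrite cabs0 addr_ge0 ?cabs_ge0.
have h0 : 3 / 4 * X <= cabs (P z0 0).
  have := b1 0; rewrite cabs0 addr0 => /(_ ler01) h.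
  have := cabsD (P z0 0) (F z0 0 - P z0 0); rewrite addrCA subrr addr0 -/X; lra.
have hpt z : disc_ind z * cabs (P (z0 + z) 0) ^+ 2 <= 2 * g z + 2 * (X / 4) ^+ 2 * disc_ind z.
  rewrite /disc_ind indicE; case: (asboolP (disc z)) => hz; last first.
    by rewrite memNset // mul0r mulr0 addr0 mulr_ge0.
  rewrite mem_set // mul1r mulr1.
  have a1 := hg z hz; have a2 := b1 z hz.
  have a3 : cabs (P (z0 + z) 0) <= cabs (F (z0 + z) 0) + X / 4.
    have -> : P (z0 + z) 0 = F (z0 + z) 0 - (F (z0 + z) 0 - P (z0 + z) 0) by ring.
    by apply: le_trans (cabsB _ _) _; rewrite lerD2l.
  have a4 : cabs (P (z0 + z) 0) ^+ 2 <= (cabs (F (z0 + z) 0) + X / 4) ^+ 2.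
    by rewrite lerXn2r ?nnegrE ?addr_ge0 ?cabs_ge0 // ltW.
  apply: le_trans a4 _; have := sqr_ge0 (cabs (F (z0 + z) 0) - X / 4).
  by move: a1; set q := cabs _; rewrite sqrrB sqrrD; nra.
have mi := measurable_disc_ind.
have /le_trans h1 := pol2_sub_mean_value z0 hP.
have h2 : ((disc_area * cabs (P z0 0) ^+ 2)%:E <=
    2%:E * \int[dA R]_u (g (toC u))%:E + (2 * (X / 4) ^+ 2 * disc_area)%:E)%E.
  have -> : ((2 * (X / 4) ^+ 2 * disc_area)%:E = (2 * (X / 4) ^+ 2)%:E * \int[dA R]_u (disc_ind (toC u))%:E)%E.
    by rewrite integral_disc_ind EFinM.
  have c0 : 0 <= 2 * (X / 4) ^+ 2 by rewrite mulr_ge0 ?sqr_ge0.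
  rewrite -!ge0_integralZl //; last 4 first.
  - by apply/measurable_EFinP.
  - by move=> u _; rewrite lee_fin disc_ind_ge0.
  - by apply/measurable_EFinP.
  - by move=> u _; rewrite lee_fin.
  rewrite -ge0_integralD //; last 4 first.
  - by move=> u _; rewrite -EFinM lee_fin mulr_ge0.
  - by apply/measurable_EFinP; apply: measurable_funM.
  - by move=> u _; rewrite -EFinM lee_fin mulr_ge0 ?disc_ind_ge0.
  - by apply/measurable_EFinP; apply: measurable_funM.
  apply: h1; apply: ge0_le_integral => //.
  - by move=> u _; rewrite lee_fin mulr_ge0 ?disc_ind_ge0 ?sqr_ge0.
  - apply/measurable_EFinP; apply: measurable_funM => //.
    apply: (@cmeas_sqr (fun z => P (z0 + z) 0)); apply: cmeas_pol2 => //.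
    by apply: cmeasD; [exact: cmeas_cst|exact: cmeas_id].
  - apply: emeasurable_funD; apply/measurable_EFinP; exact: measurable_funM.
  - by move=> u _; rewrite -!EFinM -EFinD lee_fin hpt.
have ap := disc_area_gt0.
case: (\int[dA R]_u (g (toC u))%:E)%E I0 h2 => [r||] //.
  rewrite lee_fin => r0; rewrite -!EFinM -EFinD !lee_fin => h2.
  have : (3 / 4 * X) ^+ 2 <= cabs (P z0 0) ^+ 2.
    by rewrite lerXn2r ?nnegrE ?cabs_ge0 // mulr_ge0.
  move=> /(ler_wpM2l (ltW ap)) h3.
  have X2 : 0 < disc_area * X ^+ 2 by rewrite mulr_gt0 // exprn_gt0.
  have e1 : 2 * (X / 4) ^+ 2 * disc_area = 1 / 8 * (disc_area * X ^+ 2) by field.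
  have e2 : disc_area * (3 / 4 * X) ^+ 2 = 9 / 16 * (disc_area * X ^+ 2) by field.
  rewrite e1 in h2; rewrite e2 in h3; lra.
by move=> _ _; rewrite mulry gtr0_sg // mul1e leey.
Qed.

End Disc.

(** * Uniformity of the quadratic model on the droplet *)
Section Compactness.
Variable R : realType.
Local Notation C := (R[i]%C).

(** The predicate at scale [1/(n+1)] holds near each point of [S] for all large [n];
compactness exchanges the quantifiers. *)
Lemma uniform_quad_model (Q : Cplx R -> \bar R) (S : set (Cplx R)) : compact S -> regular_near Q S ->
  exists2 e : R, 0 < e & forall p, S p ->
    quad_model (fun z => fine (Q z)) e p /\ forall h : C, cabs h <= e -> Q ((p : C) + h) \is a fin_num.
Proof.
move=> cS [Om [oO SO hO]].
have /compact_near_coveringP/(_ nat \oo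
  (fun n (p : Cplx R) => quad_model (fun z => fine (Q z)) n.+1%:R^-1 p /\
     forall h : C, cabs h <= n.+1%:R^-1 -> Q ((p : C) + h) \is a fin_num) _) h := cS.
have [|N _ hN] := h; last first.
  by exists N.+1%:R^-1 => [|p Sp]; [rewrite invr_gt0|exact: (hN N (leqnn _) p Sp)].
move=> x Sx; have [_ ra lp] := hO x (SO _ Sx).
have [e1 e10 he1] := analytic_quad_model ra lp.
have /nbhs_cabsP[d d0 hd] : nbhs x Om by apply: open_nbhs_nbhs; split => //; exact: SO.
pose e := Num.min e1 (d / 2).
have e0 : 0 < e by rewrite lt_min e10 divr_gt0.
have ee1 : e <= e1 by rewrite ge_min lexx.
have ed : e <= d / 2 by rewrite ge_min lexx orbT.
pose N := (Num.truncn e^-1).+1.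
exists ([set y : Cplx R | cabs (y - x) < e], [set n | (N <= n)%N]).
  split => /=; first by apply/nbhs_cabsP; exists e.
  by exists N.
move=> [y n] [/= hy Nn].
have ne : n.+1%:R^-1 < e.
  rewrite -[e]invrK ltf_pV2 ?posrE ?invr_gt0 //.
  by apply: lt_le_trans (truncnS_gt _) _; rewrite ler_nat (leq_trans Nn).
split.
  apply: (@quad_model_le R _ e1); [by rewrite invr_gt0|exact: le_trans (ltW ne) ee1|].
  by apply: he1; exact: le_trans (ltW hy) ee1.
move=> h' hh; have [] // := hO ((y : C) + h').
apply: hd; have -> : (y : C) + h' - x = (y - x : C) + h' by rewrite addrAC.
apply: le_lt_trans (cabsD _ _) _.
have h3 : cabs h' < e := le_lt_trans hh ne.
by have h4 := ltrD hy h3; apply: lt_le_trans h4 _; lra.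
Qed.
End Compactness.

(** * Reproducing kernels of weighted polynomials *)
Section Kernel.
Variable R : realType.
Local Notation C := (R[i]%C).
Implicit Types f g : C -> C.

Definition sqnorm (f : C -> C) : \bar R := (\int[dA R]_u (cabs (f (toC u)) ^+ 2)%:E)%E.

Lemma L2_cmeas (f : C -> C) : L2 f -> cmeas f. Proof. by case. Qed.

Lemma L2_integrable (f : C -> C) : L2 f -> (dA R).-integrable setT (fun u => (cabs (f (toC u)) ^+ 2)%:E).
Proof.
move=> hf; have [_ _ h] := hf; apply/integrableP; split.
  by apply/measurable_EFinP; apply: cmeas_sqr; exact: L2_cmeas.
under eq_integral do rewrite abse_EFin ger0_norm ?sqr_ge0 //.
exact: h.
Qed.

Lemma cmeas_conj f : cmeas f -> cmeas (fun z => conjc (f z)).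
Proof.
move=> [h1 h2]; split.
  by move: h1; congr (measurable_fun _ _); apply/funext => u /=; case: (f (toC u)).
have := measurable_funN h2; congr (measurable_fun _ _); apply/funext => u /=; by case: (f (toC u)).
Qed.

Lemma cross_integrable f g : L2 f -> L2 g ->
  (dA R).-integrable setT (fun u => (complex.Re (f (toC u) * conjc (g (toC u))))%:E) /\
  (dA R).-integrable setT (fun u => (complex.Im (f (toC u) * conjc (g (toC u))))%:E).
Proof.
move=> hf hg; have hi := integrableD (measurableT) (L2_integrable hf) (L2_integrable hg).
have [m1 m2] := cmeasM (L2_cmeas hf) (cmeas_conj (L2_cmeas hg)).
have bnd u (x : R) : `|x| <= cabs (f (toC u) * conjc (g (toC u))) ->
   (`|x%:E| <= `|(cabs (f (toC u)) ^+ 2)%:E + (cabs (g (toC u)) ^+ 2)%:E|)%E.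
  rewrite cabsM cabs_conj => hx; rewrite -EFinD !abse_EFin lee_fin.
  rewrite [X in _ <= X]ger0_norm ?addr_ge0 ?sqr_ge0 //; apply: le_trans hx _.
  set p := cabs _; set q := cabs _; have := sqr_ge0 (p - q); rewrite sqrrB -mulr_natr.
  have : 0 <= p * q by rewrite mulr_ge0 ?cabs_ge0.
  lra.
split.
  apply: le_integrable hi => //; first by apply/measurable_EFinP.
  by move=> u _; apply: bnd; exact: cabs_Re.
apply: le_integrable hi => //; first by apply/measurable_EFinP.
by move=> u _; apply: bnd; exact: cabs_Im.
Qed.

Lemma inner_conj (f g : C -> C) : L2 f -> L2 g -> inner g f = conjc (inner f g) :> C.
Proof.
move=> hf hg; have [h1 h2] := cross_integrable hf hg.
rewrite /inner /=; congr Complex.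
  by apply: eq_Rintegral => u _; case: (f (toC u)) (g (toC u)) => a b [c d] /=; ring.
rewrite -[RHS]mulN1r -RintegralZl //; apply: eq_Rintegral => u _.
by case: (f (toC u)) (g (toC u)) => a b [c d] /=; ring.
Qed.

Lemma inner_self (f : C -> C) : L2 f -> inner f f = (fine (sqnorm f))%:C%C :> C.
Proof.
move=> hf; rewrite /inner /=; congr Complex.
  rewrite /Rintegral /sqnorm; congr fine; apply: eq_integral => u _; congr EFin.
  by rewrite cabs_sqr; case: (f (toC u)) => a b /=; ring.
transitivity (\int[dA R]_u (0 : R)); last by rewrite /Rintegral integral0.
by apply: eq_Rintegral => u _; case: (f (toC u)) => a b /=; ring.
Qed.

Variables (Q : Cplx R -> \bar R) (n : nat) (K : Cplx R -> Cplx R -> Cplx R).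
Hypothesis (hK : is_reproducing_kernel (weighted_polynomials Q n) K).

Lemma kernel_L2 eta : L2 (fun z => K z eta).
Proof. by have [/(_ eta)[]] := hK. Qed.

Lemma kernel_inner eta zeta : K eta zeta = inner (fun z => K z zeta) (fun z => K z eta).
Proof. by have [h1 h2] := hK; exact: (h2 _ (h1 zeta) eta). Qed.

Lemma kernel_herm zeta eta : K zeta eta = conjc (K eta zeta).
Proof. by rewrite [LHS]kernel_inner [in RHS]kernel_inner; exact: inner_conj (kernel_L2 _) (kernel_L2 _). Qed.

Lemma kernel_sqnorm eta : sqnorm (fun z => K z eta) = (complex.Re (K eta eta))%:E.
Proof.
rewrite kernel_inner (inner_self (kernel_L2 eta)) /= fineK //.
rewrite ge0_fin_numE; first by have [_ _] := kernel_L2 eta.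
by apply: integral_ge0 => u _; rewrite lee_fin sqr_ge0.
Qed.

Lemma kernel_diag_ge0 eta : 0 <= complex.Re (K eta eta).
Proof.
rewrite -lee_fin -kernel_sqnorm; apply: integral_ge0 => u _; by rewrite lee_fin sqr_ge0.
Qed.

Lemma kernel_diag_real eta : K eta eta = (complex.Re (K eta eta))%:C%C.
Proof.
apply: complex_ext => //=; have := congr1 (@complex.Im R) (kernel_herm eta eta).
by case: (K eta eta) => a b /=; lra.
Qed.

(** For each [eta] the first variable enters through a polynomial [q eta] of degree
below [n], determined by its values at the [n] nodes [x i].  By Hermitian symmetry
[q eta (x i)] is, up to weights, the conjugate of [q (x i)] at [eta], a
polynomial in [conj eta]. *)
Lemma kernel_poly (x : 'I_n -> C) : injective x -> (forall i, weight Q n (x i) != 0) ->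
  exists2 P : C -> C -> C, pol2 P & forall zeta eta : C,
    K zeta eta = P zeta (conjc eta) * (weight Q n zeta * weight Q n eta)%:C%C.
Proof.
move=> xinj wx.
have /choice[q hq] (eta : C) : exists q : {poly R[i]%C}, (size q <= n)%N /\
   forall z : C, K z eta = q.[z] * (weight Q n z)%:C%C.
  by have [/(_ eta)[_ [q [h1 h2]]] _] := hK; exists q.
pose l (i : 'I_n) : {poly C} := \prod_(j < n | j != i) ((x i - x j)^-1 *: ('X - (x j)%:P)).
have xn i j : j != i -> x i - x j != 0 by move=> ji; rewrite subr_eq0 (inj_eq xinj) eq_sym.
have lii i : (l i).[x i] = 1.
  rewrite /l horner_prod big1 // => j ji; rewrite !hornerE mulVf //; exact: xn.
have lij i j : j != i -> (l i).[x j] = 0.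
  by move=> ji; rewrite /l horner_prod (bigD1 j) //= !hornerE subrr mulr0 mul0r.
have szl i : (size (l i) <= n)%N.
  rewrite /l; apply: leq_trans (size_poly_prod_leq _ _) _.
  have h1 : (\sum_(j < n | j != i) size ((x i - x j)^-1 *: ('X - (x j)%:P)) = \sum_(j < n | j != i) 2)%N.
    by apply: eq_bigr => j ji; rewrite size_scale ?size_XsubC // invr_eq0 xn.
  rewrite h1 sum_nat_const.
  have : (#|[pred j | j != i]| = n.-1)%N by rewrite cardC1 card_ord.
  rewrite (_ : #|[pred j | j != i]| = #|(fun j : 'I_n => j != i)|) // => ->.
  have := ltn_ord i; lia.
have qE eta : q eta = \sum_i ((q eta).[x i]) *: l i.
  apply/eqP; rewrite -subr_eq0; apply/eqP.
  apply: (@roots_geq_poly_eq0 _ _ [seq x i | i <- enum 'I_n]).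
  - apply/allP => y /mapP[i _ ->]; rewrite /root !hornerE horner_sum (bigD1 i) //=.
    rewrite hornerZ lii mulr1 big1 ?addr0 ?subrr // => j ji.
    by rewrite hornerZ lij ?mulr0 // eq_sym.
  - by rewrite map_inj_uniq ?enum_uniq.
  - rewrite size_map size_enum_ord; apply: leq_trans (size_polyD _ _) _.
    rewrite geq_max size_polyN; have [-> _] := hq eta.
    apply: leq_trans (size_sum _ _ _) _; apply/bigmax_leqP => i _.
    by apply: leq_trans (size_scale_leq _ _) (szl i).
pose rc (i : 'I_n) : {poly C} := map_poly conjc (q (x i)).
exists (fun z u => \sum_(i <- index_enum 'I_n) ((l i).[z] * (((weight Q n (x i))^-1)%:C%C * (rc i).[u]))).
  apply: pol2_sum => i; apply: pol2M; first exact: pol2_horner (pol2_fst _).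
  by apply: pol2M; [exact: pol2_cst|exact: pol2_horner (pol2_snd _)].
move=> zeta eta; have [_ hqe] := hq eta; rewrite hqe {1}(qE eta) horner_sum rmorphM /= mulrA mulr_suml.
rewrite !mulr_suml.
apply: eq_bigr => i _; rewrite hornerZ.
have wi : (weight Q n (x i))%:C%C != 0 :> C by rewrite eq_complex /= eqxx andbT.
have h1 : (q eta).[x i] = conjc (K eta (x i)) * ((weight Q n (x i))^-1)%:C%C.
  by rewrite -kernel_herm hqe -mulrA -rmorphM /= mulfV // mulr1.
have [_ hqx] := hq (x i).
have h2 : (rc i).[conjc eta] = conjc ((q (x i)).[eta]) by rewrite /rc horner_map.
have h3 : conjc (K eta (x i)) = conjc ((q (x i)).[eta]) * (weight Q n eta)%:C%C :> C.
  by rewrite hqx rmorphM /= oppr0.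
rewrite h1 h3 h2; ring.
Qed.

End Kernel.

(** * The rescaled kernel at a fixed index *)
Section Rescaling.
Variable R : realType.
Local Notation C := (R[i]%C).

Lemma conjCM (z w : C) : conjc (z * w) = conjc z * conjc w. Proof. exact: rmorphM. Qed.
Lemma conjCD (z w : C) : conjc (z + w) = conjc z + conjc w. Proof. exact: rmorphD. Qed.
Lemma conjCR (x : R) : conjc (x%:C%C : C) = x%:C%C. Proof. exact: conjc_real. Qed.
Lemma real_complexM (x y : R) : ((x * y)%:C%C : C) = x%:C%C * y%:C%C. Proof. exact: rmorphM. Qed.

Lemma continuous_conj_diag (F : C -> C -> C) : approx2 F ->
  continuous (fun zw : Cplx R * Cplx R => F zw.1 (conjc zw.2) : Cplx R).
Proof.
move=> hF; have hd := approx2_differentiable hF.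
apply: continuous2_cabsP => x e e0.
have hc := differentiable_continuous (hd (x.1, conjc x.2)).
have hn : nbhs (F x.1 (conjc x.2) : Cplx R) [set y | cabs (y - F x.1 (conjc x.2)) < e].
  by apply/nbhs_cabsP; exists e.
have /nbhs_cabs2P[d d0 h] := hc _ hn.
exists d => // y h1 h2; apply: (h (y.1, conjc y.2)) => //=.
by rewrite -rmorphB cabs_conj.
Qed.

(** The holomorphic polynomial whose real part is the harmonic part of the quadratic
model at [h = a z]. *)
Definition qpoly (al be a z : C) : C := al * (a * z) + be * (a * z) ^+ 2.

Lemma qpoly_conj al be a z : conjc (qpoly al be a z) = qpoly (conjc al) (conjc be) (conjc a) (conjc z).
Proof. by rewrite /qpoly !expr2 rmorphD !rmorphM. Qed.

Lemma pol2_qpoly1 al be a : pol2 (fun z _ : C => qpoly al be a z).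
Proof.
have h : pol2 (fun z _ : C => a * z) by apply: pol2M; [exact: pol2_cst|exact: pol2_fst].
by apply: pol2D; apply: pol2M; [exact: pol2_cst|exact: h|exact: pol2_cst|exact: pol2X].
Qed.
Lemma pol2_qpoly2 al be a : pol2 (fun _ u : C => qpoly al be a u).
Proof.
have h : pol2 (fun _ u : C => a * u) by apply: pol2M; [exact: pol2_cst|exact: pol2_snd].
by apply: pol2D; apply: pol2M; [exact: pol2_cst|exact: h|exact: pol2_cst|exact: pol2X].
Qed.

(** The phase of [e^(-n qpoly / 2)]. *)
Definition gauge (n : nat) (al be a z : C) : C :=
  cexp (0 +i* (- (n%:R / 2) * complex.Im (qpoly al be a z)))%C.

(** The continuity of [gauge] is that of [F z (conj z)], where
[F z u = exp (-n/4 (qpoly z - conj qpoly u))] is entire. *)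
Lemma gauge_cocycle n al be a :
  cocycle (fun z w : Cplx R => gauge n al be a z * conjc (gauge n al be a w) : C).
Proof.
exists (gauge n al be a); split => //; last by move=> z; rewrite cabs_cexp /= expR0.
pose F z u : C := 1 * cexp ((- (n%:R / 4))%:C%C * qpoly al be a z +
   (n%:R / 4)%:C%C * qpoly (conjc al) (conjc be) (conjc a) u).
have hF : approx2 F.
  apply: (@approx2_mulexp R (fun _ _ => 1)); first exact: pol2_cst.
  apply: pol2D; apply: pol2M; [exact: pol2_cst|exact: pol2_qpoly1|exact: pol2_cst|exact: pol2_qpoly2].
have hc := continuous_conj_diag hF.
apply/continuous_cabsP => x e e0.
have hn : nbhs (F x (conjc x) : Cplx R) [set y | cabs (y - F x (conjc x)) < e].
  by apply/nbhs_cabsP; exists e.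
have /nbhs_cabs2P[d d0 h] := hc (x, x) _ hn.
have gF z : gauge n al be a z = F z (conjc z).
  rewrite /F -qpoly_conj mul1r /gauge; congr cexp; case: (qpoly al be a z) => s t.
  by apply: complex_ext; rewrite ?ReCD ?ImCD ?ReCM ?ImCM /=; field.
by exists d => // y hy; rewrite !gF; exact: (h (y, y)).
Qed.

Variables (Q : Cplx R -> \bar R) (n : nat) (p : C) (theta e : R) (al be : C) (K : Cplx R -> Cplx R -> Cplx R).
Let f (z : C) : R := fine (Q z).
Let m : R := n%:R * lapQ Q p.
(** The map [z |-> p + a z] with [a = unscale_factor] undoes the rescaling. *)
Definition unscale_factor : C := cexp (0 +i* theta)%C / (Num.sqrt m)%:C%C.
Let a := unscale_factor.
Let q z := qpoly al be a z.

Lemma rescaled_kernelE z w : rescaled_kernel Q n p theta K z w =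
  (m^-1)%:C%C * (K (p + a * z) (p + a * w) : C) :> C.
Proof.
rewrite /rescaled_kernel -/m /a /unscale_factor; congr (_ * _).
by congr (K (_ + _) (_ + _)); rewrite mulrAC.
Qed.

Hypotheses (n0 : (0 < n)%N) (e0 : 0 < e) (lap_lo : e <= lapQ Q p).
Hypothesis (model : forall h : C, cabs h <= e ->
   `|f (p + h) - f p - complex.Re (al * h + be * h ^+ 2) - lapQ Q p * cabs h ^+ 2| <= cabs h ^+ 3 / e).
Hypothesis (Qfin : forall h : C, cabs h <= e -> Q (p + h) \is a fin_num).

Let n0R : 0 < n%:R :> R. Proof. by rewrite ltr0n. Qed.
Lemma n_lap_gt0 : 0 < m. Proof. by rewrite /m mulr_gt0 // (lt_le_trans e0). Qed.
Lemma cabs_unscale_factor : cabs a = (Num.sqrt m)^-1.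
Proof.
rewrite /a /unscale_factor cabsM cabsV cabs_real cabs_cexp /= expR0 mul1r ger0_norm // sqrtr_ge0.
Qed.
Lemma sqr_cabs_unscale_factor : cabs a ^+ 2 = m^-1.
Proof. by rewrite cabs_unscale_factor exprVn sqr_sqrtr // ltW // n_lap_gt0. Qed.

(** The error of the quadratic model in the logarithm of the weight, see
[weight_exp]. *)
Definition model_err (z : C) : R :=
  - (n%:R / 2) * (f (p + a * z) - f p - complex.Re (q z)) + cabs z ^+ 2 / 2.

(** The quadratic term of the model is exactly [|z|^2], because
[n lapQ(p) |a|^2 = 1]. *)
Lemma model_err_bound z : cabs (a * z) <= e -> `|model_err z| <= n%:R * cabs (a * z) ^+ 3 / (2 * e).
Proof.
move=> h; have := model h; rewrite -/(qpoly al be a z) -/(q z) => hm.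
have e1 : n%:R * lapQ Q p * cabs (a * z) ^+ 2 = cabs z ^+ 2.
  by rewrite cabsM exprMn sqr_cabs_unscale_factor -/m mulrA mulfV ?mul1r // gt_eqF // n_lap_gt0.
have -> : model_err z = - (n%:R / 2) * (f (p + a * z) - f p - complex.Re (q z) - lapQ Q p * cabs (a * z) ^+ 2).
  by rewrite /model_err -e1; ring.
have n2 : 0 <= n%:R / 2 :> R by rewrite divr_ge0.
rewrite normrM normrN (ger0_norm n2).
apply: le_trans (ler_wpM2l n2 hm) _.
by rewrite le_eqVlt; apply/orP; left; apply/eqP; field; rewrite gt_eqF.
Qed.

Lemma weight_exp z : cabs (a * z) <= e -> weight Q n (p + a * z) =
  expR (- (n%:R / 2) * (f p + complex.Re (q z))) * expR (- (cabs z ^+ 2 / 2)) * expR (model_err z).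
Proof.
move=> h; have := Qfin h; rewrite /weight -expRD -expRD /model_err /f.
case: (Q (p + a * z)) => [r||] // _ /=; rewrite -?EFinM -?EFinN /=; congr expR; ring.
Qed.

(** The holomorphic function whose modulus is the weight up to the factor
[e^(-|z|^2/2)] and the error. *)
Definition hol_weight (z : C) : C := cexp ((- (n%:R / 2))%:C%C * ((f p)%:C%C + q z)).

Lemma gauge_hol_weight z : gauge n al be a z * (expR (- (n%:R / 2) * (f p + complex.Re (q z))))%:C%C = hol_weight z.
Proof.
rewrite /gauge /hol_weight -cexp_real -cexpD; congr cexp; rewrite -/(q z); case: (q z) => s t.
by apply: complex_ext; rewrite ?ReCD ?ImCD ?ReCM ?ImCM /=; ring.
Qed.

Lemma cabs_hol_weight z : cabs (hol_weight z) = expR (- (n%:R / 2) * (f p + complex.Re (q z))).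
Proof. by rewrite /hol_weight cabs_cexp ReCM ReCD /= mul0r subr0. Qed.

Hypothesis (hK : is_reproducing_kernel (weighted_polynomials Q n) K).

Lemma weight_gt0 (h : C) : cabs h <= e -> 0 < weight Q n (p + h).
Proof.
move=> hh; have := Qfin hh; rewrite /weight.
by case: (Q (p + h)) => [r||] // _; rewrite -EFinM -EFinN /= expR_gt0.
Qed.

(** The two weights contribute the moduli of [hol_weight] at [z] and [w]; the gauge
restores their phases, so that what appears is [hol_weight z] and the conjugate of
[hol_weight w], entire in [z] and [conj w].  The factor [e^(z conj w)] of the
Ginibre kernel is compensated in [Psi].  The error of the model is not entire, and
stays outside of [Psi]. *)
Lemma rescaled_form : exists2 Psi : C -> C -> C, approx2 Psi & forall z w : C,
  cabs (a * z) <= e -> cabs (a * w) <= e ->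
  gauge n al be a z * conjc (gauge n al be a w) * (rescaled_kernel Q n p theta K z w : C) =
   (ginibre z w : C) * Psi z (conjc w) * (expR (model_err z + model_err w))%:C%C.
Proof.
(* The interpolation nodes need a non-zero weight, hence lie where [Q] is finite. *)
pose x (i : 'I_n) : C := p + (e / i.+1%:R)%:C%C.
have hx (i : 'I_n) : cabs ((e / i.+1%:R)%:C%C : C) <= e.
  rewrite cabs_real ger0_norm ?divr_ge0 ?(ltW e0) // ler_pdivrMr // ler_peMr ?(ltW e0) //.
  by rewrite ler1n.
have xinj : injective x.
  move=> i j /addrI/complexI/(mulfI (lt0r_neq0 e0))/invr_inj/eqP; rewrite eqr_nat eqSS => /eqP.
  exact: val_inj.
have xw i : weight Q n (x i) != 0 by rewrite gt_eqF // weight_gt0.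
have [P hP KP] := kernel_poly hK xinj xw.
exists (fun z u => ((m^-1)%:C%C * P (p + a * z) (conjc p + conjc a * u)) *
  cexp ((- (n%:R / 2))%:C%C * ((f p)%:C%C + q z) +
        (- (n%:R / 2))%:C%C * ((f p)%:C%C + qpoly (conjc al) (conjc be) (conjc a) u) + (-1) * (z * u))).
  apply: approx2_mulexp.
    apply: pol2M; first exact: pol2_cst; apply: pol2_comp => //.
      by apply: pol2D; [exact: pol2_cst|apply: pol2M; [exact: pol2_cst|exact: pol2_fst]].
    by apply: pol2D; [exact: pol2_cst|apply: pol2M; [exact: pol2_cst|exact: pol2_snd]].
  apply: pol2D; last first.
    by apply: pol2M; [exact: pol2_cst|apply: pol2M; [exact: pol2_fst|exact: pol2_snd]].
  apply: pol2D; apply: pol2M; try exact: pol2_cst; apply: pol2D; try exact: pol2_cst.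
    exact: pol2_qpoly1.
  exact: pol2_qpoly2.
move=> z w hz hw; rewrite rescaled_kernelE KP !weight_exp //.
rewrite !cexpD -/(hol_weight z).
have -> : (- (n%:R / 2))%:C%C * ((f p)%:C%C + qpoly (conjc al) (conjc be) (conjc a) (conjc w)) =
    conjc ((- (n%:R / 2))%:C%C * ((f p)%:C%C + q w)).
  by rewrite conjCM conjCD !conjCR qpoly_conj.
rewrite cexp_conj -/(hol_weight w) -!gauge_hol_weight conjCM conjCD !conjCM !conjCR.
set gz := gauge _ _ _ _ z; set gw := gauge _ _ _ _ w.
have -> : (ginibre z w : C) = cexp (z * conjc w) * ((expR (- (cabs z ^+ 2 / 2)))%:C%C * (expR (- (cabs w ^+ 2 / 2)))%:C%C).
  rewrite /ginibre -!cexp_real -!cexpD; congr cexp.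
  by rewrite -rmorphD -opprD rmorphN.
have hzw : cexp (z * conjc w) * cexp (-1 * (z * conjc w)) = 1.
  by rewrite -cexpD mulN1r subrr cexp0.
rewrite expRD !real_complexM.
set W := P _ _.
move: hzw; set X := cexp (z * conjc w); set Y := cexp _ => hXY.
set t1 := (expR (- (n%:R / 2) * (f p + complex.Re (q z))))%:C%C.
set t2 := (expR (- (n%:R / 2) * (f p + complex.Re (q w))))%:C%C.
set t3 := (expR (- (cabs z ^+ 2 / 2)))%:C%C; set t4 := (expR (- (cabs w ^+ 2 / 2)))%:C%C.
set t5 := (expR (model_err z))%:C%C; set t6 := (expR (model_err w))%:C%C; set mi := (m^-1)%:C%C.
transitivity (gz * conjc gw * (mi * (W * (t1 * t3 * t5 * (t2 * t4 * t6)))) * (X * Y)).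
  by rewrite hXY mulr1.
ring.
Qed.

Definition sub_mean_cst (M : R) : R := 5 * expR 1 * expR ((M + 1) ^+ 2 + 1).

(** Apply [approx2_sub_mean_value] to [F], the polynomial [r] times [hol_weight]: on
the disc of radius [1] around [z0], the quotient of [|F|] and [|phi|] is between
two constants.  The change of variables [z |-> p + a z] costs the factor
[m = n lapQ(p)]. *)
Lemma weighted_poly_bound (phi : C -> C) (z0 : C) (M : R) : weighted_polynomials Q n phi ->
  cabs z0 <= M -> (forall z, cabs z <= M + 1 -> cabs (a * z) <= e /\ `|model_err z| <= 2^-1) ->
  ((disc_area R * cabs (phi (p + a * z0)) ^+ 2)%:E <= (sub_mean_cst M * m)%:E * sqnorm phi)%E.
Proof.
move=> [L2phi [r [_ hr]]] hz0 hM.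
have M0 : 0 <= M := le_trans (cabs_ge0 _) hz0.
pose F (z _ : C) : C := r.[p + a * z] * cexp ((- (n%:R / 2))%:C%C * ((f p)%:C%C + q z)).
have hF : approx2 F.
  apply: approx2_mulexp.
    apply: pol2_horner; apply: pol2D; first exact: pol2_cst.
    by apply: pol2M; [exact: pol2_cst|exact: pol2_fst].
  apply: pol2M; first exact: pol2_cst; apply: pol2D; [exact: pol2_cst|exact: pol2_qpoly1].
have FE z : cabs z <= M + 1 -> cabs (F z 0) ^+ 2 =
    cabs (phi (p + a * z)) ^+ 2 * expR (cabs z ^+ 2 - 2 * model_err z).
  move=> hz; have [h1 h2] := hM z hz.
  rewrite hr /F !cabsM -/(hol_weight z) cabs_hol_weight cabs_real (weight_exp h1).
  have h3 : (expR (- (cabs z ^+ 2 / 2)) * expR (model_err z)) ^+ 2 * expR (cabs z ^+ 2 - 2 * model_err z) = 1.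
    by rewrite -expRD -expRM_natl -expRD -[RHS]expR0; congr expR; field.
  have w0 : 0 <= expR (- (n%:R / 2) * (f p + complex.Re (q z))) * expR (- (cabs z ^+ 2 / 2)) * expR (model_err z).
    by rewrite !mulr_ge0 ?expR_ge0.
  rewrite (ger0_norm w0); move: h3; set t3 := expR _; set t5 := expR _; set t6 := expR _ => h3.
  by set A := cabs _; set t1 := expR _; transitivity ((A * t1) ^+ 2 * ((t3 * t5) ^+ 2 * t6));
    [rewrite h3 mulr1|ring].
pose g (z : C) : R := expR ((M + 1) ^+ 2 + 1) * cabs (phi (p + a * (z0 + z))) ^+ 2.
have g0 z : 0 <= g z by rewrite mulr_ge0 ?expR_ge0 ?sqr_ge0.
have mphi : measurable_fun setT (fun u : plane R => (cabs (phi (toC u)) ^+ 2)%:E).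
  by apply/measurable_EFinP; apply: cmeas_sqr; exact: L2_cmeas.
have mg : measurable_fun setT (fun u : plane R => g (toC u)).
  have := measurable_comp_simil (p + a * z0) a (g := fun z => (cabs (phi z) ^+ 2)%:E) mphi.
  move=> /measurable_EFinP h; apply: measurable_funM => //.
  by move: h; congr (measurable_fun _ _); apply/funext => u; rewrite mulrDr addrA.
have gF z : cabs z <= 1 -> cabs (F (z0 + z) 0) ^+ 2 <= g z.
  move=> hz; have hzz : cabs (z0 + z) <= M + 1 by apply: le_trans (cabsD _ _) _; exact: lerD.
  rewrite FE // /g mulrC ler_wpM2r ?sqr_ge0 // ler_expR.
  have [_] := hM _ hzz; rewrite ler_norml => /andP[h _].
  have : cabs (z0 + z) ^+ 2 <= (M + 1) ^+ 2.
    by rewrite lerXn2r ?nnegrE ?cabs_ge0 // addr_ge0.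
  lra.
have := approx2_sub_mean_value hF mg g0 gF => h.
have lo : cabs (phi (p + a * z0)) ^+ 2 <= expR 1 * cabs (F z0 0) ^+ 2.
  have hz1 : cabs z0 <= M + 1 by lra.
  rewrite (FE _ hz1) mulrCA -expRD ler_peMr ?sqr_ge0 //; apply: le_trans (expR_ge1Dx _); rewrite lerDl.
  have [_] := hM _ hz1; rewrite ler_norml => /andP[_ h2].
  by have := sqr_ge0 (cabs z0); lra.
have ap := disc_area_gt0 R.
apply: le_trans (_ : ((expR 1)%:E * (disc_area R * cabs (F z0 0) ^+ 2)%:E <= _)%E).
  rewrite -EFinM lee_fin; have := ler_wpM2l (ltW ap) lo.
  by rewrite [disc_area R * (expR 1 * _)]mulrCA.
apply: le_trans (_ : ((expR 1)%:E * (5%:E * \int[dA R]_u (g (toC u))%:E) <= _)%E).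
  by apply: lee_wpmul2l => //; rewrite lee_fin expR_ge0.
have a0 : a != 0.
  apply/eqP => a0; have := sqr_cabs_unscale_factor; rewrite a0 cabs0 expr0n /= => /esym/eqP.
  by rewrite invr_eq0 gt_eqF // n_lap_gt0.
have cov := integral_dA_simil (g := fun z => (cabs (phi z) ^+ 2)%:E) (p + a * z0) a0 mphi.
have -> : (\int[dA R]_u (g (toC u))%:E = (expR ((M + 1) ^+ 2 + 1))%:E * (m%:E * sqnorm phi))%E.
  rewrite /sqnorm cov ?sqr_cabs_unscale_factor; last by move=> z; rewrite lee_fin sqr_ge0.
  have mn : m != 0 by rewrite gt_eqF // n_lap_gt0.
  rewrite (muleA m%:E) -EFinM mulfV // mul1e -ge0_integralZl //.
  - by apply: eq_integral => u _; rewrite -EFinM /g mulrDr addrA.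
  - by have := measurable_comp_simil (p + a * z0) a (g := fun z => (cabs (phi z) ^+ 2)%:E) mphi.
  - by move=> u _; rewrite lee_fin sqr_ge0.
rewrite !muleA -!EFinM le_eqVlt; apply/orP; left; apply/eqP; congr (_%:E * _)%E.
by rewrite /sub_mean_cst; ring.
Qed.

Lemma sub_mean_cst_gt0 M : 0 < sub_mean_cst M.
Proof. by rewrite /sub_mean_cst !mulr_gt0 ?expR_gt0. Qed.

(** [weighted_poly_bound] for [K(., Y)], whose squared norm is [K(Y, Y)], gives
[disc_area * |K(X, Y)|^2 <= C m K(Y, Y)].  The case [X = Y] bounds the diagonal, which
bounds the right-hand side. *)
Lemma rescaled_kernel_bound (M : R) (z w : C) : cabs z <= M -> cabs w <= M ->
  (forall z, cabs z <= M + 1 -> cabs (a * z) <= e /\ `|model_err z| <= 2^-1) ->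
  cabs (rescaled_kernel Q n p theta K z w : C) <= sub_mean_cst M / disc_area R.
Proof.
move=> hz hw hM; have ap := disc_area_gt0 R; have mp := n_lap_gt0; have Cp := sub_mean_cst_gt0 M.
have Wk eta : weighted_polynomials Q n (fun z => K z eta) by have [h _] := hK; exact: h.
set X := p + a * z; set Y := p + a * w.
have D0 : 0 <= sub_mean_cst M * m / disc_area R.
  by apply: divr_ge0 (ltW ap); exact: mulr_ge0 (ltW Cp) (ltW mp).
have diag : complex.Re (K Y Y) <= sub_mean_cst M * m / disc_area R.
  set k := complex.Re (K Y Y); have k0 : 0 <= k := kernel_diag_ge0 hK Y.
  have := weighted_poly_bound (Wk Y) hw hM; rewrite (kernel_sqnorm hK) -EFinM lee_fin -/k -/Y.
  rewrite (kernel_diag_real hK Y) -/k cabs_real ger0_norm // => h.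
  have [kz|kn] := eqVneq k 0; first by rewrite kz.
  have kp : 0 < k by rewrite lt_neqAle eq_sym kn.
  rewrite ler_pdivlMr // -(ler_pM2r kp); apply: le_trans h.
  by rewrite le_eqVlt; apply/orP; left; apply/eqP; ring.
have off := weighted_poly_bound (Wk Y) hz hM.
rewrite (kernel_sqnorm hK) -EFinM lee_fin -/X in off.
have offd : cabs (K X Y) ^+ 2 <= (sub_mean_cst M * m / disc_area R) ^+ 2.
  rewrite -(ler_pM2l ap); apply: le_trans off _.
  apply: le_trans (_ : sub_mean_cst M * m * (sub_mean_cst M * m / disc_area R) <= _).
    by apply: ler_wpM2l diag; exact: mulr_ge0 (ltW Cp) (ltW mp).
  by rewrite le_eqVlt; apply/orP; left; apply/eqP; field; rewrite gt_eqF.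
have {}offd : cabs (K X Y) <= sub_mean_cst M * m / disc_area R.
  by move: offd; rewrite ler_pXn2r ?nnegrE ?cabs_ge0.
rewrite rescaled_kernelE cabsM cabs_real ger0_norm ?invr_ge0 ?(ltW mp) //.
rewrite ler_pdivrMl //; apply: le_trans offd _.
by rewrite le_eqVlt; apply/orP; left; apply/eqP; field; rewrite gt_eqF.
Qed.

(** The reproducing identity [int |K(., X)|^2 dA = K(X, X)] in rescaled coordinates:
the Jacobian [1/m] and the factors [1/m] of the rescaled kernel balance. *)
Lemma rescaled_mass (z : C) :
  (\int[dA R]_u (cabs (rescaled_kernel Q n p theta K z (toC u) : C) ^+ 2)%:E =
   (complex.Re (rescaled_kernel Q n p theta K z z : C))%:E)%E /\
  measurable_fun setT (fun u : plane R => (cabs (rescaled_kernel Q n p theta K z (toC u) : C) ^+ 2)%:E).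
Proof.
have mp := n_lap_gt0; have mn : m != 0 by rewrite gt_eqF.
set X := p + a * z.
have a0 : a != 0.
  apply/eqP => a0; have := sqr_cabs_unscale_factor; rewrite a0 cabs0 expr0n /= => /esym/eqP.
  by rewrite invr_eq0 (negbTE mn).
have mK : measurable_fun setT (fun u : plane R => (cabs (K (toC u) X) ^+ 2)%:E).
  apply/measurable_EFinP; apply: (@cmeas_sqr R (fun v => K v X)); apply: L2_cmeas.
  exact: kernel_L2 hK X.
have eq1 (u : plane R) : (cabs (rescaled_kernel Q n p theta K z (toC u) : C) ^+ 2)%:E =
    ((m ^- 2)%:E * (cabs (K (p + a * (toC u : C))%R X) ^+ 2)%:E)%E.
  rewrite rescaled_kernelE cabsM cabs_real (ger0_norm (_ : 0 <= m^-1)) ?invr_ge0 ?ltW //.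
  by rewrite (kernel_herm hK) cabs_conj exprMn exprVn EFinM.
have mK' := measurable_comp_simil p a (g := fun v => (cabs (K v X) ^+ 2)%:E) mK.
split; last first.
  rewrite (_ : (fun u => _) = (fun u => ((m ^- 2)%:E * (cabs (K (p + a * (toC u : C))%R X) ^+ 2)%:E)%E)); last first.
    by apply/funext => u; exact: eq1.
  exact: measurable_funeM.
under eq_integral do rewrite eq1.
rewrite ge0_integralZl //; last 2 first.
- by move=> u _; rewrite lee_fin sqr_ge0.
- by rewrite lee_fin invr_ge0 sqr_ge0.
have cov := integral_dA_simil (g := fun v => (cabs (K v X) ^+ 2)%:E) p a0 mK.
have sq := kernel_sqnorm hK X; rewrite /sqnorm cov in sq; last by move=> v; rewrite lee_fin sqr_ge0.
rewrite sqr_cabs_unscale_factor in sq.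
rewrite rescaled_kernelE -/X ReCM /= mul0r subr0.
by rewrite EFinM -sq muleA -EFinM -expr2 exprVn.
Qed.

End Rescaling.

(** * Scaling limits *)
Section ScalingLimit.
Variable R : realType.
Local Notation C := (R[i]%C).

Lemma cabs_ginibre (z w : C) : cabs (ginibre z w : C) = expR (- (cabs (z - w) ^+ 2 / 2)).
Proof.
rewrite /ginibre cabs_cexp; congr expR; rewrite !cabs_sqr.
case: z w => a b [c d]; by rewrite ReCD ReCN ReCM /=; field.
Qed.

Lemma ginibre_herm (z w : C) : (ginibre z w : C) = conjc (ginibre w z).
Proof.
rewrite /ginibre -cexp_conj; congr cexp; case: z w => a b [c d].
by apply: complex_ext; rewrite ?ReCD ?ImCD ?ReCN ?ImCN ?ReCM ?ImCM /=; ring.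
Qed.

Lemma ginibre_diag (z : C) : (ginibre z z : C) = 1.
Proof.
rewrite /ginibre (_ : _ - _ = 0 :> C) ?cexp0 // cabs_mulconj.
by rewrite [X in _ - X%:C%C](_ : _ = cabs z ^+ 2) ?subrr //; field.
Qed.

Lemma ginibre_neq0 (z w : C) : (ginibre z w : C) != 0.
Proof.
apply/eqP => h; have := cabs_ginibre z w; rewrite h cabs0 => /esym/eqP.
by rewrite gt_eqF // expR_gt0.
Qed.

Lemma expR_lip (x : R) : `|x| <= 2^-1 -> `|expR x - 1| <= 2 * `|x|.
Proof.
move=> hx; have h := expR_taylor hx.
have h1 : x ^+ 2 <= 2^-1 * `|x| by rewrite -(real_normK (num_real x)) expr2 ler_wpM2r.
have := ler_normD (expR x - 1 - x) x; rewrite subrK; lra.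
Qed.

Variables (Q : Cplx R -> \bar R) (p : nat -> C) (theta : nat -> R)
  (bK : nat -> Cplx R -> Cplx R -> Cplx R) (e : R) (al be : nat -> C).
Let a n := unscale_factor Q n (p n) (theta n).
Let er n (z : C) := model_err Q n (p n) (theta n) (al n) (be n) z.
Let g n (z : C) := gauge n (al n) (be n) (a n) z.
Let K n (z w : C) : C := rescaled_kernel Q n (p n) (theta n) (bK n) z w.
Let cK n (z w : C) : C := g n z * conjc (g n w) * K n z w.
Hypotheses (e0 : 0 < e) (lap_lo : forall n, (0 < n)%N -> e <= lapQ Q (p n)).
Hypothesis (model : forall n, (0 < n)%N -> forall h : C, cabs h <= e ->
   `|fine (Q (p n + h)) - fine (Q (p n)) - complex.Re (al n * h + be n * h ^+ 2)
     - lapQ Q (p n) * cabs h ^+ 2| <= cabs h ^+ 3 / e).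
Hypothesis (Qfin : forall n, (0 < n)%N -> forall h : C, cabs h <= e -> Q (p n + h) \is a fin_num).
Hypothesis (hK : forall n, (0 < n)%N -> is_reproducing_kernel (weighted_polynomials Q n) (bK n)).

Lemma gauge_unit n z : cabs (g n z) = 1.
Proof. by rewrite /g /gauge cabs_cexp /= expR0. Qed.

Lemma cabs_cK n z w : cabs (cK n z w) = cabs (K n z w).
Proof.
rewrite /cK (cabsM (g n z * conjc (g n w)) (K n z w)) (cabsM (g n z) (conjc (g n w))).
by rewrite cabs_conj !gauge_unit !mul1r.
Qed.

(** By [model_err_bound] the error is of order [n^(-1/2)]. *)
Lemma model_err_small (M d : R) : 0 < d -> exists N, forall n, (N <= n)%N -> (0 < n)%N /\
  forall z, cabs z <= M -> cabs (a n * z) <= e /\ `|er n z| <= d.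
Proof.
(* As soon as [n >= X^2 / e], the dilation [sqrt (n lapQ)] is at least [X]; the
   second and third terms of [X] then give the two bounds. *)
move=> d0; pose X : R := 1 + `|M| / e + `|M| ^+ 3 / (2 * e ^+ 2 * d).
have t1 : 0 <= `|M| / e by rewrite divr_ge0 // ltW.
have t2 : 0 <= `|M| ^+ 3 / (2 * e ^+ 2 * d).
  by rewrite divr_ge0 ?exprn_ge0 // !mulr_ge0 ?exprn_ge0 // ltW.
have X1 : 1 <= X by rewrite /X; lra.
have X0 : 0 < X by lra.
exists (Num.truncn (X ^+ 2 / e)).+1 => n Nn.
have n0 : (0 < n)%N by exact: leq_trans Nn.
have n0R : 0 < n%:R :> R by rewrite ltr0n.
split=> // z hz; pose m := n%:R * lapQ Q (p n).
have ml := lap_lo n0.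
have mp : 0 < m by rewrite mulr_gt0 // (lt_le_trans e0).
have nX : X ^+ 2 <= m.
  have : X ^+ 2 / e < n%:R by apply: lt_le_trans (truncnS_gt _) _; rewrite ler_nat.
  rewrite ltr_pdivrMr // => h; apply: le_trans (ltW h) _.
  by rewrite ler_wpM2l // ltW.
set r := Num.sqrt m.
have r2 : r ^+ 2 = m by rewrite sqr_sqrtr // ltW.
have r0 : 0 < r by rewrite sqrtr_gt0.
have rX : X <= r by rewrite -(ler_pXn2r (n:=2)) ?nnegrE ?(ltW X0) ?(ltW r0) // r2.
have hM : cabs z <= `|M| := le_trans hz (ler_norm M).
have az : cabs (a n * z) = cabs z / r by rewrite cabsM cabs_unscale_factor mulrC.
have ae : cabs (a n * z) <= e.
  rewrite az ler_pdivrMr // mulrC; apply: le_trans hM _.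
  rewrite -ler_pdivrMr //; apply: le_trans rX; rewrite /X; lra.
split=> //.
apply: le_trans (model_err_bound n0 e0 ml (model n0) ae) _.
rewrite -/(a n) az ler_pdivrMr ?mulr_gt0 // expr_div_n mulrA ler_pdivrMr ?exprn_gt0 //.
have nm : n%:R * e <= r ^+ 2 by rewrite r2 ler_wpM2l // ltW.
have h3 : `|M| ^+ 3 <= r * (2 * e ^+ 2 * d).
  rewrite -ler_pdivrMr ?mulr_gt0 ?exprn_gt0 //; apply: le_trans rX; rewrite /X; lra.
have hz3 : cabs z ^+ 3 <= `|M| ^+ 3 by rewrite lerXn2r ?nnegrE ?cabs_ge0.
have h4 := le_trans hz3 h3.
rewrite -(ler_pM2r e0).
have -> : n%:R * cabs z ^+ 3 * e = (n%:R * e) * cabs z ^+ 3 by ring.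
have -> : d * (2 * e) * r ^+ 3 * e = r ^+ 2 * (r * (2 * e ^+ 2 * d)) by ring.
by apply: ler_pM => //; rewrite ?exprn_ge0 ?cabs_ge0 // mulr_ge0 // ltW.
Qed.

Variable Psi : nat -> C -> C -> C.
Hypothesis (Psi_approx : forall n, approx2 (Psi n)).
Hypothesis (Psi_form : forall n, (0 < n)%N -> forall z w : C,
  cabs (a n * z) <= e -> cabs (a n * w) <= e ->
  cK n z w = (ginibre z w : C) * Psi n z (conjc w) * (expR (er n z + er n w))%:C%C).

(** The modulus of the Ginibre kernel and the exponential of the error are bounded
below on each polydisc, so the bound on the rescaled kernel passes to [Psi n]. *)
Lemma Psi_bounded (M : R) : exists B N, forall n, (N <= n)%N -> forall z u : C,
  cabs z <= M -> cabs u <= M -> cabs (Psi n z u) <= B.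
Proof.
have h2 : 0 < 2^-1 :> R by [].
have [N hN] := model_err_small (M + 1) h2.
pose C0 := sub_mean_cst M / disc_area R.
exists (C0 * expR (2 * M ^+ 2 + 1)), N => n Nn z u hz hu.
have [n0 hn] := hN n Nn.
have hw : cabs (conjc u) <= M by rewrite cabs_conj.
have M0 : 0 <= M := le_trans (cabs_ge0 _) hz.
have M1 : M <= M + 1 by rewrite lerDl.
have [z1 z2] := hn z (le_trans hz M1); have [w1 w2] := hn _ (le_trans hw M1).
have bnd := rescaled_kernel_bound n0 e0 (lap_lo n0) (Qfin n0) (hK n0) hz hw hn.
have := Psi_form n0 z1 w1; rewrite conjcK => /(congr1 (@cabs R)).
rewrite cabs_cK (cabsM (ginibre z (conjc u) * Psi n z u)) (cabsM (ginibre z (conjc u)) (Psi n z u)).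
rewrite cabs_ginibre cabs_real (gtr0_norm (expR_gt0 _)) => hf.
rewrite -[rescaled_kernel _ _ _ _ _ _ _]/(K n z (conjc u)) hf in bnd.
set q := cabs (Psi n z u) in bnd *.
have q0 : 0 <= q := cabs_ge0 _.
have hzw : cabs (z - conjc u) ^+ 2 <= 4 * M ^+ 2.
  have : cabs (z - conjc u) <= 2 * M by apply: le_trans (cabsB _ _) _; lra.
  move=> h; have : cabs (z - conjc u) ^+ 2 <= (2 * M) ^+ 2.
    by rewrite lerXn2r ?nnegrE ?cabs_ge0 // mulr_ge0.
  by rewrite exprMn; lra.
have lowb : expR (- (2 * M ^+ 2 + 1)) <= expR (- (cabs (z - conjc u) ^+ 2 / 2)) * expR (er n z + er n (conjc u)).
  rewrite -expRD ler_expR; move: z2 w2 hzw; rewrite -/(er n z) -/(er n (conjc u)).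
  move: (er n z) (er n (conjc u)) (cabs (z - conjc u) ^+ 2) (M ^+ 2) => s t x y.
  by rewrite !ler_norml => /andP[b1 _] /andP[b2 _] b3; lra.
have : expR (- (2 * M ^+ 2 + 1)) * q <= C0.
  apply: le_trans bnd; rewrite mulrAC; exact: ler_wpM2r.
by rewrite expRN mulrC ler_pdivrMr ?expR_gt0.
Qed.

Lemma cK_herm n z w : (0 < n)%N -> cK n z w = conjc (cK n w z).
Proof.
move=> n0; have hKn : K n z w = conjc (K n w z).
  rewrite /K (rescaled_kernelE _ _ _ _ _ z w) (rescaled_kernelE _ _ _ _ _ w z).
  by rewrite (conjCM (_)%:C%C) conjCR -(kernel_herm (hK n0)).
rewrite /cK (conjCM (g n w * conjc (g n z)) (K n w z)) -hKn.
by rewrite (conjCM (g n w)) conjcK (mulrC (conjc (g n w))).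
Qed.

Lemma cK_diag n z : cK n z z = K n z z.
Proof. by rewrite /cK cabs_mulconj gauge_unit expr1n mul1r. Qed.

(** Montel's theorem for [Psi n], whose limit is not affected by the factor
[e^(err)], which tends to [1]. *)
Lemma subsequence_limit phi : increasing phi -> exists psi P,
  [/\ increasing psi, approx2 P &
    forall M d : R, 0 < d -> exists N, forall k, (N <= k)%N -> forall z w : C, cabs z <= M -> cabs w <= M ->
      cabs (cK (phi (psi k)) z w - (ginibre z w : C) * P z (conjc w)) <= d].
Proof.
move=> hphi.
have [||psi [P [hpsi hP aP]]] := @montel_approx R (fun k => Psi (phi k)).
- by move=> k; exact: Psi_approx.
- move=> M; have [B [N h]] := Psi_bounded M; exists B, N => k Nk; apply: h.
  exact: leq_trans Nk (increasing_ge _ hphi).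
exists psi, P; split => // M d d0.
have [B [N1 h1]] := Psi_bounded M.
pose B1 := `|B| + 1; have B10 : 0 < B1 by rewrite ltr_wpDl.
have d2 : 0 < d / 2 by rewrite divr_gt0.
have [N2 h2] := hP M _ d2.
(* [1/4] keeps the exponent in the range of [expR_lip]; the other bound makes the
   factor in [er] contribute at most [d / 2]. *)
pose dd := Num.min (1 / 4) (d / (8 * B1)).
have dd0 : 0 < dd by rewrite lt_min !divr_gt0 // mulr_gt0.
have dd1 : dd <= 1 / 4 by rewrite ge_min lexx.
have dd2 : dd <= d / (8 * B1) by rewrite ge_min lexx orbT.
have [N3 h3] := model_err_small M dd0.
exists (maxn N1 (maxn N2 N3)) => k; rewrite !geq_max => /andP[k1 /andP[k2 k3]] z w hz hw.
have kk : (k <= phi (psi k))%N := leq_trans (increasing_ge k hpsi) (increasing_ge _ hphi).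
set n := phi (psi k) in kk *.
have [n0 hn] := h3 n (leq_trans k3 kk).
have [z1 z2] := hn z hz; have [w1 w2] := hn w hw.
have hw' : cabs (conjc w) <= M by rewrite cabs_conj.
rewrite (Psi_form n0 z1 w1) -mulrA -mulrBr cabsM cabs_ginibre.
set t := expR (er n z + er n w).
apply: le_trans (_ : 1 * cabs (Psi n z (conjc w) * t%:C%C - P z (conjc w)) <= _).
  by apply: ler_wpM2r; [exact: cabs_ge0|rewrite expR_le1 oppr_le0 divr_ge0 ?sqr_ge0].
rewrite mul1r.
have -> : Psi n z (conjc w) * t%:C%C - P z (conjc w) =
   Psi n z (conjc w) * (t - 1)%:C%C + (Psi n z (conjc w) - P z (conjc w)).
  rewrite rmorphB /=; ring.
apply: le_trans (cabsD _ _) _.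
have b1 := h2 k k2 z _ hz hw'; rewrite -/n in b1.
have b2 := h1 n (leq_trans k1 kk) z _ hz hw'.
rewrite cabsM cabs_real.
have s1 : `|er n z + er n w| <= 2 * dd by apply: le_trans (ler_normD _ _) _; lra.
have s2 : `|er n z + er n w| <= 2^-1 by lra.
have b3 : `|t - 1| <= 4 * dd by apply: le_trans (expR_lip s2) _; lra.
have b4 : cabs (Psi n z (conjc w)) <= B1.
  by apply: le_trans b2 _; apply: le_trans (ler_norm B) _; rewrite lerDl.
have b5 : cabs (Psi n z (conjc w)) * `|t - 1| <= B1 * (4 * dd) by apply: ler_pM; rewrite ?cabs_ge0.
have b6 : B1 * (4 * dd) <= d / 2.
  move: dd2; rewrite ler_pdivlMr ?mulr_gt0 // => dd2; lra.
lra.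
Qed.

Section Limit.
Variables (phi : nat -> nat) (P : C -> C -> C).
Hypothesis (hphi : increasing phi).
Hypothesis (hlim : forall z w, ccvg (fun k => cK (phi k) z w) ((ginibre z w : C) * P z (conjc w))).

Let phi_gt0 k : (0 < phi k.+1)%N.
Proof. by apply: leq_trans (increasing_ge _ hphi). Qed.

Lemma limit_herm z w : P z (conjc w) = conjc (P w (conjc z)).
Proof.
have h1 : ccvg (fun k => cK (phi k) z w) (conjc ((ginibre w z : C) * P w (conjc z))).
  move=> d d0; have [N hN] := hlim w z d0; exists N.+1 => k Nk.
  rewrite cK_herm; first by rewrite -rmorphB cabs_conj; apply: hN; exact: ltnW.
  by apply: leq_trans (increasing_ge k hphi); exact: leq_trans Nk.
have := ccvg_unique (hlim z w) h1; rewrite conjCM -ginibre_herm.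
exact: (mulfI (ginibre_neq0 z w)).
Qed.

(** Fatou's lemma: part of the mass may escape to infinity in the limit, so the
identity [rescaled_mass] becomes an inequality. *)
Lemma limit_mass : mass_one (fun z w : Cplx R => P z (conjc w) : Cplx R).
Proof.
move=> z.
(* The index is shifted because the hypotheses concern positive indices only. *)
pose F k (u : plane R) : \bar R := (cabs (K (phi k.+1) z (toC u)) ^+ 2)%:E.
have mF k : measurable_fun setT (F k).
  by have [_ h] := rescaled_mass (theta (phi k.+1)) (phi_gt0 k) e0 (lap_lo (phi_gt0 k)) (hK (phi_gt0 k)) z.
have iF k : (\int[dA R]_u F k u = (complex.Re (K (phi k.+1) z z))%:E)%E.
  by have [h _] := rescaled_mass (theta (phi k.+1)) (phi_gt0 k) e0 (lap_lo (phi_gt0 k)) (hK (phi_gt0 k)) z.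
have sub : forall z w, ccvg (fun k => cK (phi k.+1) z w) ((ginibre z w : C) * P z (conjc w)).
  by move=> x y d /(hlim x y)[N hN]; exists N => k Nk; apply: hN; exact: leqW.
have F0 k u : (0 <= F k u)%E by rewrite lee_fin sqr_ge0.
have fat := @fatou _ _ _ (dA R) setT measurableT F mF (fun k u _ => F0 k u).
have cabs_cvg (x : nat -> C) l : ccvg x l -> (fun k => cabs (x k)) @ \oo --> cabs l.
  move=> hx; apply/cvgrPdist_le => d d0; have [N hN] := hx d d0; exists N => // k Nk /=.
  apply: le_trans (hN k Nk); rewrite ler_norml.
  have h1 := cabsD (x k - l) l; have h2 := cabsD (l - x k) (x k); rewrite !subrK in h1 h2.
  by rewrite (cabsBC l) in h2; apply/andP; split; lra.
have cF u : limn_einf (F^~ u) = (expR (- cabs (z - (toC u : C)) ^+ 2) * cabs (P z (conjc (toC u))) ^+ 2)%:E.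
  have -> : expR (- cabs (z - (toC u : C)) ^+ 2) * cabs (P z (conjc (toC u))) ^+ 2 =
      cabs ((ginibre z (toC u) : C) * P z (conjc (toC u))) ^+ 2.
    by rewrite cabsM cabs_ginibre exprMn -expRM_natl; congr (expR _ * _); field.
  apply: (fst (cvg_limn_einf_sup _)); apply: cvg_EFin; first by apply: nearW.
  have h := cabs_cvg _ _ (sub z (toC u)).
  have -> : fine \o F^~ u = (fun k => cabs (cK (phi k.+1) z (toC u)) * cabs (cK (phi k.+1) z (toC u))).
    by apply/funext => k; rewrite -expr2 (cabs_cK (phi k.+1) z (toC u)).
  by rewrite expr2; exact: (cvgM h h).
have cI : limn_einf (fun k => \int[dA R]_u F k u)%E = (complex.Re (P z (conjc z)))%:E.
  apply: (fst (cvg_limn_einf_sup _)).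
  rewrite (_ : (fun k => _) = (fun k => (complex.Re (K (phi k.+1) z z))%:E)); last first.
    by apply/funext => k; exact: iF.
  apply: cvg_EFin; first by apply: nearW.
  apply/cvgrPdist_le => d d0; have [N hN] := sub z z d d0; exists N => // k Nk /=.
  have := hN k Nk; rewrite cK_diag ginibre_diag mul1r cabsBC; apply: le_trans.
  by rewrite -ReCN -ReCD; exact: cabs_Re.
rewrite cI in fat; apply: le_trans fat; rewrite le_eqVlt; apply/orP; left; apply/eqP.
by apply: eq_integral => u _; rewrite cF.
Qed.
End Limit.

End ScalingLimit.

Theorem theorem1 (R : realType) (Q : Cplx R -> \bar R)
    (sigma : probability (plane R) R)
    (p : nat -> Cplx R) (theta : nat -> R)
    (bK : nat -> Cplx R -> Cplx R -> Cplx R)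
    (hQ : admissible_potential Q)
    (hsigma : is_equilibrium_measure Q sigma)
    (hreg : regular_near Q (supp sigma))
    (hp : forall n, (0 < n)%N -> supp sigma (p n))
    (hbK : forall n, (0 < n)%N ->
       is_reproducing_kernel (weighted_polynomials Q n) (bK n)) :
  let K n := rescaled_kernel Q n (p n) (theta n) (bK n) in
  exists c : nat -> Cplx R -> Cplx R -> Cplx R,
    (forall n, cocycle (c n)) /\
    let cK n := fun z w : Cplx R => c n z w * K n z w in
    (forall phi, increasing phi ->
       exists psi L, increasing psi /\
         cvg_locally_uniformly (fun k => cK (phi (psi k))) L) /\
    (forall phi L, increasing phi ->
       cvg_locally_uniformly (fun k => cK (phi k)) L ->
       exists Psi, [/\ hermitian_entire Psi,
         forall z w, L z w = ginibre z w * Psi z w & mass_one Psi]).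
Proof.
move=> K; have [cS _] := hsigma.
have [e e0 hmod] := uniform_quad_model cS hreg.
(* Index [0] carries no hypothesis and gets junk coefficients. *)
have /choice[ab hab] n : exists ab : R[i]%C * R[i]%C, (0 < n)%N -> forall h : R[i]%C, cabs h <= e ->
   `|fine (Q ((p n : R[i]%C) + h)) - fine (Q (p n)) - complex.Re (ab.1 * h + ab.2 * h ^+ 2)
     - lapQ Q (p n) * cabs h ^+ 2| <= cabs h ^+ 3 / e.
  have [n0|n0] := boolP (0 < n)%N; last by exists (0, 0).
  by have [[_ [al [be h]]] _] := hmod _ (hp n n0); exists (al, be).
pose al n := (ab n).1; pose be n := (ab n).2.
have lap_lo n : (0 < n)%N -> e <= lapQ Q (p n).
  by move=> n0; have [[h _] _] := hmod _ (hp n n0).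
have Qfin n : (0 < n)%N -> forall h : R[i]%C, cabs h <= e -> Q ((p n : R[i]%C) + h) \is a fin_num.
  by move=> n0; have [_ h] := hmod _ (hp n n0).
pose a n := unscale_factor Q n (p n) (theta n).
pose g n (z : R[i]%C) := gauge n (al n) (be n) (a n) z.
exists (fun n z w => g n z * conjc (g n w) : R[i]%C); split=> [n|]; first exact: gauge_cocycle.
have /choice[Psi hPsi] n : exists Psi : R[i]%C -> R[i]%C -> R[i]%C, approx2 Psi /\
    ((0 < n)%N -> forall z w : R[i]%C, cabs (a n * z) <= e -> cabs (a n * w) <= e ->
    g n z * conjc (g n w) * (rescaled_kernel Q n (p n) (theta n) (bK n) z w : R[i]%C) =
      (ginibre z w : R[i]%C) * Psi z (conjc w) *
      (expR (model_err Q n (p n) (theta n) (al n) (be n) z + model_err Q n (p n) (theta n) (al n) (be n) w))%:C%C).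
  have [n0|n0] := boolP (0 < n)%N; last first.
    exists (fun _ _ => 0); split => // M d d0.
    by exists (fun _ _ => 0) => [|z u _ _]; [exact: pol2_cst|rewrite subrr cabs0 ltW].
  by have [P h1 h2] := rescaled_form (theta n) (al n) (be n) e0 (Qfin n n0) (hbK n n0); exists P.
have key := subsequence_limit e0 lap_lo hab Qfin hbK (fun n => proj1 (hPsi n)) (fun n => proj2 (hPsi n)).
move=> cK; split=> [phi hphi|phi L hphi hL].
  have [psi [P [hpsi _ h]]] := key phi hphi.
  exists psi, (fun z w => (ginibre z w : R[i]%C) * P z (conjc w)); split => //.
  apply: cvg_locally_uniformly_cabs => M d d0; have [N hN] := h M d d0.
  by exists N => k Nk z w hz hw; exact: hN.
(* The given limit [L] agrees with the one that the extraction of (i) produces. *)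
have [psi [P [hpsi aP h]]] := key phi hphi.
have hlim z w : ccvg (fun k => cK (phi (psi k)) z w : R[i]%C) ((ginibre z w : R[i]%C) * P z (conjc w)).
  move=> d d0; have [N hN] := h (Num.max (cabs z) (cabs w)) d d0.
  by exists N => k Nk; apply: hN; rewrite ?le_max ?lexx ?orbT.
have hphipsi : increasing (phi \o psi) by move=> i j ij; apply: hphi; exact: hpsi.
exists (fun z w => P z (conjc w)); split.
- split; last first.
    exists (fun zw => P zw.1 zw.2); split => //; exact: approx2_differentiable.
  split; first exact: continuous_conj_diag.
  by move=> z w; exact: (limit_herm hbK hphipsi hlim z w).
- move=> z w; exact: ccvg_unique (ccvg_sub hpsi (cvg_locally_uniformly_pointwise z w hL)) (hlim z w).
- exact: (limit_mass e0 lap_lo hbK hphipsi hlim).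
Qed.
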